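(* Let $M$ be a finite monoid whose idempotents generate an $\mathcal R$-trivial monoid and let $k$ be a field whose characteristic does not divide the order of any maximal subgroup of $M$ and over which each maximal subgroup of $M$ splits. Let $e_1,\ldots,e_n$ be a complete set of idempotent representatives of the regular $\mathcal J$-classes of $M$. Then the quiver of $kM$ is isomorphic to the directed graph that has vertices indexed by pairs $(e_i,[V])$ where $V$ is a simple $kG_{e_i}$-module ($[V]$ its isomorphism class) and edges as follows. If $(e,[V])$ and $(f,[W])$ are two vertices, then the number of arrows from $(e,[V])$ to $(f,[W])$ is the multiplicity of $W\otimes D(V)$ as an irreducible constituent of the $k[G_f\times G_e]$-module $U^\flat$ defined as follows. Let $\equiv$ be the least equivalence relation on $fMe$ such that: (1) $x\equiv y$ if $x,y\in fI(f)I(e)e$; (2) $zx\equiv zy$ if $x,y\in L_e$, $z\in fI(f)$ and $x,y$ act as the same partial injection on the right of $R_e$. Let $X$ be the set of $\equiv$-classes of elements of $fMe$ not meeting $fI(f)I(e)e$; it is a $G_f\times G_e$-set via $(g,h)[x]_\equiv=[gxh^{-1}]_\equiv$. Let $U^\flat$ be the submodule of the permutation module $kX$ spanned by the differences $[x]_\equiv-[y]_\equiv$ with $x,y\in fM\cap L_e$ such that $x$ and $y$ act as the same partial injection on the right of $R_e$, and by those $[z]_\equiv\in X$ such that $z\in(fM\cap\widetilde L_e)\setminus L_e$.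
   Context: Green's relations: $m\,\mathcal L\,n$ iff $Mm=Mn$; $m\,\mathcal R\,n$ iff $mM=nM$; $m\,\mathcal J\,n$ iff $MmM=MnM$; $L_m,R_m,J_m$ are the classes of $m$. A monoid is $\mathcal R$-trivial if all its $\mathcal R$-classes are singletons; ''the idempotents generate an $\mathcal R$-trivial monoid'' means the submonoid generated by the set $E(M)$ of idempotents is $\mathcal R$-trivial. A $\mathcal J$-class is regular if it contains an idempotent. For $e\in E(M)$, $G_e$ is the group of units of $eMe$ (the maximal subgroup at $e$). $m\,\widetilde{\mathcal L}\,n$ iff for all $a\in E(M)$: $ma=m\iff na=n$; $\widetilde L_m$ is the $\widetilde{\mathcal L}$-class of $m$. For $f\in E(M)$, $I(f)=\{m\in M: f\notin MmM\}$. Products of sets are elementwise, e.g. $fI(f)I(e)e=\{fmne: m\in I(f),n\in I(e)\}$. $M$ acts on the right of $R_e$ by partial maps: $r\cdot m=rm$ if $rm\in R_e$, undefined otherwise; for the monoids considered these partial maps are injective. Thus $x,y$ act as the same partial injection on the right of $R_e$ iff for all $r\in R_e$: $rx\in R_e\iff ry\in R_e$, and in that case $rx=ry$. $k$ splits a group $G$ if every simple $kG$-module has endomorphism algebra $k$. $D(V)=\mathrm{Hom}_k(V,k)$ is a right $kG_e$-module, and $W\otimes D(V)$ (tensor over $k$) is a left $k[G_f\times G_e]$-module via $(g,h)(w\otimes\phi)=gw\otimes\phi h^{-1}$. The quiver of a finite dimensional split $k$-algebra $A$ is the directed graph with vertices the isomorphism classes $[S]$ of simple (left) $A$-modules and with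 $\dim\mathrm{Ext}^1_A(S,S')$ arrows from $[S]$ to $[S']$. *)

(* Defs.v *)
From HB Require Import structures.
From mathcomp Require Import all_boot all_order all_algebra.
From mathcomp Require Import fingroup morphism gproduct falgebra.

Set Implicit Arguments.
Unset Strict Implicit.
Unset Printing Implicit Defensive.

Import GRing.Theory.
Local Open Scope ring_scope.

Lemma linfunK (K : fieldType) (U V : vectType K) (f : U -> V) :
  linear f -> linfun f =1 f.
Proof.
move=> fL; pose m := GRing.isLinear.Build _ _ _ _ f fL.
pose F : {linear U -> V} := HB.pack f m.
exact: (lfunE F).
Qed.

Section Modules.
Variables (k : fieldType) (A : falgType k).

Record algmod := AlgMod {
  algmod_sort :> vectType k;
  act : A -> 'End(algmod_sort);
  act_linear : linear act;
  act1 : act 1 = \1%VF;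
  actM : forall a b, act (a * b) = (act a \o act b)%VF }.

Record submodule (V : algmod) := Submodule {
  submod_vs :> {vspace V};
  submod_stable : forall a, (act V a @: submod_vs <= submod_vs)%VS }.

Section Submod.
Variables (V : algmod) (U : submodule V).

Definition submod_act (a : A) : 'End(subvs_of U) :=
  linfun (fun u => vsproj U (act V a (vsval u))).

Lemma submod_actE a u : vsval (submod_act a u) = act V a (vsval u).
Proof.
rewrite linfunK => [|c v w]; last by rewrite !linearP.
rewrite vsprojK //; apply: (subvP (submod_stable U a)).
by rewrite memv_img // subvsP.
Qed.

Fact submod_act_linear : linear submod_act.
Proof.
move=> c a b; apply/lfunP=> u; apply: val_inj => /=.
by rewrite lfunE /= lfunE /= !submod_actE act_linear lfunE /= lfunE.
Qed.

Fact submod_act1 : submod_act 1 = \1%VF.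
Proof.
by apply/lfunP=> u; apply: val_inj; rewrite /= submod_actE act1 !lfunE.
Qed.

Fact submod_actM a b : submod_act (a * b) = (submod_act a \o submod_act b)%VF.
Proof.
apply/lfunP=> u; apply: val_inj.
by rewrite /= submod_actE actM !comp_lfunE !submod_actE.
Qed.

Definition submod : algmod :=
  AlgMod submod_act_linear submod_act1 submod_actM.

End Submod.

Definition simple_mod (V : algmod) : Prop :=
  (fullv : {vspace V}) <> 0%VS /\
  forall U : submodule V, U = 0%VS :> {vspace V} \/ U = fullv :> {vspace V}.

(* Hom_A(V, W), as the kernel of f |-> (a |-> f a - a f). *)
Definition homA (V W : algmod) : {vspace 'Hom(V, W)} :=
  lker (linfun (fun f : 'Hom(V, W) =>
    linfun (fun a : A => (f \o act V a)%VF - (act W a \o f)%VF))).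

Lemma homAP (V W : algmod) (f : 'Hom(V, W)) :
  reflect (forall a v, f (act V a v) = act W a (f v)) (f \in homA V W).
Proof.
have L1 (g : 'Hom(V, W)) :
  linear (fun a : A => (g \o act V a)%VF - (act W a \o g)%VF).
  move=> c a b; rewrite !act_linear; apply/lfunP=> v.
  by do !rewrite ?lfunE /=; rewrite !linearP /= scalerDr addrACA.
have L2 : linear (fun g : 'Hom(V, W) =>
    linfun (fun a : A => (g \o act V a)%VF - (act W a \o g)%VF)).
  move=> c g h; apply/lfunP=> a; rewrite add_lfunE scale_lfunE !linfunK //.
  apply/lfunP=> v; do !rewrite ?lfunE /=.
  by rewrite !linearP /= scalerDr addrACA.
rewrite memv_ker (linfunK L2); apply: (iffP eqP) => [f0 a v|fA].
  have := congr1 (fun F : 'Hom(A, 'Hom(V, W)) => F a v) f0.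
  by rewrite /= (linfunK (L1 f)); do !rewrite ?lfunE /=; move/eqP; rewrite subr_eq0 => /eqP.
apply/lfunP=> a; rewrite (linfunK (L1 f)); apply/lfunP=> v.
by do !rewrite ?lfunE /=; rewrite fA subrr.
Qed.

Definition isomod (V W : algmod) : Prop :=
  exists2 f : 'Hom(V, W), f \in homA V W & bijective f.

Section FreeModule.
Variable n : nat.

Definition free_act (a : A) : 'End({ffun 'I_n -> A}) :=
  linfun (fun x : {ffun 'I_n -> A} => [ffun i => a * x i]).

Lemma free_actE a x i : free_act a x i = a * x i.
Proof.
rewrite linfunK ?ffunE // => c u v; apply/ffunP=> j.
by rewrite !ffunE mulrDr scalerAr.
Qed.

Fact free_act_linear : linear free_act.
Proof.
move=> c a b; apply/lfunP=> x; apply/ffunP=> i.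
by rewrite lfunE /= lfunE /= !ffunE !free_actE mulrDl scalerAl.
Qed.

Fact free_act1 : free_act 1 = \1%VF.
Proof. by apply/lfunP=> x; apply/ffunP=> i; rewrite free_actE mul1r lfunE. Qed.

Fact free_actM a b : free_act (a * b) = (free_act a \o free_act b)%VF.
Proof.
by apply/lfunP=> x; apply/ffunP=> i; rewrite comp_lfunE !free_actE mulrA.
Qed.

Definition free_mod : algmod := AlgMod free_act_linear free_act1 free_actM.

End FreeModule.

Lemma ker_stable (V W : algmod) (f : 'Hom(V, W)) (fA : f \in homA V W) a :
  (act V a @: lker f <= lker f)%VS.
Proof.
apply/subvP=> _ /memv_imgP[v vK ->]; move: vK; rewrite !memv_ker => /eqP v0.
by rewrite (homAP _ fA) v0 linear0.
Qed.

(* The free cover A^d -> S, d = dim S, mapping the i-th basis vector of A^d   *)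
(* to the i-th vector of a k-basis of S.                                      *)
Definition free_cover (S : algmod) : 'Hom(free_mod (\dim {:S}), S) :=
  linfun (fun x : {ffun 'I_(\dim {:S}) -> A} =>
    \sum_i act S (x i) (vbasis {:S})`_i).

Lemma free_coverE (S : algmod) (x : {ffun 'I_(\dim {:S}) -> A}) :
  free_cover S x = \sum_i act S (x i) (vbasis {:S})`_i.
Proof.
rewrite linfunK // => c u v; rewrite scaler_sumr -big_split /=.
by apply: eq_bigr => i _; rewrite !ffunE act_linear !lfunE /= !lfunE.
Qed.

Fact free_cover_homA (S : algmod) :
  free_cover S \in homA (free_mod (\dim {:S})) S.
Proof.
apply/homAP=> a x; rewrite !free_coverE linear_sum /=.
by apply: eq_bigr => i _; rewrite free_actE actM lfunE.
Qed.

Fact free_cover_surj (S : algmod) : limg (free_cover S) = fullv.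
Proof.
apply/vspaceP=> v; rewrite memvf; apply/memv_imgP.
pose x : {ffun 'I_(\dim {:S}) -> A} := [ffun i => (coord (vbasis {:S}) i v)%:A].
exists x; first exact: memvf.
rewrite free_coverE {1}(coord_vbasis (memvf v)); apply: eq_bigr => i _.
have a0 : act S 0 = 0.
  by have := act_linear S (-1) 0 0; rewrite scaler0 addr0 scaleN1r addNr.
by rewrite ffunE -[_%:A]addr0 act_linear act1 a0 addr0 scale_lfunE id_lfunE.
Qed.

Definition syzygy_submodule (S : algmod) : submodule (free_mod (\dim {:S})) :=
  Submodule (ker_stable (free_cover_homA S)).

Definition syzygy (S : algmod) : algmod := submod (syzygy_submodule S).

Definition syzygy_incl (S : algmod) :
    'Hom(syzygy S, free_mod (\dim {:S})) :=
  linfun (vsval : subvs_of (lker (free_cover S)) -> _).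

(* Ext^1_A(S, T) is the cokernel of the restriction map Hom_A(F, T) ->        *)
(* Hom_A(K, T), where 0 -> K -> F -> S -> 0 is exact and F is free; the       *)
(* subtraction below is exact, the image lying inside Hom_A(K, T).            *)
Definition ext1_dim (S T : algmod) : nat :=
  (\dim (homA (syzygy S) T) -
   \dim (linfun (fun f : 'Hom(free_mod (\dim {:S}), T) =>
           (f \o syzygy_incl S)%VF) @: homA (free_mod (\dim {:S})) T))%N.

Section Generated.
Variables (V : algmod) (s : seq V).

Definition gen_vs : {vspace V} :=
  (\sum_(v <- s) linfun (fun a : A => act V a v) @: fullv)%VS.

Fact gen_stable a : (act V a @: gen_vs <= gen_vs)%VS.
Proof.
have lin v : linear (fun a : A => act V a v).
  by move=> c b d; rewrite act_linear !lfunE /= !lfunE.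
rewrite /gen_vs; elim: s => [|v r IHr]; first by rewrite big_nil limg0.
rewrite big_cons limgD; apply: addvS => //.
apply/subvP=> _ /memv_imgP[_ /memv_imgP[b _ ->] ->]; apply/memv_imgP.
by exists (a * b); rewrite ?memvf // !linfunK // actM lfunE.
Qed.

Definition gen_submodule : submodule V := Submodule gen_stable.

End Generated.

(* S occurs exactly m times in a decomposition of U as a direct sum of simple *)
(* submodules.                                                                *)
Definition has_multiplicity (U S : algmod) (m : nat) : Prop :=
  exists (r : nat) (N : 'I_r -> submodule U) (J : {set 'I_r}),
    [/\ forall i, simple_mod (submod (N i)),
        directv (\sum_i N i)%VS /\ (\sum_i N i)%VS = fullv,
        forall i, i \in J <-> isomod (submod (N i)) S
      & #|J| = m].

End Modules.

(* Directed multigraph whose vertices are taken up to the equivalence         *)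
(* vertex_eq; arrows v w n says that there are exactly n arrows from v to w.  *)
Record digraph := Digraph {
  vertex : Type;
  vertex_eq : vertex -> vertex -> Prop;
  arrows : vertex -> vertex -> nat -> Prop }.

Definition digraph_iso (Q R : digraph) : Prop :=
  exists f : vertex Q -> vertex R,
    [/\ forall v w, vertex_eq v w <-> vertex_eq (f v) (f w),
        forall w, exists v, vertex_eq (f v) w
      & forall v w n, arrows v w n <-> arrows (f v) (f w) n].

(* Every simple A-module is finite dimensional, so algmod misses none.        *)
Definition quiver (k : fieldType) (A : falgType k) : digraph :=
  Digraph (fun S T : {S : algmod A | simple_mod S} => isomod (sval S) (sval T))
          (fun S T n => ext1_dim (sval S) (sval T) = n).

Record finMonoid := FinMonoid {
  fm_sort :> Type;
  fm_finite : Finite fm_sort;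
  fm_mul : fm_sort -> fm_sort -> fm_sort;
  fm_one : fm_sort;
  fm_mulA : associative fm_mul;
  fm_mul1m : left_id fm_one fm_mul;
  fm_mulm1 : right_id fm_one fm_mul }.

HB.instance Definition _ (M : finMonoid) : Finite (fm_sort M) := fm_finite M.
HB.instance Definition _ (M : finMonoid) :=
  isMonoid.Build (fm_sort M) (@fm_mulA M) (@fm_mul1m M) (@fm_mulm1 M).

Definition group_monoid (G : finGroupType) : finMonoid :=
  FinMonoid (Finite.class G) (@mulgA G) (@mul1g G) (@mulg1 G).

Section MonoidAlgebra.
Variables (k : fieldType) (M : finMonoid).

Definition malg := {ffun M -> k^o}.
HB.instance Definition _ := Vector.copy malg {ffun M -> k^o}.

Definition malg_coef (a : malg) (m : M) : k := (a : {ffun M -> k^o}) m.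

Definition malg_elt (m : M) : malg := [ffun x => (x == m)%:R] : {ffun M -> k^o}.

Definition malg_mul (a b : malg) : malg :=
  [ffun z => \sum_(p : M * M | (p.1 * p.2)%g == z)
               malg_coef a p.1 * malg_coef b p.2] : {ffun M -> k^o}.

Fact malg_coefD a b m : malg_coef (a + b) m = malg_coef a m + malg_coef b m.
Proof. by rewrite /malg_coef ffunE. Qed.

Fact malg_coefZ c a m : malg_coef (c *: a) m = c * malg_coef a m.
Proof. by rewrite /malg_coef ffunE. Qed.

Fact malg_coef_elt x y : malg_coef (malg_elt x) y = (y == x)%:R.
Proof. by rewrite /malg_coef ffunE. Qed.

Lemma malg_expand a : a = \sum_m malg_coef a m *: malg_elt m.
Proof.
apply/ffunP=> x; rewrite sum_ffunE (bigD1 x) //= big1 => [|y ne].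
  by rewrite !ffunE eqxx addr0 [_ *: _]mulr1.
by rewrite !ffunE eq_sym (negbTE ne) [_ *: _]mulr0.
Qed.

Fact malg_mulE a b z : malg_coef (malg_mul a b) z =
  \sum_(p : M * M | (p.1 * p.2)%g == z) malg_coef a p.1 * malg_coef b p.2.
Proof. by rewrite {1}/malg_coef ffunE. Qed.

Fact malgP a b : malg_coef a =1 malg_coef b -> a = b.
Proof. by move=> ab; apply/ffunP. Qed.

Fact malg_mulDl : left_distributive malg_mul +%R.
Proof.
move=> a b c; apply: malgP => z; rewrite malg_coefD !malg_mulE -big_split /=.
by apply: eq_bigr => p _; rewrite malg_coefD mulrDl.
Qed.

Fact malg_mulDr : right_distributive malg_mul +%R.
Proof.
move=> a b c; apply: malgP => z; rewrite malg_coefD !malg_mulE -big_split /=.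
by apply: eq_bigr => p _; rewrite malg_coefD mulrDr.
Qed.

Fact malg_mulZl c a b : c *: malg_mul a b = malg_mul (c *: a) b.
Proof.
apply: malgP => z; rewrite malg_coefZ !malg_mulE mulr_sumr.
by apply: eq_bigr => p _; rewrite malg_coefZ mulrA.
Qed.

Fact malg_mulZr c a b : c *: malg_mul a b = malg_mul a (c *: b).
Proof.
apply: malgP => z; rewrite malg_coefZ !malg_mulE mulr_sumr.
by apply: eq_bigr => p _; rewrite malg_coefZ mulrCA.
Qed.

Lemma malg_mul_elt x y : malg_mul (malg_elt x) (malg_elt y) = malg_elt (x * y)%g.
Proof.
apply: malgP => z; rewrite malg_mulE malg_coef_elt big_mkcond (bigD1 (x, y)) //=.
rewrite big1 => [|[u v] /=].
  by rewrite !malg_coef_elt !eqxx mulr1 addr0 eq_sym; case: eqP.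
rewrite xpair_eqE negb_and !malg_coef_elt.
by move=> ne; case: ifP => // _; case/orP: ne => /negbTE->; rewrite (mul0r, mulr0).
Qed.

Fact malg_mul0l b : malg_mul 0 b = 0.
Proof. by rewrite -(scale0r (0 : malg)) -malg_mulZl !scale0r. Qed.

Fact malg_mul0r b : malg_mul b 0 = 0.
Proof. by rewrite -(scale0r (0 : malg)) -malg_mulZr !scale0r. Qed.

Lemma malg_mul_suml (I : finType) (F : I -> malg) b :
  malg_mul (\sum_i F i) b = \sum_i malg_mul (F i) b.
Proof. exact: (big_morph (malg_mul^~ b) (fun x y => malg_mulDl x y b) (malg_mul0l b)). Qed.

Lemma malg_mul_sumr (I : finType) (F : I -> malg) b :
  malg_mul b (\sum_i F i) = \sum_i malg_mul b (F i).
Proof. exact: (big_morph (malg_mul b) (malg_mulDr b) (malg_mul0r b)). Qed.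

Fact malg_mulA : associative malg_mul.
Proof.
move=> a b c; rewrite [a]malg_expand !malg_mul_suml; apply: eq_bigr => x _.
rewrite -!malg_mulZl; congr (_ *: _); rewrite [b]malg_expand.
rewrite !(malg_mul_suml, malg_mul_sumr); apply: eq_bigr => y _.
rewrite -!(malg_mulZl, malg_mulZr); congr (_ *: _); rewrite [c]malg_expand.
rewrite !malg_mul_sumr; apply: eq_bigr => z _.
by rewrite -!malg_mulZr !malg_mul_elt mulgA.
Qed.

Fact malg_mul1l : left_id (malg_elt 1%g) malg_mul.
Proof.
move=> a; rewrite [a]malg_expand malg_mul_sumr; apply: eq_bigr => x _.
by rewrite -malg_mulZr malg_mul_elt mul1g.
Qed.

Fact malg_mul1r : right_id (malg_elt 1%g) malg_mul.
Proof.
move=> a; rewrite [a]malg_expand malg_mul_suml; apply: eq_bigr => x _.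
by rewrite -malg_mulZl malg_mul_elt mulg1.
Qed.

Fact malg_1neq0 : malg_elt 1%g != 0.
Proof.
apply/eqP=> /(congr1 (fun a => malg_coef a 1%g)); move/eqP.
by rewrite malg_coef_elt eqxx /malg_coef ffunE oner_eq0.
Qed.

HB.instance Definition _ := GRing.Zmodule_isNzRing.Build malg
  malg_mulA malg_mul1l malg_mul1r malg_mulDl malg_mulDr malg_1neq0.
HB.instance Definition _ := GRing.Lmodule_isLalgebra.Build k malg malg_mulZl.
HB.instance Definition _ := GRing.Lalgebra_isAlgebra.Build k malg malg_mulZr.
HB.instance Definition _ := Algebra_isFalgebra.Build k malg.

Section Linearize.
Variables (V : vectType k) (rho : M -> 'End(V)).
Hypothesis rho1 : rho 1%g = \1%VF.
Hypothesis rhoM : forall x y, rho (x * y)%g = (rho x \o rho y)%VF.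

Definition lin_act (a : malg) : 'End(V) := \sum_m malg_coef a m *: rho m.

Fact lin_act_linear : linear lin_act.
Proof.
move=> c a b; rewrite /lin_act scaler_sumr -big_split /=.
by apply: eq_bigr => m _; rewrite malg_coefD malg_coefZ scalerDl scalerA.
Qed.

Lemma lin_act_elt m : lin_act (malg_elt m) = rho m.
Proof.
rewrite /lin_act (bigD1 m) //= malg_coef_elt eqxx scale1r big1 ?addr0 // => x ne.
by rewrite malg_coef_elt (negbTE ne) scale0r.
Qed.

Fact lin_act1 : lin_act 1 = \1%VF.
Proof. by rewrite lin_act_elt rho1. Qed.

Fact lin_actM a b : lin_act (a * b) = (lin_act a \o lin_act b)%VF.
Proof.
have a0 : lin_act 0 = 0.
  by have := lin_act_linear (-1) 0 0; rewrite scaler0 addr0 scaleN1r addNr.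
have Z c d : lin_act (c *: d) = c *: lin_act d.
  by rewrite -[c *: d]addr0 lin_act_linear a0 addr0.
have D : {morph lin_act : u v / u + v}.
  by move=> u v; rewrite -[u]scale1r lin_act_linear !scale1r.
have -> : a * b = \sum_x \sum_y
    (malg_coef a x * malg_coef b y) *: malg_elt (x * y)%g.
  transitivity (malg_mul a b); first by [].
  rewrite {1}(malg_expand a) malg_mul_suml.
  apply: eq_bigr => x _; rewrite {1}(malg_expand b) malg_mul_sumr.
  by apply: eq_bigr => y _; rewrite -malg_mulZr -malg_mulZl malg_mul_elt scalerA mulrC.
rewrite (big_morph _ D a0).
apply/lfunP=> v; rewrite comp_lfunE [lin_act a]/lin_act !sum_lfunE.
apply: eq_bigr => x _; rewrite (big_morph _ D a0) sum_lfunE scale_lfunE.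
rewrite linear_sum scaler_sumr /=.
apply: eq_bigr => y _; rewrite Z lin_act_elt rhoM !scale_lfunE comp_lfunE.
by rewrite linearZ /= scalerA.
Qed.

Definition lin_mod : algmod malg := AlgMod lin_act_linear lin_act1 lin_actM.

End Linearize.

End MonoidAlgebra.

Section Green.
Variable M : finMonoid.
Implicit Types (x y z m n : M) (S T : {set M}).
Local Open Scope group_scope.

Definition lideal m : {set M} := [set x * m | x : M].
Definition rideal m : {set M} := [set m * x | x : M].
Definition ideal m : {set M} := [set x * m * y | x : M, y : M].

Definition Lclass m : {set M} := [set n : M | lideal n == lideal m].
Definition Rclass m : {set M} := [set n : M | rideal n == rideal m].
Definition Jclass m : {set M} := [set n : M | ideal n == ideal m].

Definition idempotents : {set M} := [set a : M | a * a == a].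

Definition Ltilde_class m : {set M} :=
  [set n : M | [forall a in idempotents, (n * a == n) == (m * a == m)]].

Definition regular_Jclass m : Prop := exists2 a, a \in idempotents & a \in Jclass m.

Definition submonoid S : bool :=
  (1 \in S) && [forall x in S, forall y in S, x * y \in S].

Definition gen_submonoid S : {set M} :=
  \bigcap_(T : {set M} | submonoid T && (S \subset T)) T.

(* The R-relation is the one of the submonoid S, not of M. *)
Definition Rtrivial S : Prop :=
  {in S &, forall x y, [set x * s | s in S] = [set y * s | s in S] -> x = y}.

Definition idem : Type := {a : M | a \in idempotents}.
HB.instance Definition _ := Finite.copy idem {a : M | a \in idempotents}.
Definition idem_val (a : idem) : M := sval a.
Coercion idem_val : idem >-> fm_sort.

Definition corner m : {set M} := [set m * x * m | x : M].

Definition unit_set m : {set M} :=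
  [set x : M in corner m | [exists y in corner m, (x * y == m) && (y * x == m)]].

Lemma idemP (a : idem) : (a : M) * (a : M) = (a : M).
Proof. by apply/eqP; have := valP a; rewrite inE. Qed.

Lemma cornerP e x : e * e = e ->
  reflect (e * x = x /\ x * e = x) (x \in corner e).
Proof.
move=> ee; apply: (iffP imsetP) => [[y _ ->]|[ex xe]]; last by exists x; rewrite // ex xe.
by rewrite !mulgA ee -!mulgA ee.
Qed.

Lemma unit_setP e x :
  reflect (x \in corner e /\ exists2 y, y \in corner e & x * y = e /\ y * x = e)
          (x \in unit_set e).
Proof.
rewrite inE; apply: (iffP andP) => -[xC H]; split=> //.
  by case/exists_inP: H => y yC /andP[/eqP ? /eqP ?]; exists y.
by case: H => y yC [xy yx]; apply/exists_inP; exists y; rewrite // xy yx eqxx.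
Qed.

End Green.

Section MaximalSubgroup.
Variables (M : finMonoid) (e : idem M).
Local Open Scope group_scope.

Definition max_subgroup : Type := {x : M | x \in unit_set e}.
HB.instance Definition _ := Finite.copy max_subgroup {x : M | x \in unit_set e}.
Definition ms_val (g : max_subgroup) : M := sval g.
Coercion ms_val : max_subgroup >-> fm_sort.

Lemma ms_inj (g h : max_subgroup) : g = h :> M -> g = h.
Proof. exact: val_inj. Qed.

Lemma ms_mul_e (g : max_subgroup) : (e : M) * (g : M) = (g : M) /\ (g : M) * (e : M) = (g : M).
Proof. by case: g => x /= /unit_setP[/(cornerP _ (idemP e))]. Qed.

Fact ms_one_subproof : (e : M) \in unit_set e.
Proof.
have ee := idemP e; have eC : (e : M) \in corner e by apply/cornerP.
by apply/unit_setP; split=> //; exists (e : M).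
Qed.

Fact ms_mul_subproof (g h : max_subgroup) : (g : M) * (h : M) \in unit_set e.
Proof.
have cP := cornerP _ (idemP e).
case: g h => [x xU] [y yU] /=.
case/unit_setP: xU => /cP[ex xe] [x' /cP[ex' xe'] [xx' x'x]].
case/unit_setP: yU => /cP[ey ye] [y' /cP[ey' ye'] [yy' y'y]].
apply/unit_setP; split; first by apply/cP; rewrite mulgA ex -mulgA ye.
exists (y' * x'); first by apply/cP; rewrite mulgA ey' -mulgA xe'.
by rewrite -!mulgA (mulgA y) yy' ex' xx' (mulgA x') x'x ey y'y.
Qed.

Definition ms_one : max_subgroup := exist _ (e : M) ms_one_subproof.
Definition ms_mul (g h : max_subgroup) : max_subgroup :=
  exist _ ((g : M) * (h : M)) (ms_mul_subproof g h).
Definition ms_inv (g : max_subgroup) : max_subgroup :=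
  odflt g [pick h | ms_mul h g == ms_one].

Fact ms_mulA : associative ms_mul.
Proof. by move=> g h l; apply: ms_inj; exact: (mulgA (g : M)). Qed.

Fact ms_mul1 : left_id ms_one ms_mul.
Proof. by move=> g; apply: ms_inj; case: (ms_mul_e g). Qed.

Fact ms_mulV : left_inverse ms_one ms_inv ms_mul.
Proof.
move=> g; rewrite /ms_inv; case: pickP => [h /eqP //|/= no].
case: g no => x xU no; case/unit_setP: (xU) => xC [y yC [xy yx]].
have yU : y \in unit_set e by apply/unit_setP; split=> //; exists x.
by case/eqP: (no (exist _ y yU)); apply: ms_inj.
Qed.

HB.instance Definition _ :=
  Finite_isGroup.Build max_subgroup ms_mulA ms_mul1 ms_mulV.

Lemma ms_valM (g h : max_subgroup) : ms_val (g * h) = (g : M) * (h : M).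
Proof. by []. Qed.

Lemma ms_val1 : ms_val 1 = (e : M).
Proof. by []. Qed.

End MaximalSubgroup.

Section TheGSet.
Variables (M : finMonoid) (e f : M).
Implicit Types (x y z m n : M) (C : {set M}).
Local Open Scope group_scope.

Definition Iset (a : M) : {set M} := [set m : M | a \notin ideal m].

Definition fI : {set M} := [set f * m | m in Iset f].
Definition fIIe : {set M} := [set f * m * n * e | m in Iset f, n in Iset e].
Definition fMe : {set M} := [set f * m * e | m : M].
Definition fM_Le : {set M} := rideal f :&: Lclass e.
Definition fM_Lte : {set M} := rideal f :&: Ltilde_class e.

Definition same_on_Re x y : bool :=
  [forall r in Rclass e,
    ((r * x \in Rclass e) == (r * y \in Rclass e)) &&
    ((r * x \in Rclass e) ==> (r * x == r * y))].

Definition equiv_gen x y : bool :=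
  (x \in fIIe) && (y \in fIIe) ||
  [exists z in fI, exists x' in Lclass e, exists y' in Lclass e,
    [&& same_on_Re x' y', x == z * x' & y == z * y']].

Lemma equiv_gen_sym : symmetric equiv_gen.
Proof.
suff S x y : equiv_gen x y -> equiv_gen y x by move=> x y; apply/idP/idP; apply: S.
case/orP=> [|/exists_inP[z zI /exists_inP[x' Lx /exists_inP[y' Ly /and3P[s Ex Ey]]]]].
  by rewrite andbC /equiv_gen => ->.
apply/orP; right; apply/exists_inP; exists z => //; apply/exists_inP; exists y' => //.
apply/exists_inP; exists x' => //; rewrite Ex Ey !andbT.
apply/forall_inP=> r Rr; have /forall_inP/(_ r Rr)/andP[/eqP E /implyP I] := s.
by rewrite -E eqxx; apply/implyP=> /I; rewrite eq_sym.
Qed.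

(* connect is the reflexive-transitive closure; since equiv_gen is symmetric  *)
(* it is the least equivalence relation containing it.                        *)
Definition equiv : rel M := connect equiv_gen.

Lemma equiv_equivalence : equivalence_rel equiv.
Proof.
apply/equivalence_relP; split=> [x|x y]; first exact: connect0.
by apply: same_connect; apply: sym_connect_sym; exact: equiv_gen_sym.
Qed.

Definition equiv_class x : {set M} := [set y : M in fMe | equiv x y].

Definition Xset : {set {set M}} :=
  [set C in [set equiv_class x | x in fMe] | [disjoint C & fIIe]].

Definition X : Type := {C : {set M} | C \in Xset}.
HB.instance Definition _ := Finite.copy X {C : {set M} | C \in Xset}.

End TheGSet.

Section Action.
Variables (M : finMonoid) (e f : idem M).
Implicit Types (x y z m n r t : M) (C : {set M}).
Local Open Scope group_scope.

Local Notation Gfe := (max_subgroup f * max_subgroup e)%type.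

Definition biact (p : Gfe) x : M := ms_val p.1 * x * ms_val p.2^-1.

Lemma idealP m n : reflect (exists x y, n = x * m * y) (n \in ideal m).
Proof.
apply: (iffP imset2P) => [[x y _ _ ->]|[x [y ->]]]; first by exists x, y.
by exists x y.
Qed.

Lemma LclassP m n :
  reflect ((exists x, n = x * m) /\ (exists y, m = y * n)) (n \in Lclass m).
Proof.
rewrite inE; apply: (iffP eqP) => [E|[[x nE] [y mE]]].
  have self t : t \in lideal t by apply/imsetP; exists 1; rewrite ?mul1g.
  have := self n; rewrite E => /imsetP[x _ nE].
  by have := self m; rewrite -E => /imsetP[y _ mE]; split; [exists x | exists y].
apply/setP=> t; apply/imsetP/imsetP => -[a _ ->].
  by exists (a * x); rewrite // nE mulgA.
by exists (a * y); rewrite // {1}mE mulgA.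
Qed.

Lemma RclassP m n :
  reflect ((exists x, n = m * x) /\ (exists y, m = n * y)) (n \in Rclass m).
Proof.
rewrite inE; apply: (iffP eqP) => [E|[[x nE] [y mE]]].
  have self t : t \in rideal t by apply/imsetP; exists 1; rewrite ?mulg1.
  have := self n; rewrite E => /imsetP[x _ nE].
  by have := self m; rewrite -E => /imsetP[y _ mE]; split; [exists x | exists y].
apply/setP=> t; apply/imsetP/imsetP => -[a _ ->].
  by exists (x * a); rewrite // nE mulgA.
by exists (y * a); rewrite // {1}mE mulgA.
Qed.

Lemma Iset_mul a x m y : m \in Iset a -> x * m * y \in Iset a.
Proof.
rewrite !inE; apply: contra => /idealP[u [v ->]]; apply/idealP.
by exists (u * x), (y * v); rewrite !mulgA.
Qed.

Lemma msV (a : idem M) (u : max_subgroup a) :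
  ms_val u * ms_val u^-1 = idem_val a.
Proof. by rewrite -ms_valM mulgV. Qed.

Lemma Lclass_mulr x (u : max_subgroup e) :
  x \in Lclass e -> x * ms_val u \in Lclass e.
Proof.
have [eu ue] := ms_mul_e u.
case/LclassP=> -[a xE] [b eE]; apply/LclassP; split.
  by exists (a * ms_val u); rewrite xE -!mulgA eu ue.
exists (ms_val u^-1 * b); rewrite -mulgA (mulgA b) -eE eu.
by rewrite -ms_valM mulVg.
Qed.

Lemma Rclass_mulr t (u : max_subgroup e) : t * idem_val e = t ->
  (t * ms_val u \in Rclass e) = (t \in Rclass e).
Proof.
have main t1 (v : max_subgroup e) : t1 \in Rclass e -> t1 * idem_val e = t1 ->
    t1 * ms_val v \in Rclass e.
  case/RclassP=> -[a tE] [b eE] te; apply/RclassP; split.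
    by exists (a * ms_val v); rewrite tE mulgA.
  exists (ms_val v^-1 * b).
  by rewrite -mulgA (mulgA (ms_val v)) msV mulgA te.
move=> te; apply/idP/idP => [tu|tR]; last exact: main.
have -> : t = t * ms_val u * ms_val u^-1 by rewrite -mulgA msV te.
by apply: main => //; case: (ms_mul_e u) => _ ue; rewrite -mulgA ue.
Qed.

Lemma Lclass_e x : x \in Lclass e -> x * idem_val e = x.
Proof. by case/LclassP=> -[a ->] _; rewrite -mulgA idemP. Qed.

Lemma same_on_Re_mulr x y (u : max_subgroup e) :
  x \in Lclass e -> y \in Lclass e -> same_on_Re e x y ->
  same_on_Re e (x * ms_val u) (y * ms_val u).
Proof.
move=> Lx Ly /forall_inP s; apply/forall_inP=> r Rr.
have /andP[/eqP E /implyP I] := s r Rr.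
rewrite !mulgA !Rclass_mulr -?mulgA ?Lclass_e // E eqxx /=.
by apply/implyP=> ry; rewrite !mulgA (eqP (I _)) // E.
Qed.

Lemma fI_mull z (g : max_subgroup f) : z \in fI f -> ms_val g * z \in fI f.
Proof.
have [fg gf] := ms_mul_e g.
case/imsetP=> m mI ->; apply/imsetP; exists (ms_val g * m).
  by rewrite -[_ * m]mulg1 Iset_mul.
by rewrite !mulgA gf fg.
Qed.

Lemma biact_fIIe p x : x \in fIIe e f -> biact p x \in fIIe e f.
Proof.
have [fg gf] := ms_mul_e p.1; have [eh he] := ms_mul_e (p.2^-1).
case/imset2P=> m n mI nI ->.
apply/imset2P; exists (ms_val p.1 * m) (n * ms_val p.2^-1).
- by rewrite -[_ * m]mulg1 Iset_mul.
- by rewrite -[_ * _]mul1g mulgA Iset_mul.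
by rewrite /biact !mulgA gf fg -!mulgA eh he.
Qed.

Lemma biact_fMe p x : x \in fMe e f -> biact p x \in fMe e f.
Proof.
have [fg gf] := ms_mul_e p.1; have [eh he] := ms_mul_e (p.2^-1).
case/imsetP=> m _ ->; apply/imsetP; exists (biact p m) => //.
by rewrite /biact !mulgA gf fg -!mulgA eh he.
Qed.

Lemma biactM p q x : biact p (biact q x) = biact (p * q) x.
Proof. by rewrite /biact /= invMg !ms_valM !mulgA. Qed.

Lemma fMeP x : x \in fMe e f -> idem_val f * x = x /\ x * idem_val e = x.
Proof. by case/imsetP=> m _ ->; rewrite !mulgA idemP -!mulgA idemP. Qed.

Lemma biact1 x : x \in fMe e f -> biact 1 x = x.
Proof. by case/fMeP=> fx xe; rewrite /biact /= invg1 !ms_val1 fx xe. Qed.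

Lemma equiv_gen_fMe x y : equiv_gen e f x y -> x \in fMe e f.
Proof.
have fIIeS t : t \in fIIe e f -> t \in fMe e f.
  by case/imset2P=> m n _ _ ->; apply/imsetP; exists (m * n); rewrite // !mulgA.
case/orP=> [/andP[/fIIeS //]|].
case/exists_inP=> z /imsetP[m _ ->] /exists_inP[x' Lx /exists_inP[y' _]].
case/and3P=> _ /eqP -> _; apply/imsetP; exists (m * x') => //.
by rewrite -{1}(Lclass_e Lx) !mulgA.
Qed.

Lemma biact_equiv_gen p x y :
  equiv_gen e f x y -> equiv_gen e f (biact p x) (biact p y).
Proof.
case/orP=> [/andP[xI yI]|].
  by apply/orP; left; rewrite !biact_fIIe.
case/exists_inP=> z zI /exists_inP[x' Lx /exists_inP[y' Ly]].
case/and3P=> s /eqP -> /eqP ->; apply/orP; right.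
apply/exists_inP; exists (ms_val p.1 * z); first exact: fI_mull.
apply/exists_inP; exists (x' * ms_val p.2^-1); first exact: Lclass_mulr.
apply/exists_inP; exists (y' * ms_val p.2^-1); first exact: Lclass_mulr.
by rewrite same_on_Re_mulr // /biact !mulgA !eqxx.
Qed.

Lemma biact_equiv p x y : equiv e f x y -> equiv e f (biact p x) (biact p y).
Proof.
case/connectP=> s; elim: s x => [|t s IHs] x /=; first by move=> _ ->; exact: connect0.
case/andP=> xt ts yE; apply: connect_trans (IHs _ ts yE).
exact/connect1/biact_equiv_gen.
Qed.

Lemma biact_class p x : x \in fMe e f ->
  [set biact p y | y in equiv_class e f x] = equiv_class e f (biact p x).
Proof.
move=> xM; apply/setP=> w; apply/imsetP/idP => [[y]|].
  by rewrite !inE => /andP[yM xy] ->; rewrite biact_fMe // biact_equiv.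
rewrite inE => /andP[wM xw]; exists (biact p^-1 w).
  rewrite inE biact_fMe //= -[x]biact1 // -(mulVg p) -biactM.
  exact: biact_equiv.
by rewrite biactM mulgV biact1.
Qed.

Fact biact_X_subproof p C :
  C \in Xset e f -> [set biact p x | x in C] \in Xset e f.
Proof.
rewrite !inE => /andP[/imsetP[x xM ->] dis]; rewrite biact_class //.
apply/andP; split; first by apply/imsetP; exists (biact p x); rewrite ?biact_fMe.
apply/pred0Pn => -[w /= /andP[]]; rewrite inE => /andP[wM xw] wI.
case/pred0Pn: dis; exists (biact p^-1 w); rewrite /= biact_fIIe // andbT.
rewrite inE biact_fMe //= -[x]biact1 // -(mulVg p) -biactM.
exact: biact_equiv.
Qed.

Lemma Lclass_fIIe x : x \in Lclass e -> x \notin fIIe e f.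
Proof.
case/LclassP=> _ [y eE]; apply/negP=> /imset2P[m n _ nI xE]; move: nI; rewrite inE.
case/negP; apply/idealP; exists (y * idem_val f * m), (idem_val e).
by rewrite {1}eE xE !mulgA.
Qed.

Lemma equiv_gen_Lclass x y :
  equiv_gen e f x y -> x \in Lclass e -> y \in Lclass e.
Proof.
case/orP=> [/andP[xI _] /Lclass_fIIe|]; first by rewrite xI.
case/exists_inP=> z _ /exists_inP[x' _ /exists_inP[y' Ly]].
case/and3P=> /forall_inP s /eqP -> /eqP -> /LclassP[_ [u eE]].
have rx : idem_val e * u * z * x' = idem_val e by rewrite -!mulgA -eE idemP.
have Rr : idem_val e * u * z \in Rclass e.
  by apply/RclassP; split; [exists (u * z); rewrite mulgA | exists x'].
have := s _ Rr; rewrite rx; have -> : idem_val e \in Rclass e by rewrite inE.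
case/andP=> _ /eqP ry; case/LclassP: Ly => -[c yE] _.
apply/LclassP; split; first by exists (z * c); rewrite yE mulgA.
by exists (idem_val e * u); rewrite mulgA.
Qed.

Lemma fM_Le_X x : x \in fM_Le e f -> equiv_class e f x \in Xset e f.
Proof.
case/setIP=> /imsetP[a _ xE] Lx; rewrite inE; apply/andP; split.
  apply/imsetP; exists x => //; apply/imsetP; exists a => //.
  by rewrite -xE Lclass_e.
apply/pred0Pn => -[y /= /andP[]]; rewrite inE => /andP[_ /connectP[s]].
elim: s x Lx {xE} => [|t s IHs] x Lx /=.
  by move=> _ ->; rewrite (negbTE (Lclass_fIIe Lx)).
by case/andP=> /equiv_gen_Lclass/(_ Lx)/IHs.
Qed.

Definition biact_X (p : Gfe) (C : X e f) : X e f :=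
  exist _ [set biact p x | x in sval C] (biact_X_subproof p (svalP C)).

Fact biact_X1 (C : X e f) : biact_X 1 C = C.
Proof.
apply: val_inj; case: C => C /=; rewrite !inE => /andP[/imsetP[x xM ->] _].
by rewrite biact_class // biact1.
Qed.

Fact biact_XM p q (C : X e f) : biact_X (p * q) C = biact_X p (biact_X q C).
Proof.
apply: val_inj; rewrite /= -imset_comp; apply: eq_imset => x /=.
by rewrite biactM.
Qed.

End Action.

Section PermutationModule.
Variables (k : fieldType) (N : finMonoid) (T : finType) (to : N -> T -> T).
Hypothesis to1 : forall x, to 1%g x = x.
Hypothesis toM : forall m n x, to (m * n)%g x = to m (to n x).

(* Sends the basis element x to the basis element to n x. *)
Definition perm_rep (n : N) : 'End({ffun T -> k^o}) :=
  linfun (fun v : {ffun T -> k^o} => [ffun y => \sum_(x | to n x == y) v x]).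

Lemma perm_repE n v y : perm_rep n v y = \sum_(x | to n x == y) v x.
Proof.
rewrite linfunK ?ffunE // => c u w; apply/ffunP=> z.
rewrite !ffunE scaler_sumr -big_split; apply: eq_bigr => x _ /=.
by rewrite !ffunE.
Qed.

Fact perm_rep1 : perm_rep 1%g = \1%VF.
Proof.
apply/lfunP=> v; apply/ffunP=> y; rewrite perm_repE id_lfunE.
by rewrite (big_pred1 y) // => x; rewrite to1.
Qed.

Fact perm_repM m n : perm_rep (m * n)%g = (perm_rep m \o perm_rep n)%VF.
Proof.
apply/lfunP=> v; apply/ffunP=> y; rewrite comp_lfunE !perm_repE.
rewrite (partition_big (to n) (fun z => to m z == y)) /= => [|x]; last by rewrite toM.
apply: eq_bigr => z /eqP mz; rewrite perm_repE; apply: eq_bigl => x.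
by rewrite toM; case: (to n x =P z) => [->|]; rewrite ?mz ?eqxx ?andbF.
Qed.

Definition perm_mod : algmod (malg k N) := lin_mod perm_rep1 perm_repM.

End PermutationModule.

Section UFlat.
Variables (k : fieldType) (M : finMonoid) (e f : idem M).

Local Notation Gfe := (group_monoid (max_subgroup f * max_subgroup e)%type).

Definition kX : algmod (malg k Gfe) :=
  @perm_mod k Gfe (X e f) (@biact_X M e f) (@biact_X1 M e f) (@biact_XM M e f).

(* The basis element [x] of kX when the class of x belongs to X (which is     *)
(* always so for x in fM_Le, by fM_Le_X), and 0 otherwise.                    *)
Definition class_elt (x : M) : kX :=
  [ffun C : X e f => (x \in sval C)%:R] : {ffun X e f -> k^o}.

Definition Uflat_gens : seq kX :=
  [seq class_elt p.1 - class_elt p.2 | p : M * M in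
     [pred p | [&& p.1 \in fM_Le e f, p.2 \in fM_Le e f & same_on_Re e p.1 p.2]]]
  ++ [seq class_elt z | z : M in
     [pred z | (z \in fM_Lte e f :\: Lclass e) && (equiv_class e f z \in Xset e f)]].

(* When the idempotents of M generate an R-trivial monoid, the linear span of *)
(* Uflat_gens is already stable, so it is the submodule generated by them.    *)
Definition Uflat : algmod (malg k Gfe) := submod (gen_submodule Uflat_gens).

End UFlat.

Section TensorDual.
Variables (k : fieldType) (G H : finGroupType).
Variables (W : algmod (malg k (group_monoid G))).
Variables (V : algmod (malg k (group_monoid H))).

Local Notation DV := 'Hom(V, k^o).
Local Notation bW := (vbasis {:W}).
Local Notation bD := (vbasis {:DV}).

Definition grp_act (K : finGroupType) (U : algmod (malg k (group_monoid K)))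
  (g : K) : 'End(U) := act U (malg_elt k (g : group_monoid K)).

(* The right action phi h = (v |-> phi (h v)) of H on D(V). *)
Definition dual_act (h : H) : 'End(DV) :=
  linfun (fun phi : DV => (phi \o grp_act V h)%VF).

Lemma dual_actE h phi v : dual_act h phi v = phi (grp_act V h v).
Proof.
rewrite linfunK ?comp_lfunE // => c u w.
by apply/lfunP=> x; rewrite !lfun_simp.
Qed.

(* W (x) D(V), encoded by coordinate matrices in bases of W and D(V).         *)
Definition tensor_sort : vectType k := 'M[k]_(\dim {:W}, \dim {:DV}).

Definition pure_tensor (w : W) (phi : DV) : tensor_sort :=
  (passmx.rVof bW w)^T *m passmx.rVof bD phi.

Definition tensor_act (p : G * H) : 'End(tensor_sort) :=
  linfun (fun T : 'M[k]_(\dim {:W}, \dim {:DV}) =>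
    (passmx.mxof bW bW (grp_act W p.1))^T *m T
      *m passmx.mxof bD bD (dual_act p.2^-1%g)).

Lemma tensor_actE p T : tensor_act p T =
  (passmx.mxof bW bW (grp_act W p.1))^T *m T
      *m passmx.mxof bD bD (dual_act p.2^-1%g).
Proof.
rewrite linfunK // => c S R.
by rewrite mulmxDr mulmxDl -scalemxAr -scalemxAl.
Qed.

Lemma tensor_act_pure p w phi :
  tensor_act p (pure_tensor w phi) =
  pure_tensor (grp_act W p.1 w) (dual_act p.2^-1%g phi).
Proof.
rewrite tensor_actE /pure_tensor (passmx.rVof_app bW (vbasisP _)) (passmx.rVof_app bD (vbasisP _)).
by rewrite trmx_mul !mulmxA.
Qed.

Lemma pure_tensor_basis (i : 'I_(\dim {:W})) (j : 'I_(\dim {:DV})) :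
  pure_tensor bW`_i bD`_j = delta_mx i j.
Proof.
rewrite /pure_tensor !passmx.rVofE ?vbasisP // trmx_delta mul_delta_mx //.
Qed.

Fact tensor_act1 : tensor_act 1%g = \1%VF.
Proof.
have a1 : grp_act W 1%g = \1%VF by exact: act1.
have d1 : dual_act 1^-1%g = \1%VF.
  apply/lfunP=> phi; apply/lfunP=> v.
  by rewrite dual_actE invg1 [grp_act V _](act1 V) !id_lfunE.
have mx1 (U : vectType k) : passmx.mxof (vbasis {:U}) (vbasis {:U}) \1%VF = 1%:M.
  apply/row_matrixP=> i; rewrite rowE passmx.mul_mxof id_lfunE.
  by rewrite passmx.vecofK ?vbasisP // row1.
by apply/lfunP=> T; rewrite tensor_actE a1 d1 !mx1 trmx1 mul1mx mulmx1 id_lfunE.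
Qed.

Fact tensor_actM p q : tensor_act (p * q)%g = (tensor_act p \o tensor_act q)%VF.
Proof.
apply/lfunP=> T; rewrite comp_lfunE !tensor_actE /=.
have aM : grp_act W (p.1 * q.1)%g = (grp_act W p.1 \o grp_act W q.1)%VF.
  by rewrite /grp_act -actM; congr (act W _); exact/esym/malg_mul_elt.
have aV x y : grp_act V (x * y)%g = (grp_act V x \o grp_act V y)%VF.
  by rewrite /grp_act -actM; congr (act V _); exact/esym/malg_mul_elt.
have dM : dual_act (p.2 * q.2)^-1%g =
    (dual_act p.2^-1%g \o dual_act q.2^-1%g)%VF.
  apply/lfunP=> phi; apply/lfunP=> v.
  by rewrite comp_lfunE !dual_actE invMg aV comp_lfunE.
rewrite aM dM (passmx.mxof_comp _ _ (vbasisP {:W})).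
rewrite (passmx.mxof_comp _ _ (vbasisP {:DV})) trmx_mul.
by rewrite !mulmxA.
Qed.

Definition tensor_dual : algmod (malg k (group_monoid (G * H)%type)) :=
  @lin_mod k (group_monoid (G * H)%type) tensor_sort tensor_act tensor_act1 tensor_actM.

End TensorDual.

Section PairQuiver.
Variables (k : fieldType) (M : finMonoid).

Definition splits (G : finGroupType) : Prop :=
  forall V : algmod (malg k (group_monoid G)), simple_mod V ->
    homA V V = <[\1%VF]>%VS.

Definition regular_reps (n : nat) (e : 'I_n -> idem M) : Prop :=
  forall m : M, regular_Jclass m -> exists! i, (e i : M) \in Jclass m.

Variables (n : nat) (e : 'I_n -> idem M).

Definition kG_simple (i : 'I_n) : Type :=
  {V : algmod (malg k (group_monoid (max_subgroup (e i)))) | simple_mod V}.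

Inductive same_pair : {i : 'I_n & kG_simple i} -> {i : 'I_n & kG_simple i} -> Prop :=
  SamePair i (V W : kG_simple i) of isomod (sval V) (sval W) :
    same_pair (existT _ i V) (existT _ i W).

Definition pair_quiver : digraph :=
  Digraph same_pair (fun v w m =>
    has_multiplicity (Uflat k (e (tag v)) (e (tag w)))
      (tensor_dual (sval (tagged w)) (sval (tagged v))) m).

End PairQuiver.

(* Main.v *)
Require Import Defs.
From mathcomp Require Import all_boot all_order all_algebra.
From mathcomp Require Import fingroup morphism gproduct falgebra.
From Stdlib Require Import Classical_Prop.

(** The idempotents generate an R-trivial monoid, so a regular R-class contains
    only one idempotent, and M acts on the right of the R-class of an idempotent
    e by partial injections (Rclass_inj).

    Simple modules.  A simple module S has an apex: an idempotent e, unique up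
    to J-equivalence, with eS nonzero and I(e)S = 0 (simple_apex).  The values
    r s in the corner eS, for r in the R-class of e, determine s in S.  Because
    the action is injective, the elements of the R-class have duals in the
    L-class, and averaging over the maximal subgroup shows that every
    equivariant family of values is attained (glueP).  So S is the module
    coinduced from its corner, the corner is a simple module of the maximal
    subgroup, and S |-> (e, eS) is the bijection on vertices (isomod_of_corner,
    corner_simple, coind_corner).

    Arrows.  The group Ext^1(S, T) is the space of derivations from the algebra
    to Hom(S, T) modulo inner ones (ext1_dim_derivations).  Let S and T have
    apexes e and f.  A derivation d has values f d(x) e from eS to fT, for x in
    fMe.  They vanish on fI(f)I(e)e and identify zx with zy for z in fI(f) and
    x, y in the L-class of e with the same action, because fI(f) kills T and
    x, y act alike on S; so x |-> f d(x) e factors through kX.  It is moreover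
    equivariant on the combinations of x that lie in fI(f) and kill S.  These
    span Uflat: an element of fMe below both J-classes that is not in the tilde
    class of e lies in fI(f)I(e)e (not_Ltilde_fIIe), and differences x - y with
    the same action lie in fI(f) unless x = y (same_fM_Le).  This gives a map
    from derivations to equivariant maps from Uflat to Hom(eS, fT).

    - Its kernel consists of the inner derivations: up to an inner derivation,
      d is recovered from the average of its corner values by an explicit double
      sum q over dual elements (delta_average).  If the corner values vanish on
      Uflat they split into a part supported on the R-class of f, where
      q m = m (q 1), and a part factoring through S, where q m = (q 1) m; hence
      m |-> q m - q 1 m is inner (delta_trivial).
    - It is onto: extend an equivariant map from Uflat to kX by Maschke's
      theorem and put it into the same double sum; m |-> q m - q 1 m is then a
      derivation with the prescribed corner values (corner_values_onto).

    So Ext^1(S, T) has the dimension of the space of equivariant maps from Uflat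
    to Hom(eS, fT), which is the tensor product of fT with the dual of eS
    (tensor_dual_hom).  As k splits both maximal subgroups, that module is
    simple with scalar endomorphisms (hom_mod_end, hom_mod_simple), so this
    dimension is its multiplicity in Uflat (has_multiplicityE). *)

Set Implicit Arguments.
Unset Strict Implicit.
Unset Printing Implicit Defensive.

Import GRing.Theory.
Local Open Scope ring_scope.


(** * Modules over a finite dimensional algebra *)

Section ModuleTheory.
Variables (k : fieldType) (A : falgType k).
Implicit Types S T U V W Z : algmod A.

Lemma act_linear_apply S v : linear (fun a : A => act S a v).
Proof. by move=> c a b; rewrite act_linear !lfunE /= lfunE. Qed.

Lemma act0 S : act S 0 = 0.
Proof.
by have := act_linear S (-1) 0 0; rewrite scaler0 addr0 scaleN1r addNr.
Qed.

Lemma actD S : {morph act S : a b / a + b}.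
Proof. by move=> a b; have := act_linear S 1 a b; rewrite !scale1r. Qed.

Lemma actZ S c a : act S (c *: a) = c *: act S a.
Proof. by rewrite -[c *: a]addr0 act_linear act0 addr0. Qed.

Lemma act_sum S (I : Type) (r : seq I) (P : pred I) (F : I -> A) :
  act S (\sum_(i <- r | P i) F i) = \sum_(i <- r | P i) act S (F i).
Proof. exact: (big_morph (act S) (@actD S) (act0 S)). Qed.

Lemma homA_act V W (f : 'Hom(V, W)) a v :
  f \in homA V W -> f (act V a v) = act W a (f v).
Proof. by move/homAP. Qed.

Lemma homA_id U : \1%VF \in homA U U.
Proof. by apply/homAP=> a v; rewrite !id_lfunE. Qed.

Lemma homA_comp U V W (g : 'Hom(V, W)) (f : 'Hom(U, V)) :
  g \in homA V W -> f \in homA U V -> (g \o f)%VF \in homA U W.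
Proof.
by move=> gA fA; apply/homAP=> a v; rewrite !comp_lfunE !homA_act.
Qed.

Lemma homA_incl U (N : submodule U) : linfun vsval \in homA (submod N) U.
Proof. by apply/homAP=> a v; rewrite !lfunE /= submod_actE. Qed.

Lemma homA_proj U (N : submodule U) (p : 'End(U)) :
  p \in homA U U -> (forall v, p v \in (N : {vspace U})) ->
  (linfun (vsproj N) \o p)%VF \in homA U (submod N).
Proof.
move=> pA pN; apply/homAP=> a v; apply: val_inj.
by rewrite !comp_lfunE !lfunE /= submod_actE !vsprojK // homA_act //.
Qed.

Lemma isomodP U V : isomod U V <->
  exists f g, [/\ f \in homA U V, g \in homA V U, cancel f g & cancel g f].
Proof.
split=> [[f fA fbij]|[f [g [fA _ fK gK]]]]; last by exists f => //; exists g.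
have f0 : lker f == 0%VS by apply/lker0P/bij_inj.
have gK : cancel f^-1%VF f.
  by case: fbij => h fK hK w; rewrite limg_lfunVK // -[w]hK memv_img ?memvf.
exists f, f^-1%VF; split=> //; last exact: lker0_lfunK.
apply/homAP=> a w; apply: (bij_inj fbij).
by rewrite gK homA_act // gK.
Qed.

Lemma isomod_refl U : isomod U U.
Proof.
by exists \1%VF; [exact: homA_id | exists \1%VF => x; rewrite !id_lfunE].
Qed.

Lemma isomod_sym U V : isomod U V -> isomod V U.
Proof. by case/isomodP=> f [g [? ? ? ?]]; apply/isomodP; exists g, f. Qed.

Lemma isomod_trans U V W : isomod U V -> isomod V W -> isomod U W.
Proof.
case=> f fA fb [g gA gb]; exists (g \o f)%VF; first exact: homA_comp.
by apply: (eq_bij (bij_comp gb fb)) => x; rewrite /= comp_lfunE.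
Qed.

Lemma img_stable V W (f : 'Hom(V, W)) (fA : f \in homA V W) (N : submodule V) a :
  (act W a @: (f @: N) <= f @: N)%VS.
Proof.
apply/subvP=> _ /memv_imgP[_ /memv_imgP[v vN ->] ->].
rewrite -homA_act //; apply: memv_img.
exact: (subvP (submod_stable N a)) (memv_img _ vN).
Qed.

Definition img_submodule V W (f : 'Hom(V, W)) (fA : f \in homA V W) (N : submodule V) :
  submodule W := Submodule (img_stable fA N).

Definition ker_submodule V W (f : 'Hom(V, W)) (fA : f \in homA V W) :
  submodule V := Submodule (ker_stable fA).

Lemma full_stable V a : (act V a @: fullv <= fullv)%VS.
Proof. exact: subvf. Qed.

Definition full_submodule V : submodule V := Submodule (@full_stable V).

Lemma cap_stable V (N N' : submodule V) a :
  (act V a @: (N :&: N') <= N :&: N')%VS.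
Proof. by apply: subv_trans (limg_cap _ _ _) _; apply: capvS; apply: submod_stable. Qed.

Definition cap_submodule V (N N' : submodule V) : submodule V :=
  Submodule (@cap_stable V N N').

Lemma simple_isomod U V : isomod U V -> simple_mod U -> simple_mod V.
Proof.
case/isomodP=> f [g [fA gA fK gK]] [U0 Us]; split=> [V0|N].
  apply: U0; apply/vspaceP=> u; rewrite memvf memv0 -[u]fK.
  by have := memvf (f u); rewrite V0 memv0 => /eqP->; rewrite linear0 eqxx.
have NE (X : {vspace V}) : (f @: (g @: X))%VS = X.
  by rewrite -limg_comp (eq_in_limg (g := \1%VF)) ?lim1g // => v _;
     rewrite comp_lfunE gK id_lfunE.
have := Us (img_submodule gA N); rewrite /= => -[gN|gN].
  by left; rewrite -(NE N) gN limg0.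
right; rewrite -(NE N) gN; apply/eqP; rewrite eqEsubv subvf /=; apply/subvP=> v _.
by rewrite -[v]gK memv_img ?memvf.
Qed.

Lemma schur_iso U V (f : 'Hom(U, V)) :
  simple_mod U -> simple_mod V -> f \in homA U V -> f != 0 -> bijective f.
Proof.
move=> [_ Us] [_ Vs] fA f0.
have f_inj : injective f.
  apply/lker0P; case: (Us (ker_submodule fA)) => /= E; first by rewrite E.
  case/eqP: f0; apply/lfunP=> u; rewrite zero_lfunE; apply/eqP.
  by rewrite -memv_ker E memvf.
have fim : limg f = fullv.
  case: (Vs (img_submodule fA (full_submodule U))) => //= E.
  case/eqP: f0; apply/lfunP=> u; rewrite zero_lfunE; apply/eqP.
  by rewrite -memv0 -E memv_img ?memvf.
exists f^-1%VF; first exact/lker0_lfunK/lker0P.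
by move=> v; rewrite limg_lfunVK // fim memvf.
Qed.

Lemma simple_isomodE U V : simple_mod U -> simple_mod V ->
  isomod U V <-> homA U V != 0%VS.
Proof.
move=> Us Vs; split=> [[f fA fb]|H].
  apply: contra_notN (proj1 Us) => /eqP H0.
  have f0 : f = 0 by apply/eqP; rewrite -memv0 -H0.
  apply/eqP; rewrite eqEsubv sub0v andbT.
  apply/subvP=> u _; rewrite memv0 -(inj_eq (bij_inj fb)) linear0.
  by rewrite f0 zero_lfunE.
exists (vpick (homA U V)); first exact: memv_pick.
by apply: schur_iso; rewrite ?memv_pick ?vpick0.
Qed.

(** By Schur's lemma g is an isomorphism, and f g^-1 is a scalar for every f. *)
Lemma homA_line U Z (g : 'Hom(U, Z)) :
  homA Z Z = <[\1%VF]>%VS -> g \in homA U Z -> bijective g ->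
  homA U Z = <[g]>%VS.
Proof.
move=> Zend gA gb; have gI := bij_inj gb.
have [g' g'A g'K] : exists2 g', g' \in homA Z U & cancel g' g.
  have /isomodP[h [h' [hA h'A hK h'K]]] : isomod U Z by exists g.
  have : (g \o h')%VF \in homA Z Z by apply: homA_comp.
  rewrite Zend => /vlineP[c cE].
  have gE u : g u = c *: h u.
    have := congr1 (fun l : 'End(Z) => l (h u)) cE.
    by rewrite /= comp_lfunE hK scale_lfunE id_lfunE.
  have [c0|c0] := eqVneq c 0.
    exists h' => // z; have E : h' z = 0.
      by apply: gI; rewrite !gE c0 !scale0r.
    by rewrite -[z]h'K E !linear0.
  exists (c^-1 *: h')%VF; first exact: memvZ.
  by move=> z; rewrite scale_lfunE gE linearZ /= h'K scalerA mulfV ?scale1r.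
apply/eqP; rewrite eqEsubv -memvE gA andbT; apply/subvP=> f fA.
have : (f \o g')%VF \in homA Z Z by apply: homA_comp.
rewrite Zend => /vlineP[c cE]; apply/vlineP; exists c; apply/lfunP=> u.
have := congr1 (fun l : 'End(Z) => l (g u)) cE.
have -> : (f \o g')%VF (g u) = f u by rewrite comp_lfunE; congr (f _); apply: gI;
  rewrite g'K.
by rewrite !scale_lfunE id_lfunE.
Qed.

End ModuleTheory.


(** * Multiplicities in semisimple modules *)

Section Semisimple.
Variables (k : fieldType) (A : falgType k).
Implicit Types U Z : algmod A.

(** Complete reducibility, phrased with projections: averaging over a group
    produces them, and they extend equivariant maps from submodules. *)
Definition semisimple U := forall N : submodule U, exists2 p : 'End(U),
  p \in homA U U & (forall v, p v \in (N : {vspace U})) /\ {in N, p =1 id}.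

Lemma semisimple_decomposition U : semisimple U ->
  exists r (N : 'I_r -> submodule U),
    [/\ forall i, simple_mod (submod (N i)),
        directv (\sum_i N i)%VS & (\sum_i N i)%VS = fullv].
Proof.
move=> Uss.
suff H d (C : submodule U) : (\dim C <= d)%N -> exists r (N : 'I_r -> submodule U),
    [/\ forall i, simple_mod (submod (N i)),
        directv (\sum_i N i)%VS & (\sum_i N i)%VS = C].
  exact: (H _ (full_submodule U) (leqnn _)).
elim: d C => [|d IHd] C dC.
  exists 0, (fun=> C); split; first by case.
    by rewrite directvE /= !big_ord0 dimv0.
  by rewrite big_ord0; apply/esym/eqP; rewrite -dimv_eq0 -leqn0.
have [C0|C0] := eqVneq (C : {vspace U}) 0%VS.
  by apply: IHd; rewrite C0 dimv0.
have [Cs|Cns] := classic (simple_mod (submod C)).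
  exists 1, (fun=> C); split; rewrite ?big_ord1 //.
  by rewrite directvE /= !big_ord1.
(* A proper nonzero submodule of C splits it into two smaller pieces. *)
have [X0 X0n X0C] : exists2 X : submodule (submod C), X != 0%VS :> {vspace _}
    & X != fullv :> {vspace _}.
  apply: NNPP => noX; apply: Cns; split=> [E|X].
    case/eqP: C0; apply/vspaceP=> u; rewrite memv0; apply/idP/eqP=> [uC|->];
      last exact: mem0v.
    have : vsproj C u \in (fullv : {vspace submod C}) by exact: memvf.
    by rewrite E memv0 => /eqP/(congr1 vsval); rewrite vsprojK.
  have [E|X0] := eqVneq (X : {vspace submod C}) 0%VS; first by left.
  have [E|XC] := eqVneq (X : {vspace submod C}) fullv; first by right.
  by case: noX; exists X.
pose X := img_submodule (homA_incl C) X0.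
have XE u : (u \in (X : {vspace U})) = (u \in (C : {vspace U})) &&
  (vsproj C u \in (X0 : {vspace submod C})).
  apply/idP/idP=> [/memv_imgP[x xX ->]|/andP[uC uX]].
    by rewrite lfunE /= subvsP vsvalK.
  by apply/memv_imgP; exists (vsproj C u); rewrite ?lfunE //= vsprojK.
have XC : (X <= C)%VS by apply/subvP=> u; rewrite XE => /andP[].
have [p pA [pX pid]] := Uss X.
pose Y := cap_submodule C (ker_submodule pA).
have YE u : (u \in (Y : {vspace U})) = (u \in (C : {vspace U})) && (p u == 0).
  by rewrite memv_cap memv_ker.
have XY0 : (X :&: Y = 0)%VS.
  apply/vspaceP=> u; rewrite memv_cap memv0 YE; apply/idP/eqP=> [|->].
    by case/and3P=> uX _; rewrite pid // => /eqP.
  by rewrite !mem0v linear0 eqxx.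
have XYC : (X + Y = C)%VS.
  apply/vspaceP=> u; apply/memv_addP/idP=> [[x xX [y yY ->]]|uC].
    by apply: memvD; [exact: (subvP XC) | move: yY; rewrite YE => /andP[]].
  exists (p u) => //; exists (u - p u); last by rewrite addrC subrK.
  rewrite YE linearB /= (pid (p u)) ?pX // subrr eqxx andbT memvB //.
  exact: (subvP XC).
have dXY : (\dim X + \dim Y = \dim C)%N by rewrite -dimv_disjoint_sum // XYC.
have dX0 : (0 < \dim X)%N.
  rewrite lt0n dimv_eq0; apply: contraNneq X0n => E; apply/eqP/vspaceP=> u.
  rewrite memv0; apply/idP/eqP=> [uX|->]; last exact: mem0v.
  apply: val_inj; apply/eqP; rewrite -memv0 -E XE /= subvsP /=.
  by rewrite vsvalK.
have dY0 : (0 < \dim Y)%N.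
  rewrite lt0n dimv_eq0; apply: contraNneq X0C => E; apply/eqP/vspaceP=> u.
  rewrite memvf; have := subvsP u; rewrite -{2}XYC E addv0 XE => /andP[_].
  by rewrite vsvalK.
have [r1 [N1 [N1s N1d N1C]]] : exists r (N : 'I_r -> submodule U),
    [/\ forall i, simple_mod (submod (N i)),
        directv (\sum_i N i)%VS & (\sum_i N i)%VS = X].
  by apply: IHd; rewrite -ltnS (leq_trans _ dC) // -dXY -[ltnLHS]addn0 ltn_add2l.
have [r2 [N2 [N2s N2d N2C]]] : exists r (N : 'I_r -> submodule U),
    [/\ forall i, simple_mod (submod (N i)),
        directv (\sum_i N i)%VS & (\sum_i N i)%VS = Y].
  by apply: IHd; rewrite -ltnS (leq_trans _ dC) // -dXY -[ltnLHS]add0n ltn_add2r.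
pose N (i : 'I_(r1 + r2)) := match split i with inl j => N1 j | inr j => N2 j end.
have Nl j : N (lshift r2 j) = N1 j by rewrite /N (unsplitK (inl j)).
have Nr j : N (rshift r1 j) = N2 j by rewrite /N (unsplitK (inr j)).
have NC : (\sum_i N i)%VS = C.
  rewrite big_split_ord /= -XYC -N1C -N2C; congr (_ + _)%VS.
    by apply: eq_bigr => j _; rewrite Nl.
  by apply: eq_bigr => j _; rewrite Nr.
exists (r1 + r2)%N, N; split=> //; first by move=> i; rewrite /N; case: split.
have dX := directvP N1d; have dY := directvP N2d.
rewrite directvE /=; apply/eqP.
transitivity (\dim X + \dim Y)%N; first by rewrite dXY -NC.
rewrite -{1}N1C -N2C dX dY /= big_split_ord /=; congr (_ + _)%N.
  by apply: eq_bigr => j _; rewrite Nl.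
by apply: eq_bigr => j _; rewrite Nr.
Qed.

(** By Schur's lemma a map from U to Z is the choice of one scalar for each
    summand isomorphic to Z. *)
Lemma multiplicity_dim U Z m : simple_mod Z -> homA Z Z = <[\1%VF]>%VS ->
  has_multiplicity U Z m -> m = \dim (homA U Z).
Proof.
move=> Zs Zend [r [N [J [Ns [Nd Nf] JP <-]]]].
pose pi_ i : 'End(U) := sumv_pi_for (esym Nf) i.
have pi_sum v : \sum_i pi_ i v = v by apply: sumv_pi_sum; exact: memvf.
have pi_mem i v : pi_ i v \in (N i : {vspace U}) by exact: memv_sum_pi.
have pi_uniq (us : 'I_r -> U) v : (forall i, us i \in (N i : {vspace U})) ->
    \sum_i us i = v -> forall i, pi_ i v = us i.
  move=> usN usv i.
  have := directv_sum_unique Nd us (pi_ ^~ v) (fun i _ => usN i) (fun i _ =>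
    pi_mem i v).
  by rewrite usv pi_sum eqxx => /esym/forall_inP/(_ i isT)/eqP->.
have pi_id i u : u \in (N i : {vspace U}) -> forall j,
  pi_ j u = if j == i then u else 0.
  move=> uN; apply: pi_uniq => [j|]; first by case: eqP => [->|_]; rewrite ?mem0v.
  by rewrite -big_mkcond big_pred1_eq.
have piA i : pi_ i \in homA U U.
  apply/homAP=> a v; apply: (pi_uniq (fun j => act U a (pi_ j v))) => [j|].
    by apply: (subvP (submod_stable (N j) a)); rewrite memv_img.
  by rewrite -linear_sum pi_sum.
pose phi i : 'Hom(submod (N i), Z) := vpick (homA (submod (N i)) Z).
have phiA i : phi i \in homA (submod (N i)) Z by exact: memv_pick.
have phi0 i : (i \in J) = (phi i != 0).
  rewrite vpick0; apply/idP/idP=> [/JP|]; first by move/(simple_isomodE (Ns i) Zs).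
  by move=> H; apply/JP/(simple_isomodE (Ns i) Zs).
pose psi i : 'Hom(U, Z) := (phi i \o (linfun (vsproj (N i)) \o pi_ i))%VF.
have psiA i : psi i \in homA U Z by rewrite homA_comp // homA_proj.
have psiE i j (u : submod (N j)) : psi i (vsval u) = if i == j then phi j u else 0.
  rewrite !comp_lfunE lfunE /= (pi_id j) ?subvsP //.
  by have [->|_] := eqVneq i j; rewrite ?vsvalK // !linear0.
have -> : homA U Z = (\sum_(i in J) <[psi i]>)%VS.
  apply/eqP; rewrite eqEsubv; apply/andP; split; last first.
    by apply/subv_sumP=> i _; rewrite -memvE.
  apply/subvP=> f fA.
  have fE i : (f \o linfun vsval)%VF \in homA (submod (N i)) Z.
    exact: homA_comp fA (homA_incl (N i)).
  have fc i : exists c, forall u : submod (N i), f (vsval u) = c *: phi i u.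
    have [iJ|iJ] := boolP (i \in J).
      have pb : bijective (phi i) by apply: (schur_iso (Ns i) Zs); rewrite -?phi0.
      have := fE i; rewrite (homA_line Zend (phiA i) pb) => /vlineP[c cE].
      exists c => u; have := congr1 (fun l : 'Hom(submod (N i), Z) => l u) cE.
      by rewrite /= comp_lfunE lfunE /= scale_lfunE.
    exists 0 => u; rewrite scale0r; move: iJ; rewrite phi0 negbK vpick0 => /eqP H.
    have := fE i; rewrite H memv0 => /eqP/(congr1 (fun l : 'Hom(submod (N i), Z) =>
      l u)).
    by rewrite /= comp_lfunE lfunE /= zero_lfunE.
  have /fin_all_exists[c cE] : forall i, exists c, forall u : submod (N i),
    f (vsval u) = c *: phi i u by [].
  have -> : f = \sum_(i in J) c i *: psi i.
    apply/lfunP=> v; rewrite -[v]pi_sum !linear_sum /=; apply: eq_bigr => j _.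
    have := pi_mem j v; move: (pi_ j v) => u uN.
    rewrite -(vsprojK uN) cE sum_lfunE.
    have [jJ|jJ] := boolP (j \in J).
      rewrite (bigD1 j) //= scale_lfunE psiE eqxx big1 ?addr0 // => i /andP[_ ij].
      by rewrite scale_lfunE psiE (negbTE ij) scaler0.
    rewrite big1 => [|i iJ]; first by move: jJ; rewrite phi0 negbK => /eqP->;
      rewrite zero_lfunE scaler0.
    by rewrite scale_lfunE psiE; case: eqP iJ jJ => [->->|_ _ _] //; rewrite scaler0.
  apply: memv_suml => i iJ; apply: memvZ.
  exact: (subvP (sumv_sup i iJ (subvv _))) (memv_line _).
suff /directvP -> : directv (\sum_(i in J) <[psi i]>)%VS.
  rewrite /= -sum1_card; apply: eq_bigr => i; rewrite phi0 dim_vline => p0.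
  suff -> : psi i != 0 by []; apply: contraNneq p0 => E.
  apply/eqP/lfunP=> u; have := psiE i i u; rewrite eqxx => <-.
  by rewrite E !zero_lfunE.
apply/directv_sum_independent => us usP us0 i iJ.
apply/lfunP=> v; rewrite zero_lfunE.
have usE l : l \in J -> exists c, us l = c *: psi l by move/usP/vlineP.
have us_off l j u : l \in J -> u \in (N j : {vspace U}) -> l != j -> us l u = 0.
  move=> /usE[c ->] uN lj; rewrite -(vsprojK uN) scale_lfunE psiE (negbTE lj).
  by rewrite scaler0.
rewrite -[v]pi_sum linear_sum big1 // => j _.
have [<-|ij] := eqVneq i j; last exact: (us_off i j).
have := congr1 (fun l : 'Hom(U, Z) => l (pi_ i v)) us0.
rewrite /= sum_lfunE zero_lfunE (bigD1 i) //= big1 ?addr0 // => l /andP[lJ li].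
exact: (us_off l i).
Qed.

(** Isomorphism with Z is the nonvanishing of a space of maps, hence decidable,
    so the set of summands isomorphic to Z exists for any decomposition. *)
Lemma has_multiplicityE U Z m : semisimple U -> simple_mod Z ->
  homA Z Z = <[\1%VF]>%VS ->
  has_multiplicity U Z m <-> m = \dim (homA U Z).
Proof.
move=> Uss Zs Zend; split=> [|->]; first exact: multiplicity_dim.
have [r [N [Ns Nd Nf]]] := semisimple_decomposition Uss.
have H : has_multiplicity U Z #|[set i | homA (submod (N i)) Z != 0%VS]|.
  exists r, N, [set i | homA (submod (N i)) Z != 0%VS]; split=> // i.
  by rewrite inE; apply: iff_sym; apply: simple_isomodE.
by rewrite -(multiplicity_dim Zs Zend H).
Qed.

Lemma has_multiplicity_isor U Z Z' m : isomod Z Z' ->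
  has_multiplicity U Z m -> has_multiplicity U Z' m.
Proof.
move=> ZZ' [r [N [J [Ns Nd JP mE]]]]; exists r, N, J; split=> // i.
rewrite JP; split=> H; first exact: isomod_trans H ZZ'.
exact: isomod_trans H (isomod_sym ZZ').
Qed.

End Semisimple.


(** * Extensions and derivations *)

Section Derivations.
Variables (k : fieldType) (A : falgType k) (S T : algmod A).
Implicit Types (a b : A) (h : 'Hom(S, T)) (d : 'Hom(A, 'Hom(S, T))).

Definition derivations : {vspace 'Hom(A, 'Hom(S, T))} :=
  lker (linfun (fun d : 'Hom(A, 'Hom(S, T)) =>
    linfun (fun a : A => linfun (fun b : A =>
      d (a * b) - (act T a \o d b)%VF - (d a \o act S b)%VF)))).

Lemma derivationsP d :
  reflect (forall a b, d (a * b) = (act T a \o d b)%VF + (d a \o act S b)%VF)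
          (d \in derivations).
Proof.
have comb c (x x' y y' z z' : T) : c *: x + x' + (c *: - y - y') + (c *: - z - z') =
    c *: (x - y - z) + (x' - y' - z').
  by rewrite !scalerBr !scalerN (addrACA (c *: x)) (addrACA (c *: x - c *: y)).
have L3 e a : linear (fun b : A =>
    (e : 'Hom(A, 'Hom(S, T))) (a * b) - (act T a \o e b)%VF - (e a \o act S b)%VF).
  move=> c b b'; rewrite act_linear mulrDr -scalerAr !linearP /=; apply/lfunP=> s.
  by rewrite !lfun_simp !linearP /= comb.
have L2 e : linear (fun a : A => linfun (fun b : A =>
    (e : 'Hom(A, 'Hom(S, T))) (a * b) - (act T a \o e b)%VF - (e a \o act S b)%VF)).
  move=> c a a'; apply/lfunP=> b; rewrite add_lfunE scale_lfunE !linfunK //.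
  rewrite act_linear mulrDl -scalerAl !linearP /=; apply/lfunP=> s.
  by rewrite !lfun_simp !linearP /= comb.
have L1 : linear (fun d : 'Hom(A, 'Hom(S, T)) =>
    linfun (fun a : A => linfun (fun b : A =>
      d (a * b) - (act T a \o d b)%VF - (d a \o act S b)%VF))).
  move=> c d1 d2; apply/lfunP=> a; rewrite add_lfunE scale_lfunE !(linfunK (L2 _)) /=.
  apply/lfunP=> b; rewrite (linfunK (L3 _ _)) [RHS]add_lfunE [X in _ = X +
    _]scale_lfunE.
  rewrite !(linfunK (L3 _ _)); apply/lfunP=> s.
  by rewrite !lfun_simp !linearP /= comb.
rewrite memv_ker; apply: (iffP eqP) => [d0 a b|dM].
  have := congr1 (fun F : 'Hom(A, 'Hom(A, 'Hom(S, T))) => F a b) d0.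
  rewrite /= (linfunK L1) (linfunK (L2 _)) (linfunK (L3 _ _)) !zero_lfunE => /eqP.
  by rewrite subr_eq0 subr_eq addrC => /eqP.
apply/lfunP=> a; rewrite (linfunK L1) (linfunK (L2 _)) zero_lfunE; apply/lfunP=> b.
by rewrite (linfunK (L3 _ _)) zero_lfunE dM addrAC addrK subrr.
Qed.

Definition inner : 'Hom('Hom(S, T), 'Hom(A, 'Hom(S, T))) :=
  linfun (fun h : 'Hom(S, T) =>
    linfun (fun a : A => (act T a \o h)%VF - (h \o act S a)%VF)).

Lemma innerE h a : inner h a = (act T a \o h)%VF - (h \o act S a)%VF.
Proof.
have L2 h' : linear (fun a : A => (act T a \o h')%VF - (h' \o act S a)%VF).
  move=> c x y; rewrite !act_linear comp_lfunDl comp_lfunDr -comp_lfunZl -comp_lfunZr.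
  by rewrite scalerBr opprD addrACA.
rewrite /inner linfunK ?linfunK // => c x y; apply/lfunP=> b.
rewrite add_lfunE scale_lfunE !linfunK //.
by rewrite comp_lfunDl comp_lfunDr -comp_lfunZl -comp_lfunZr scalerBr opprD addrACA.
Qed.

Lemma inner_derivation h : inner h \in derivations.
Proof.
apply/derivationsP=> a b; rewrite !innerE !actM comp_lfunDl comp_lfunDr.
by rewrite !(comp_lfunNl, comp_lfunNr) !comp_lfunA addrA subrK.
Qed.

Lemma derivation1 d : d \in derivations -> d 1 = 0.
Proof.
move/derivationsP/(_ 1 1); rewrite mulr1 !act1 comp_lfun1l comp_lfun1r.
by move/eqP; rewrite -subr_eq0 opprD addrA subrr sub0r oppr_eq0 => /eqP.
Qed.

Local Notation bS := (vbasis {:S}).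
Local Notation F := (free_mod A (\dim {:S})).

(* The free cover is the algebra tensored with S; this is s |-> 1 (x) s. *)
Let sigma (s : S) : F := [ffun i => (coord bS i s)%:A].

Let sigma_linear : linear sigma.
Proof.
by move=> c s t; apply/ffunP=> i; rewrite !ffunE linearP /= scalerDl scalerA.
Qed.

Let cover_sigma s : free_cover S (sigma s) = s.
Proof.
rewrite free_coverE [RHS](coord_vbasis (memvf s)); apply: eq_bigr => i _.
by rewrite ffunE actZ act1 scale_lfunE id_lfunE.
Qed.

Let evalb (d : 'Hom(A, 'Hom(S, T))) (x : F) : T :=
  \sum_i d ((x : {ffun 'I_(\dim {:S}) -> A}) i) bS`_i.

Let evalb_linear d : linear (evalb d).
Proof.
move=> c x y; rewrite /evalb scaler_sumr -big_split /=; apply: eq_bigr => i _.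
by rewrite !ffunE linearP /= add_lfunE scale_lfunE.
Qed.

Let evalb_sigma d a s : evalb d (act F a (sigma s)) = d a s.
Proof.
rewrite /evalb {2}(coord_vbasis (memvf s)) linear_sum; apply: eq_bigr => i _.
by rewrite free_actE ffunE -scalerAr mulr1 !linearZ /= scale_lfunE.
Qed.

Let restr : 'Hom('Hom(A, 'Hom(S, T)), 'Hom(syzygy S, T)) :=
  linfun (fun d : 'Hom(A, 'Hom(S, T)) => linfun (fun x : syzygy S =>
    evalb d (vsval x))).

Let restrE d x : restr d x = evalb d (vsval x).
Proof.
have L d' : linear (fun x : syzygy S => evalb d' (vsval x)).
  by move=> c x' y; rewrite linearP evalb_linear.
rewrite /restr linfunK ?linfunK // => c d1 d2; apply/lfunP=> y.
rewrite add_lfunE scale_lfunE !linfunK // /evalb scaler_sumr -big_split /=.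
by apply: eq_bigr => i _; rewrite !(add_lfunE, scale_lfunE).
Qed.

(* The defect of A-linearity of sigma; these elements span the syzygy. *)
Let gen a s : syzygy S := vsproj _ (act F a (sigma s) - sigma (act S a s)).

Let genE a s : vsval (gen a s) = act F a (sigma s) - sigma (act S a s).
Proof.
rewrite vsprojK // memv_ker linearB /= (homA_act _ _ (free_cover_homA S)).
by rewrite !cover_sigma subrr.
Qed.

Let restr_gen d a s : d \in derivations -> restr d (gen a s) = d a s.
Proof.
move=> dA; rewrite restrE genE -(linfunK (evalb_linear d)) linearB /=.
rewrite !(linfunK (evalb_linear d)) evalb_sigma.
rewrite -[sigma (act S a s)]id_lfunE -(act1 F) evalb_sigma.
by rewrite derivation1 // zero_lfunE subr0.
Qed.

Let cover_syzygy (x : syzygy S) :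
  \sum_i act S ((vsval x : {ffun 'I_(\dim {:S}) -> A}) i) bS`_i = 0.
Proof. by have := subvsP x; rewrite memv_ker free_coverE => /eqP. Qed.

Let syzygy_expand (x : syzygy S) :
  x = \sum_i gen ((vsval x : {ffun 'I_(\dim {:S}) -> A}) i) bS`_i.
Proof.
apply: val_inj; rewrite /= linear_sum /=.
under eq_bigr do rewrite genE.
rewrite sumrB.
have -> : \sum_i sigma (act S ((vsval x : {ffun 'I_(\dim {:S}) -> A}) i) bS`_i) = 0.
  rewrite -[LHS](eq_bigr _ (fun i _ => linfunK sigma_linear _)) -linear_sum /=.
  by rewrite cover_syzygy linear0.
rewrite subr0; apply/ffunP=> j; rewrite sum_ffunE (bigD1 j) //= big1 => [|i ij].
  rewrite free_actE ffunE addr0 coord_free ?(basis_free (vbasisP _)) // eqxx.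
  by rewrite scale1r mulr1.
rewrite free_actE ffunE coord_free ?(basis_free (vbasisP _)) // (negbTE ij).
by rewrite scale0r mulr0.
Qed.

Let restr_inj : (derivations :&: lker restr = 0)%VS.
Proof.
apply/vspaceP=> d; rewrite memv_cap (memv_ker restr) memv0;
  apply/andP/eqP=> [[dA /eqP d0]|->].
  apply/lfunP=> a; apply/lfunP=> s; rewrite -(restr_gen a s dA) d0.
  by rewrite !zero_lfunE.
by rewrite mem0v linear0.
Qed.

Let restr_derivations : (restr @: derivations)%VS = homA (syzygy S) T.
Proof.
apply/eqP; rewrite eqEsubv; apply/andP; split; apply/subvP.
  move=> _ /memv_imgP[d dA ->]; apply/homAP=> a x.
  rewrite !restrE submod_actE /evalb linear_sum /=.
  have E0 : d a (free_cover S (vsval x)) = 0.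
    by have := subvsP x; rewrite memv_ker => /eqP->; rewrite linear0.
  rewrite -[RHS]addr0 -[X in _ + X]E0 free_coverE linear_sum -big_split /=;
    apply: eq_bigr => i _.
  by rewrite free_actE (derivationsP _ dA) add_lfunE !comp_lfunE.
move=> f fA.
pose d := linfun (fun a : A => linfun (fun s : S => f (gen a s))).
have gL a : linear (gen a).
  move=> c s t; apply: subvs_inj; rewrite linearP !genE sigma_linear !linearP /=.
  by rewrite sigma_linear !genE scalerBr opprD addrACA.
have gR s : linear (gen ^~ s).
  move=> c a b; apply: subvs_inj; rewrite linearP !genE !act_linear.
  by rewrite !add_lfunE !scale_lfunE sigma_linear /= !genE scalerBr opprD addrACA.
have L1 a : linear (fun s : S => f (gen a s)).
  by move=> c s t; rewrite gL linearP.
have dE a s : d a s = f (gen a s).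
  rewrite /d linfunK ?linfunK // => c x y; apply/lfunP=> t.
  by rewrite add_lfunE scale_lfunE !linfunK // gR linearP.
have dA : d \in derivations.
  apply/derivationsP=> a b; apply/lfunP=> s.
  rewrite add_lfunE !comp_lfunE !dE -(homA_act _ _ fA) -linearD /=; congr (f _).
  have vA x : vsval (act (syzygy S) a x) = act F a (vsval x) by exact: submod_actE.
  apply: subvs_inj; rewrite linearD -[X in _ = X + _]/(vsval (act (syzygy S) a (gen b
    s))) vA -[X in _ = _ + X]/(vsval _) !genE linearB /= !actM !comp_lfunE.
  by rewrite free_actM comp_lfunE addrA subrK.
apply/memv_imgP; exists d => //; apply/lfunP=> x.
rewrite (syzygy_expand x) !linear_sum /=.
by apply: eq_bigr => i _; rewrite restr_gen // dE.
Qed.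

Let restr_inner : (restr @: limg inner)%VS =
  (linfun (fun f : 'Hom(F, T) => (f \o syzygy_incl S)%VF) @: homA F T)%VS.
Proof.
have RE f : linfun (fun f : 'Hom(F, T) => (f \o syzygy_incl S)%VF) f = (f \o
  syzygy_incl S)%VF.
  by rewrite linfunK // => c f1 f2; rewrite comp_lfunDl comp_lfunZl.
have innE h x : restr (inner h) x = \sum_i act T ((vsval x : {ffun 'I_(\dim {:S}) ->
  A}) i) (h bS`_i).
  rewrite restrE /evalb; under eq_bigr do rewrite innerE add_lfunE opp_lfunE
    !comp_lfunE.
  by rewrite sumrB -(linear_sum h) /= cover_syzygy linear0 subr0.
apply/eqP; rewrite eqEsubv; apply/andP; split; apply/subvP => d /memv_imgP.
  case=> _ /memv_imgP[h _ ->] {d}->.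
  pose f : 'Hom(F, T) := linfun (fun x : F => \sum_i act T ((x : {ffun 'I_(\dim {:S})
    -> A}) i) (h bS`_i)).
  have fE x : f x = \sum_i act T ((x : {ffun 'I_(\dim {:S}) -> A}) i) (h bS`_i).
    rewrite /f linfunK // => c y z; rewrite scaler_sumr -big_split /=.
    by apply: eq_bigr => i _; rewrite !ffunE act_linear add_lfunE scale_lfunE.
  apply/memv_imgP; exists f.
    apply/homAP=> a x; rewrite !fE linear_sum; apply: eq_bigr => i _.
    by rewrite free_actE actM comp_lfunE.
  by apply/lfunP=> x; rewrite innE RE comp_lfunE fE lfunE.
case=> f fA {d}->; apply/memv_imgP.
exists (inner (linfun (fun s => f (sigma s)))); first by rewrite memv_img ?memvf.
have hE s : linfun (fun s => f (sigma s)) s = f (sigma s).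
  by rewrite linfunK // => c x y; rewrite sigma_linear linearP.
apply/lfunP=> x; rewrite innE RE comp_lfunE lfunE /= {1}[x]syzygy_expand.
rewrite !linear_sum /=; under eq_bigr do rewrite genE linearB /=.
rewrite sumrB [X in _ - X](_ : _ = 0) ?subr0.
  by apply: eq_bigr => i _; rewrite hE (homA_act _ _ fA).
under eq_bigr do rewrite -hE; rewrite -(linear_sum (linfun _)) /=.
by rewrite cover_syzygy linear0.
Qed.

(** The free cover of S is the algebra tensored with S, and its kernel is
    spanned by the elements a (x) s - 1 (x) a s.  The value of an A-linear map
    at these elements is a derivation, every derivation arises, and the map
    extends to the cover exactly when the derivation is inner. *)
Lemma ext1_dim_derivations :
  ext1_dim S T = (\dim derivations - \dim (limg inner))%N.
Proof.
rewrite /ext1_dim -restr_derivations -restr_inner.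
have sub : (limg inner <= derivations)%VS.
  by apply/subvP=> _ /memv_imgP[h _ ->]; exact: inner_derivation.
rewrite (limg_dim_eq restr_inj) limg_dim_eq //; apply/eqP.
by rewrite -subv0 (subv_trans (capvS sub (subvv _))) // restr_inj.
Qed.

End Derivations.


(** * Modules over monoid and group algebras *)

Lemma lfun_bij (k : fieldType) (U V : vectType k) (f : 'Hom(U, V)) :
  injective f -> (forall v, exists u, v = f u) -> bijective f.
Proof.
move=> fI fS; exists f^-1%VF; first exact/lker0_lfunK/lker0P.
by move=> v; have [u ->] := fS v; rewrite limg_lfunVK // memv_img ?memvf.
Qed.

Section MonoidModules.
Variables (k : fieldType) (M : finMonoid).
Implicit Types S T : algmod (malg k M).

Definition mact S (m : M) : 'End(S) := act S (malg_elt k m).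

Lemma mactM S x y : mact S (x * y)%g = (mact S x \o mact S y)%VF.
Proof. by rewrite /mact -actM; congr (act S _); exact/esym/malg_mul_elt. Qed.

Lemma mactME S x y s : mact S (x * y)%g s = mact S x (mact S y s).
Proof. by rewrite mactM comp_lfunE. Qed.

Lemma mact1 S s : mact S 1%g s = s.
Proof. by rewrite /mact (act1 S) id_lfunE. Qed.

Lemma act_mact S a : act S a = \sum_m malg_coef a m *: mact S m.
Proof. by rewrite {1}[a]malg_expand act_sum; apply: eq_bigr => m _; rewrite actZ. Qed.

Lemma mact_lin_mod (V : vectType k) (rho : M -> 'End(V)) rho1 rhoM m :
  mact (@lin_mod k M V rho rho1 rhoM) m = rho m.
Proof. exact: lin_act_elt. Qed.

Lemma homA_mactP S T (f : 'Hom(S, T)) :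
  (f \in homA S T) <-> (forall m s, f (mact S m s) = mact T m (f s)).
Proof.
split=> [fA m s|fM]; first exact: homA_act.
apply/homAP=> a s; rewrite !act_mact !sum_lfunE linear_sum /=.
by apply: eq_bigr => m _; rewrite !scale_lfunE linearZ /= fM.
Qed.

Lemma mstable_stable S (U : {vspace S}) :
  (forall m u, u \in U -> mact S m u \in U) -> forall a, (act S a @: U <= U)%VS.
Proof.
move=> UM a; apply/subvP=> _ /memv_imgP[u uU ->].
rewrite act_mact sum_lfunE; apply: memv_suml => m _.
by rewrite scale_lfunE memvZ // UM.
Qed.

Definition msubmodule S (U : {vspace S})
  (UM : forall m u, u \in U -> mact S m u \in U) : submodule S :=
  Submodule (mstable_stable UM).

Lemma submod_mact S (N : submodule S) m u : u \in (N : {vspace S}) ->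
  mact S m u \in (N : {vspace S}).
Proof. by move=> uN; apply: (subvP (submod_stable N (malg_elt k m)));
  apply: memv_img. Qed.

Lemma mact_submod S (N : submodule S) m (u : submod N) :
  vsval (mact (submod N) m u) = mact S m (vsval u).
Proof. exact: submod_actE. Qed.

End MonoidModules.

Section GroupModules.
Variables (k : fieldType) (G : finGroupType).
Local Notation kG := (malg k (group_monoid G)).
Implicit Types U V W : algmod kG.

Lemma grp_actM U (g h : G) v : grp_act U (g * h)%g v = grp_act U g (grp_act U h v).
Proof. exact: (@mactME k (group_monoid G)). Qed.

Lemma grp_act1 U v : grp_act U 1%g v = v.
Proof. exact: (@mact1 k (group_monoid G)). Qed.

Lemma grp_actK U (g : G) : cancel (grp_act U g) (grp_act U g^-1%g).
Proof. by move=> v; rewrite -grp_actM mulVg grp_act1. Qed.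

Lemma grp_actKV U (g : G) : cancel (grp_act U g^-1%g) (grp_act U g).
Proof. by move=> v; rewrite -grp_actM mulgV grp_act1. Qed.

Lemma homA_grpP V W (f : 'Hom(V, W)) :
  (f \in homA V W) <-> (forall (g : G) v, f (grp_act V g v) = grp_act W g (f v)).
Proof. exact: (@homA_mactP k (group_monoid G)). Qed.

(** Maschke's theorem: average a linear projection over the group. *)
Lemma maschke U : #|G|%:R != 0 :> k -> semisimple U.
Proof.
move=> G0 N.
pose p : 'End(U) := #|G|%:R^-1 *:
  (\sum_(g : G) (grp_act U g \o (projv N \o grp_act U g^-1%g)))%VF.
have pE v : p v = #|G|%:R^-1 *: \sum_(g : G) grp_act U g (projv N (grp_act U g^-1%g v)).
  rewrite scale_lfunE sum_lfunE; congr (_ *: _); apply: eq_bigr => g _.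
  by rewrite !comp_lfunE.
have NG (g : G) u : u \in (N : {vspace U}) -> grp_act U g u \in (N : {vspace U}).
  exact: (@submod_mact k (group_monoid G)).
exists p; last split.
- apply/homA_grpP=> h v; rewrite !pE linearZ /=; congr (_ *: _); rewrite linear_sum.
  rewrite (reindex_inj (mulgI h)) /=; apply: eq_bigr => g _.
  by rewrite invMg !grp_actM grp_actK.
- by move=> v; rewrite pE memvZ // memv_suml // => g _; rewrite NG ?memv_proj.
move=> v vN /=; rewrite pE (eq_bigr (fun=> v)) => [|g _].
  by rewrite sumr_const -scaler_nat scalerA mulVf ?scale1r.
by rewrite projv_id ?NG // grp_actKV.
Qed.

End GroupModules.

Section HomModule.
Variables (k : fieldType) (G H : finGroupType).
Variables (W : algmod (malg k (group_monoid G))).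
Variables (V : algmod (malg k (group_monoid H))).
Local Notation GH := (group_monoid (G * H)%type).
Local Notation bW := (vbasis {:W}).
Local Notation bV := (vbasis {:V}).
Local Notation DV := 'Hom(V, k^o).
Local Notation bD := (vbasis {:DV}).
Implicit Types (w : W) (v : V) (phi : DV) (p : G * H).

Definition hom_act p : 'End('Hom(V, W)) :=
  linfun (fun f : 'Hom(V, W) => grp_act W p.1 \o (f \o grp_act V p.2^-1%g))%VF.

Lemma hom_actE p f v : hom_act p f v = grp_act W p.1 (f (grp_act V p.2^-1%g v)).
Proof.
rewrite linfunK ?comp_lfunE // => c f1 f2; apply/lfunP=> u.
by rewrite !lfun_simp linearP.
Qed.

Fact hom_act1 : hom_act 1%g = \1%VF.
Proof.
apply/lfunP=> f; apply/lfunP=> v.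
by rewrite hom_actE /= invg1 !grp_act1 id_lfunE.
Qed.

Fact hom_actM p q : hom_act (p * q)%g = (hom_act p \o hom_act q)%VF.
Proof.
apply/lfunP=> f; apply/lfunP=> v; rewrite comp_lfunE !hom_actE /=.
by rewrite invMg !grp_actM.
Qed.

Definition hom_mod : algmod (malg k GH) :=
  @lin_mod k GH 'Hom(V, W) hom_act hom_act1 hom_actM.

Lemma grp_act_hom p f : grp_act hom_mod p f = hom_act p f.
Proof. by rewrite /grp_act /= lin_act_elt. Qed.

Definition rank1 w phi : 'Hom(V, W) := linfun (fun v => phi v *: w).

Lemma rank1E w phi v : rank1 w phi v = phi v *: w.
Proof. by rewrite linfunK // => c x y; rewrite linearP scalerDl scalerA. Qed.

Definition cobasis j : DV := linfun (fun v => coord bV j v : k^o).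

Lemma cobasisE j v : cobasis j v = coord bV j v.
Proof. by rewrite linfunK // => c x y; rewrite linearP. Qed.

Lemma cobasis_expand phi : phi = \sum_(j < \dim {:V}) phi bV`_j *: cobasis j.
Proof.
apply/lfunP=> v; rewrite {1}(coord_vbasis (memvf v)) linear_sum sum_lfunE /=.
apply: eq_bigr => j _; rewrite linearZ scale_lfunE cobasisE /=.
exact: mulrC.
Qed.

Lemma hom_expand f : f = \sum_(j < \dim {:V}) rank1 (f bV`_j) (cobasis j) :> 'Hom(V, W).
Proof.
apply/lfunP=> v; rewrite {1}(coord_vbasis (memvf v)) linear_sum sum_lfunE /=.
by apply: eq_bigr => j _; rewrite linearZ rank1E cobasisE.
Qed.

Lemma dual_separates v v' : (forall phi, phi v = phi v') -> v = v'.
Proof.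
move=> E; rewrite (coord_vbasis (memvf v)) [RHS](coord_vbasis (memvf v')).
by apply: eq_bigr => j _; rewrite -!cobasisE E.
Qed.

Local Notation TD := (tensor_dual W V).

Let kap : 'Hom(TD, hom_mod) := linfun (fun X : 'M[k]_(\dim {:W}, \dim {:DV}) =>
  \sum_(i < \dim {:W}) \sum_(j < \dim {:DV}) X i j *: rank1 bW`_i bD`_j).

Let kapE X : kap X = \sum_(i < \dim {:W}) \sum_(j < \dim {:DV}) (X : 'M[k]_(_,
  _)) i j *: rank1 bW`_i bD`_j.
Proof.
rewrite linfunK // => c Y Z; rewrite scaler_sumr -big_split /=; apply: eq_bigr => i _.
rewrite scaler_sumr -big_split /=; apply: eq_bigr => j _.
by rewrite !mxE scalerDl scalerA.
Qed.

Let kap_pure w phi : kap (pure_tensor w phi) = rank1 w phi.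
Proof.
apply/lfunP=> v; rewrite kapE sum_lfunE rank1E.
rewrite {2}(coord_vbasis (memvf w)) scaler_sumr; apply: eq_bigr => i _.
rewrite sum_lfunE {2}(coord_vbasis (memvf phi)) sum_lfunE scaler_suml.
apply: eq_bigr => j _; rewrite !scale_lfunE rank1E !scalerA !mxE big_ord1 !mxE.
by congr (_ *: _); rewrite -mulrA [RHS]mulrC.
Qed.

(** The tensor w (x) phi is the rank one map v |-> phi(v) w. *)
Lemma tensor_dual_hom : isomod TD hom_mod.
Proof.
exists kap.
  apply/homA_grpP=> p X; rewrite grp_act_hom.
  have -> : grp_act TD p X = tensor_act W V p X by rewrite /grp_act /= lin_act_elt.
  have -> : X = \sum_(i < \dim {:W}) \sum_(j < \dim {:DV}) (X : 'M[k]_(_,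
    _)) i j *: pure_tensor bW`_i bD`_j.
    rewrite {1}[X]matrix_sum_delta; apply: eq_bigr => i _; apply: eq_bigr => j _.
    by rewrite pure_tensor_basis.
  rewrite !linear_sum /=; apply: eq_bigr => i _; rewrite !linear_sum /=.
  apply: eq_bigr => j _; rewrite !linearZ /= tensor_act_pure !kap_pure.
  congr (_ *: _); apply/lfunP=> v; rewrite hom_actE !rank1E dual_actE.
  by rewrite linearZ.
apply: lfun_bij => [|f].
  apply/lker0P; apply/eqP/vspaceP=> X; rewrite memv_ker memv0;
    apply/eqP/eqP=> [X0|->]; last exact: linear0.
  apply/matrixP=> i j; rewrite mxE.
  have E i' : \sum_(j < \dim {:DV}) (X : 'M[k]_(_, _)) i' j *: bD`_j = 0.
    apply/lfunP=> v; rewrite zero_lfunE.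
    have := congr1 (fun f : 'Hom(V, W) => coord bW i' (f v)) X0.
    rewrite /= kapE sum_lfunE zero_lfunE linear0 => <-.
    rewrite (eq_bigr (fun l => (\sum_(j < \dim {:DV}) ((X : 'M[k]_(_,
      _)) l j *: bD`_j) v) *: bW`_l)) => [|l _].
      by rewrite coord_sum_free ?(basis_free (vbasisP _)) // sum_lfunE.
    rewrite sum_lfunE scaler_suml; apply: eq_bigr => j' _.
    by rewrite !scale_lfunE rank1E scalerA.
  by rewrite -(coord_sum_free ((X : 'M[k]_(_, _)) i) j (basis_free (vbasisP {:DV}))) E
    linear0.
exists (\sum_(j < \dim {:V}) pure_tensor (f bV`_j) (cobasis j)).
by rewrite {1}[f]hom_expand linear_sum /=; apply: eq_bigr => j _; rewrite kap_pure.
Qed.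

Hypotheses (Ws : simple_mod W) (Vs : simple_mod V).
Hypotheses (Wend : homA W W = <[\1%VF]>%VS) (Vend : homA V V = <[\1%VF]>%VS).

Let basis_vector (K : finGroupType) (U : algmod (malg k (group_monoid K))) :
  simple_mod U -> 'I_(\dim {:U}).
Proof.
move=> [U0 _]; apply: (@Ordinal _ 0); rewrite lt0n dimv_eq0; apply/eqP.
exact: U0.
Qed.

Let coord1 (U : vectType k) (i : 'I_(\dim {:U})) : coord (vbasis {:U}) i (vbasis
  {:U})`_i = 1.
Proof. by rewrite coord_free ?eqxx // (basis_free (vbasisP _)). Qed.

(** An endomorphism commutes with G in the first factor and with H in the
    second one, so it is scalar in each of them in turn. *)
Lemma hom_mod_end : homA hom_mod hom_mod = <[\1%VF]>%VS.
Proof.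
apply/eqP; rewrite eqEsubv -memvE homA_id andbT; apply/subvP=> F /homA_grpP FA.
have {}FA (g : G) (h : H) f v :
    F (hom_act (g, h) f) v = grp_act W g (F f (grp_act V h^-1%g v)).
  by have := FA (g, h) f; rewrite !grp_act_hom => ->; rewrite hom_actE.
have rank1_linW phi : linear (rank1^~ phi).
  by move=> c x y; apply/lfunP=> v; rewrite !(add_lfunE, scale_lfunE,
    rank1E) scalerDr !scalerA mulrC.
have rank1_linD w : linear (rank1 w).
  by move=> c x y; apply/lfunP=> v; rewrite !(add_lfunE, scale_lfunE,
    rank1E) scalerDl !scalerA.
have step1 phi v : exists c, forall w, F (rank1 w phi) v = c *: w.
  have fE w : linfun (fun w => F (rank1 w phi) v) w = F (rank1 w phi) v.
    by rewrite linfunK // => c x y; rewrite rank1_linW linearP /= add_lfunE scale_lfunE.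
  have : linfun (fun w => F (rank1 w phi) v) \in homA W W.
    apply/homA_grpP=> g w; rewrite !fE.
    have := FA g 1%g (rank1 w phi) v; rewrite invg1 grp_act1 => <-; congr (F _ v).
    by apply/lfunP=> u; rewrite hom_actE /= invg1 grp_act1 !rank1E linearZ.
  rewrite Wend => /vlineP[c cE]; exists c => w.
  by rewrite -fE cE scale_lfunE id_lfunE.
pose w0 := bW`_(basis_vector Ws).
pose c phi v := coord bW (basis_vector Ws) (F (rank1 w0 phi) v).
have FE w phi v : F (rank1 w phi) v = c phi v *: w.
  by have [d dE] := step1 phi v; rewrite /c !dE linearZ /= coord1 mulr1.
have cLD v : linear (fun phi : DV => c phi v : k^o).
  by move=> d x y; rewrite /c rank1_linD linearP add_lfunE scale_lfunE linearP.
have cD phi v : \sum_(j < \dim {:V}) phi bV`_j * c (cobasis j) v = c phi v.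
  rewrite -[RHS](linfunK (cLD v)) {2}[phi]cobasis_expand linear_sum.
  by apply: eq_bigr => j _; rewrite linearZ /= (linfunK (cLD v)).
have cL phi : linear (c phi : V -> k^o).
  by move=> d x y; rewrite /c !linearP.
pose t : 'End(V) := linfun (fun v => \sum_(j < \dim {:V}) c (cobasis j) v *: bV`_j).
have tE v : t v = \sum_(j < \dim {:V}) c (cobasis j) v *: bV`_j.
  rewrite linfunK // => d x y; rewrite scaler_sumr -big_split /=.
  by apply: eq_bigr => j _; rewrite cL scalerDl scalerA.
have phit phi v : phi (t v) = c phi v.
  rewrite tE linear_sum -cD; apply: eq_bigr => j _.
  by rewrite linearZ; exact: mulrC.
have : t \in homA V V.
  apply/homA_grpP=> h v; apply: dual_separates => phi.
  rewrite phit.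
  have := phit (phi \o grp_act V h)%VF v; rewrite comp_lfunE => ->.
  rewrite /c; suff -> : F (rank1 w0 phi) (grp_act V h v) = F (rank1 w0 (phi \o grp_act
    V h)%VF) v by [].
  have := FA 1%g h^-1%g (rank1 w0 phi) v; rewrite grp_act1 invgK => <-; congr (F _ v).
  by apply/lfunP=> u; rewrite hom_actE /= invgK grp_act1 !rank1E comp_lfunE.
rewrite Vend => /vlineP[d dE]; apply/vlineP; exists d.
apply/lfunP=> f; rewrite scale_lfunE id_lfunE {1 2}[f]hom_expand linear_sum scaler_sumr.
apply: eq_bigr => j _; apply/lfunP=> v.
by rewrite FE scale_lfunE rank1E -phit dE scale_lfunE id_lfunE linearZ /= scalerA.
Qed.

(** Semisimple with scalar endomorphisms only, hence simple. *)
Lemma hom_mod_simple : #|{: G * H}|%:R != 0 :> k -> simple_mod hom_mod.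
Proof.
move=> GH0; split=> [H0|N].
  have := memvf (rank1 bW`_(basis_vector Ws) (cobasis (basis_vector Vs)) : hom_mod).
  rewrite H0 memv0 => /eqP/(congr1 (fun f : 'Hom(V, W) =>
    coord bW (basis_vector Ws) (f bV`_(basis_vector Vs)))).
  rewrite /= rank1E cobasisE coord1 scale1r coord1 zero_lfunE linear0.
  by move/eqP; rewrite oner_eq0.
have [p pA [pN pid]] := @maschke k _ hom_mod GH0 N.
move: pA; rewrite hom_mod_end => /vlineP[c pE].
have pv (f : hom_mod) : p f = c *: f by rewrite pE scale_lfunE id_lfunE.
have [c0|c0] := eqVneq c 0; [left|right].
  apply/eqP; rewrite -subv0; apply/subvP=> f fN.
  by rewrite memv0 -(pid f fN) pv c0 scale0r.
apply/eqP; rewrite eqEsubv subvf; apply/subvP=> f _.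
by rewrite -[f](scalerK c0) -pv memvZ.
Qed.

End HomModule.


(** * Finite monoids *)

Section FiniteMonoid.
Variable M : finMonoid.
Implicit Types (a b m r s t u x y z : M) (e f : idem M).
Local Open Scope group_scope.

Lemma idem_power x : exists n, (0 < n)%N /\ x ^+ n * x ^+ n = x ^+ n.
Proof.
have [i [j [ij E]]] : exists i j, (i < j)%N /\ x ^+ i = x ^+ j.
  have /injectivePn[i [j ij E]] : ~~ injectiveb (fun i : 'I_#|{: M}|.+1 => x ^+ i).
    by apply/injectiveP=> /leq_card; rewrite card_ord ltnn.
  have [lt|lt|/val_inj/eqP] := ltngtP i j; last by rewrite (negbTE ij).
    by exists i, j.
  by exists j, i.
pose p := (j - i)%N.
have step n : (i <= n)%N -> x ^+ (n + p) = x ^+ n.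
  move=> iln; rewrite -(subnK iln) -addnA addnBCA ?(ltnW ij) // subnn addn0.
  by rewrite !expgnDr -E.
have steps n q : (i <= n)%N -> x ^+ (n + p * q) = x ^+ n.
  move=> iln; elim: q => [|q IHq]; first by rewrite muln0 addn0.
  by rewrite mulnS addnCA addnC step ?IHq // (leq_trans iln) // leq_addr.
exists (p * i.+1)%N; split; first by rewrite muln_gt0 subn_gt0 ij.
rewrite -expgnDr steps // (leq_trans (leqnSn i)) // leq_pmull //.
by rewrite subn_gt0.
Qed.

(** Stability of finite monoids, by counting: x = a x y b shows that xM has at
    most as many elements as its subset xyM. *)
Lemma stable_right x y : x \in ideal (x * y) -> exists u, x = x * y * u.
Proof.
case/idealP=> a [b xE].
have sub : rideal (x * y) \subset rideal x.
  by apply/subsetP=> _ /imsetP[z _ ->]; apply/imsetP; exists (y * z); rewrite ?mulgA.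
have le : (#|rideal x| <= #|rideal (x * y)%g|)%N.
  apply: leq_trans (leq_imset_card (fun z => a * z) _); apply: subset_leq_card.
  apply/subsetP=> _ /imsetP[z _ ->]; apply/imsetP; exists (x * y * (b * z)).
    by apply/imsetP; exists (b * z).
  by rewrite {1}xE !mulgA.
have /eqP E : rideal (x * y) == rideal x by rewrite eqEcard sub.
have : x \in rideal x by apply/imsetP; exists 1; rewrite ?mulg1.
by rewrite -E => /imsetP[u _ xu]; exists u.
Qed.

Lemma stable_left x y : x \in ideal (y * x) -> exists u, x = u * (y * x).
Proof.
case/idealP=> a [b xE].
have sub : lideal (y * x) \subset lideal x.
  by apply/subsetP=> _ /imsetP[z _ ->]; apply/imsetP; exists (z * y); rewrite ?mulgA.
have le : (#|lideal x| <= #|lideal (y * x)%g|)%N.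
  apply: leq_trans (leq_imset_card (fun z => z * b) _); apply: subset_leq_card.
  apply/subsetP=> _ /imsetP[z _ ->]; apply/imsetP; exists (z * a * (y * x)).
    by apply/imsetP; exists (z * a).
  by rewrite {1}xE !mulgA.
have /eqP E : lideal (y * x) == lideal x by rewrite eqEcard sub.
have : x \in lideal x by apply/imsetP; exists 1; rewrite ?mul1g.
by rewrite -E => /imsetP[u _ xu]; exists u.
Qed.

Lemma mem_ideal x : x \in ideal x.
Proof. by apply/idealP; exists 1, 1; rewrite mul1g mulg1. Qed.

Lemma ideal_mul x y m : x \in ideal m -> m \in ideal y -> x \in ideal y.
Proof.
case/idealP=> a [b ->] /idealP[c [d ->]]; apply/idealP.
by exists (a * c), (d * b); rewrite !mulgA.
Qed.

Lemma ideal_factor a x m y : a \in ideal (x * m * y) -> a \in ideal m.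
Proof. by move=> H; apply: ideal_mul H _; apply/idealP; exists x, y. Qed.

Lemma in_Iset a m : (m \in Iset a) = (a \notin ideal m).
Proof. by rewrite inE. Qed.

Lemma RclassE e r : (r \in Rclass e) = ((e : M) * r == r) && ((e : M) \in ideal r).
Proof.
apply/idP/andP=> [/RclassP[[u rE] [v eE]]|[/eqP er /idealP H]].
  split; first by rewrite rE mulgA idemP.
  by apply/idealP; exists 1, v; rewrite mul1g -eE.
have [u eE] : exists u, (e : M) = (e : M) * r * u by apply: stable_right; rewrite er;
  apply/idealP.
by apply/RclassP; split; [exists r | exists u; rewrite {1}eE er].
Qed.

Lemma LclassE e x : (x \in Lclass e) = (x * (e : M) == x) && ((e : M) \in ideal x).
Proof.
apply/idP/andP=> [/LclassP[[u rE] [v eE]]|[/eqP er /idealP H]].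
  split; first by rewrite rE -mulgA idemP.
  by apply/idealP; exists v, 1; rewrite mulg1 -eE.
have [u eE] : exists u, (e : M) = u * (x * (e : M)) by apply: stable_left;
  rewrite er; apply/idealP.
by apply/LclassP; split; [exists x | exists u; rewrite {1}eE er].
Qed.

Lemma Rclass_el e r : r \in Rclass e -> (e : M) * r = r.
Proof. by rewrite RclassE => /andP[/eqP]. Qed.

Lemma mem_Rclass e : (e : M) \in Rclass e.
Proof. by rewrite inE. Qed.

Lemma Rclass_mul_unit e (h : max_subgroup e) r : r \in Rclass e ->
  ms_val h * r \in Rclass e.
Proof.
have [eh _] := ms_mul_e h; rewrite !RclassE => /andP[/eqP er H].
rewrite mulgA eh eqxx /=; apply: ideal_mul H _; apply/idealP.
by exists (ms_val h^-1), 1; rewrite mulg1 mulgA -ms_valM mulVg er.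
Qed.

Lemma unit_setE e x : (e : M) * x = x -> x * (e : M) = x -> (e : M) \in ideal x ->
  x \in unit_set e.
Proof.
move=> ex xe H.
have /RclassP[_ [u eu]] : x \in Rclass e by rewrite RclassE ex eqxx.
have /LclassP[_ [v ve]] : x \in Lclass e by rewrite LclassE xe eqxx.
have vu : v * (e : M) = (e : M) * u by rewrite {1}eu mulgA -ve.
have cP := cornerP _ (idemP e).
apply/unit_setP; split; first exact/cP.
exists ((e : M) * u * (e : M)); first by apply/imsetP; exists u.
split; first by rewrite !mulgA xe -eu idemP.
by rewrite -vu -!mulgA !ex -ve.
Qed.

Lemma unit_of e r y : r \in Rclass e -> y \in Lclass e -> (e : M) \in ideal (r * y) ->
  exists h : max_subgroup e, ms_val h = r * y.
Proof.
rewrite RclassE LclassE => /andP[/eqP er _] /andP[/eqP ye _] H.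
have U : r * y \in unit_set e by apply: unit_setE => //;
  rewrite -?mulgA ?ye // mulgA er.
by exists (exist _ (r * y) U : max_subgroup e).
Qed.

Lemma Rclass_Lclass_mem e r y : r \in Rclass e ->
  (r * y \in Rclass e) = ((e : M) \in ideal (r * y)).
Proof. by move/Rclass_el=> er; rewrite RclassE mulgA er eqxx. Qed.

(** These elements are dual to the R-class of e: r' (Lsec r) falls below the
    J-class of e unless r' is a unit multiple of r. *)
Definition Lsec e r : M := odflt (e : M) [pick x in Lclass e | r * x == (e : M)].

Lemma LsecP e r : r \in Rclass e -> Lsec e r \in Lclass e /\ r * Lsec e r = (e : M).
Proof.
move=> rR; rewrite /Lsec; case: pickP => [x /andP[xL /eqP]//|no].
case/RclassP: (rR) => _ [u eu]; have := no (u * (e : M)).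
rewrite mulgA -eu idemP eqxx andbT => /negP[]; rewrite LclassE -mulgA idemP eqxx /=.
by apply/idealP; exists r, 1; rewrite mulg1 mulgA -eu idemP.
Qed.

Lemma Lsec_L e r : r \in Rclass e -> Lsec e r \in Lclass e.
Proof. by case/LsecP. Qed.

Lemma mul_Lsec e r : r \in Rclass e -> r * Lsec e r = (e : M).
Proof. by case/LsecP. Qed.

Lemma Lclass_mull e x z : x \in Lclass e -> (z * x \in Lclass e) = ((e : M) \in ideal
  (z * x)).
Proof. by rewrite !LclassE => /andP[/eqP xe _]; rewrite -mulgA xe eqxx. Qed.

Lemma fMe_mem e f x : (f : M) * x = x -> x * (e : M) = x -> x \in fMe (e : M) (f : M).
Proof. by move=> fx xe; apply/imsetP; exists x; rewrite // fx xe. Qed.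

Lemma fM_Le_fMe e f x : x \in fM_Le (e : M) (f : M) -> x \in fMe (e : M) (f : M).
Proof.
case/setIP=> /imsetP[a _ xa] xL; apply: fMe_mem; last exact: Lclass_e.
by rewrite xa mulgA idemP.
Qed.

Lemma fM_Le_unit_mul e f (g : max_subgroup f) (h : max_subgroup e) x :
  x \in fM_Le (e : M) (f : M) ->
  ms_val g * x \in Lclass (e : M) /\ ms_val g * x * ms_val h \in fM_Le (e : M) (f : M).
Proof.
move=> xM; have /setIP[_ xL] := xM; have [fx xe] := fMeP (fM_Le_fMe xM).
have gxL : ms_val g * x \in Lclass (e : M).
  rewrite Lclass_mull //; have /LclassP[_ [u eu]] := xL.
  apply/idealP; exists (u * ms_val g^-1), 1.
  by rewrite mulg1 -mulgA (mulgA (ms_val _) (ms_val g)) -ms_valM mulVg ms_val1 fx.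
split=> //; apply/setIP; split; last exact: Lclass_mulr.
apply/imsetP; exists (ms_val g * x * ms_val h) => //.
by rewrite !mulgA (ms_mul_e g).1.
Qed.

End FiniteMonoid.

(** * Idempotents generating an R-trivial monoid *)

Section RtrivialIdempotents.
Variable M : finMonoid.
Hypothesis Rt : Rtrivial (gen_submonoid (idempotents M)).
Implicit Types (a b m r s t u x y z : M) (e f : idem M).
Local Open Scope group_scope.

Lemma gen_idem e : (e : M) \in gen_submonoid (idempotents M).
Proof. by apply/bigcapP=> T /andP[_ /subsetP]; apply; exact: valP. Qed.

Lemma gen_mul x y : x \in gen_submonoid (idempotents M) ->
  y \in gen_submonoid (idempotents M) -> x * y \in gen_submonoid (idempotents M).
Proof.
move=> /bigcapP X /bigcapP Y; apply/bigcapP=> T HT.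
have /andP[/andP[_ /forall_inP TM] _] := HT.
exact: (forall_inP (TM x (X T HT))) (Y T HT).
Qed.

Lemma gen_one : 1 \in gen_submonoid (idempotents M).
Proof. by apply/bigcapP=> T /andP[/andP[]]. Qed.

Lemma gen_Requiv x y u v : let N := gen_submonoid (idempotents M) in
  x \in N -> y \in N -> u \in N -> v \in N -> x = y * u -> y = x * v -> x = y.
Proof.
move=> N xN yN uN vN xE yE; apply: Rt => //; apply/setP=> t.
apply/imsetP/imsetP=> -[s sN ->].
  by exists (u * s); [exact: gen_mul | rewrite {1}xE mulgA].
by exists (v * s); [exact: gen_mul | rewrite {1}yE mulgA].
Qed.

Lemma idem_Runique a b : a * a = a -> b * b = b -> a * b = b -> b * a = a -> a = b.
Proof.
move=> aa bb ab ba.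
have aI : a \in idempotents M by rewrite inE aa.
have bI : b \in idempotents M by rewrite inE bb.
have aN := gen_idem (exist _ a aI); have bN := gen_idem (exist _ b bI).
exact: (gen_Requiv aN bN aN bN (esym ba) (esym ab)).
Qed.

(** M acts by partial injections on the right of a regular R-class: if t
    inverts the action of m on r and s alike, then t r and t s are idempotents
    in one R-class, hence equal. *)
Lemma Rclass_inj e r s m : r \in Rclass e -> s \in Rclass e ->
  r * m = s * m -> r * m \in Rclass e -> r = s.
Proof.
move=> rR sR E /RclassP[_ [v ev]].
have rt : r * (m * v) = (e : M) by rewrite mulgA -ev.
have st : s * (m * v) = (e : M) by rewrite mulgA -E -ev.
have er := Rclass_el rR; have es := Rclass_el sR.
have T : m * v * r = m * v * s.
  have key x y : x * (m * v) = (e : M) -> (e : M) * y = y ->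
    m * v * x * (m * v * y) = m * v * y.
    by move=> xe ey; rewrite mulgA -(mulgA (m * v)) xe -mulgA ey.
  by apply: idem_Runique; apply: key.
by rewrite -er -rt -mulgA T mulgA rt es.
Qed.

(** If r y = h and r' y = h' are units, then r and h h'^-1 r' agree after y, so
    they are equal because y acts injectively. *)
Lemma orbit_mem e r r' y : r \in Rclass e -> r' \in Rclass e -> y \in Lclass e ->
  (e : M) \in ideal (r * y) -> (e : M) \in ideal (r' * y) ->
  exists h : max_subgroup e, r = ms_val h * r'.
Proof.
move=> rR r'R yL H H'.
have [h hE] := unit_of rR yL H; have [h' h'E] := unit_of r'R yL H'.
have E : ms_val (h * h'^-1) * r' * y = r * y.
  by rewrite -mulgA -h'E -ms_valM -mulgA mulVg mulg1.
exists (h * h'^-1); apply: (Rclass_inj rR (Rclass_mul_unit _ r'R) (esym E)).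
by rewrite Rclass_Lclass_mem.
Qed.

Lemma orbit_inj e r : r \in Rclass e -> injective (fun h : max_subgroup e =>
  ms_val h * r).
Proof.
move=> rR h h' E; apply: ms_inj.
have [_ he] := ms_mul_e h; have [_ h'e] := ms_mul_e h'.
by rewrite -he -h'e -(mul_Lsec rR) !mulgA E.
Qed.

Lemma sum_orbit e r (V : zmodType) (F : M -> V) : r \in Rclass e ->
  (forall s, s \in Rclass e -> (forall h : max_subgroup e, s <> ms_val h * r) ->
    F s = 0%R) ->
  (\sum_(s in Rclass e) F s = \sum_(h : max_subgroup e) F (ms_val h * r)%g)%R.
Proof.
move=> rR F0; pose O := [set ms_val h * r | h : max_subgroup e].
rewrite (bigID (mem O)) /= [X in (_ + X)%R]big1 ?GRing.addr0 => [|s /andP[sR sO]].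
  rewrite (eq_bigl (mem O)) => [|s].
    by rewrite big_imset //= => h h' _ _; exact: orbit_inj.
  by apply/andb_idl => /imsetP[h _ ->]; exact: Rclass_mul_unit.
by apply: F0 => // h sE; case/negP: sO; apply/imsetP; exists h.
Qed.

(** An element of the L-class of e is defined on a single orbit of the maximal
    subgroup in the R-class, so one value determines its action. *)
Lemma same_on_ReE e y y' r : y \in Lclass e -> y' \in Lclass e -> r \in Rclass e ->
  (e : M) \in ideal (r * y) -> r * y = r * y' -> same_on_Re e y y'.
Proof.
move=> yL y'L rR H E.
have half x x' : x \in Lclass e -> (e : M) \in ideal (r * x) -> r * x = r * x' ->
    forall s, s \in Rclass e -> s * x \in Rclass e -> s * x = s * x'.
  move=> xL Hx Ex s sR; rewrite Rclass_Lclass_mem // => Hs.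
  by have [h ->] := orbit_mem sR rR xL Hs Hx; rewrite -!mulgA Ex.
apply/forall_inP=> s sR; have [sy|sy] := boolP (s * y \in Rclass e).
  by rewrite -(half _ _ yL H E s sR sy) sy !eqxx.
rewrite andbT eq_sym eqbF_neg; apply: contra sy => sy'.
by rewrite -(half _ _ y'L _ (esym E) s sR sy') // -E.
Qed.

Lemma same_on_Re_sym e x y : same_on_Re e x y -> same_on_Re e y x.
Proof.
move=> /forall_inP S; apply/forall_inP=> r rR; have /andP[/eqP E I] := S r rR.
by rewrite -E eqxx /= eq_sym.
Qed.

Lemma same_on_Re_eq e x y r : same_on_Re e x y -> r \in Rclass e ->
  r * x \in Rclass e -> r * x = r * y.
Proof. by move=> /forall_inP S rR rx; have /andP[_ /implyP/(_ rx)/eqP] := S r rR. Qed.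

Lemma same_on_Re_mem e x y r : same_on_Re e x y -> r \in Rclass e ->
  (r * x \in Rclass e) = (r * y \in Rclass e).
Proof. by move=> /forall_inP S rR; have /andP[/eqP] := S r rR. Qed.

Lemma same_Lclass_mull e x y z : x \in Lclass e -> y \in Lclass e -> same_on_Re e x y ->
  (z * x \in Lclass e) = (z * y \in Lclass e).
Proof.
have half x' y' : x' \in Lclass e -> y' \in Lclass e -> same_on_Re e x' y' ->
    z * x' \in Lclass e -> z * y' \in Lclass e.
  move=> xL yL S; rewrite !Lclass_mull // => H.
  have /LclassP[_ [u eu]] : z * x' \in Lclass e by rewrite Lclass_mull.
  have rx : (e : M) * u * z * x' = (e : M) by rewrite -!mulgA -eu idemP.
  have rR : (e : M) * u * z \in Rclass e.
    rewrite RclassE !mulgA idemP eqxx /=; apply/idealP; exists 1, x'.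
    by rewrite mul1g rx.
  have rxR : (e : M) * u * z * x' \in Rclass e by rewrite rx mem_Rclass.
  apply/idealP; exists ((e : M) * u), 1.
  by rewrite mulg1 mulgA -(same_on_Re_eq S rR rxR) rx.
move=> xL yL S; apply/idP/idP; apply: half => //; exact: same_on_Re_sym.
Qed.

Lemma same_on_Re_mull e x y z : x \in Lclass e -> y \in Lclass e -> same_on_Re e x y ->
  same_on_Re e (z * x) (z * y).
Proof.
move=> xL yL S; apply/forall_inP=> r rR; rewrite !mulgA.
have [rz|rz] := boolP (r * z \in Rclass e); first exact: (forall_inP S) rz.
have no t : r * z * t \notin Rclass e.
  apply: contra rz; rewrite -mulgA !Rclass_Lclass_mem // mulgA.
  by rewrite -[r * z * t]mul1g mulgA; exact: ideal_factor.
by rewrite !(negbTE (no _)).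
Qed.

(** If x is R-equivalent to f, some r in the R-class of e satisfies r x = e and
    x r = f; then r y = e too, whence y = x r y = x. *)
Lemma same_fM_Le e f x y : x \in fM_Le e f -> y \in fM_Le e f -> same_on_Re e x y ->
  x = y \/ x \in Iset f /\ y \in Iset f.
Proof.
have half x' y' : x' \in fM_Le e f -> y' \in fM_Le e f -> same_on_Re e x' y' ->
    (f : M) \in ideal x' -> x' = y'.
  move=> /setIP[/imsetP[a _ xa] xL] /setIP[/imsetP[b _ yb] yL] S H.
  have fx : (f : M) * x' = x' by rewrite xa mulgA idemP.
  have fy : (f : M) * y' = y' by rewrite yb mulgA idemP.
  have /RclassP[_ [t ft]] : x' \in Rclass f by rewrite RclassE fx eqxx.
  have /LclassP[_ [u eu]] := xL.
  have xe := Lclass_e xL; have ye := Lclass_e yL.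
  pose r := (e : M) * u * (f : M).
  have rx : r * x' = (e : M) by rewrite /r -!mulgA fx -eu idemP.
  have rR : r \in Rclass e.
    rewrite RclassE /r !mulgA idemP eqxx /=; apply/idealP; exists 1, x'.
    by rewrite mul1g -/r rx.
  have rxR : r * x' \in Rclass e by rewrite rx mem_Rclass.
  have ry := same_on_Re_eq S rR rxR.
  have rE : r = (e : M) * t by rewrite /r {1}ft -mulgA (mulgA u) -eu mulgA idemP.
  have xr : x' * r = (f : M) by rewrite rE mulgA xe -ft.
  by rewrite -fy -xr -mulgA -ry rx xe.
move=> xf yf S.
have [H|H] := boolP ((f : M) \in ideal x); first by left; exact: half H.
have [H'|H'] := boolP ((f : M) \in ideal y).
  by left; apply/esym/half => //; exact: same_on_Re_sym.
by right; rewrite !in_Iset.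
Qed.

(** If z a = z and e a <> e for an idempotent a, then z = z b e with b an
    idempotent power of e a; R-triviality forces b below the J-class of e. *)
Lemma not_Ltilde_fIIe e f z : z \in fMe e f -> z \in Iset f ->
  z \notin Ltilde_class e -> z \in fIIe e f.
Proof.
move=> /fMeP[fz ze] zI; rewrite inE => /forall_inPn[a aI /negP zaea].
have aa : a * a = a by move: aI; rewrite inE => /eqP.
have ea : (e : M) * a = (e : M) -> z * a = z by move=> E; rewrite -{1}ze -mulgA E ze.
have [za eaN] : z * a = z /\ (e : M) * a <> (e : M).
  have [E|E] := eqVneq ((e : M) * a) (e : M).
    by case: zaea; rewrite E (ea E) !eqxx.
  have [E'|E'] := eqVneq (z * a) z; first by split=> //; apply/eqP.
  by case: zaea; rewrite (negbTE E) (negbTE E').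
have [n [n0 bb]] := idem_power ((e : M) * a).
set b := _ ^+ n in bb.
have zb : z * b = z.
  rewrite /b; elim: (n) => [|i IHi]; first by rewrite expg0 mulg1.
  by rewrite expgSr mulgA IHi mulgA ze za.
have eb : (e : M) * b = b.
  by rewrite /b -(prednK n0) expgS !mulgA idemP.
have bI : b \in Iset e.
  rewrite in_Iset; apply/negP=> H.
  have /RclassP[_ [u eu]] : b \in Rclass e by rewrite RclassE eb eqxx.
  have be : b * (e : M) = (e : M) by rewrite eu mulgA bb.
  have eE : (e : M) = b by apply: idem_Runique => //; exact: idemP.
  case: eaN; apply/esym.
  have aN : a \in gen_submonoid (idempotents M) by exact: (gen_idem (exist _ a aI)).
  have eaG := gen_mul (gen_idem e) aN.
  have powN i : ((e : M) * a) ^+ i \in gen_submonoid (idempotents M).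
    elim: i => [|i IHi]; first by rewrite expg0 gen_one.
    by rewrite expgS gen_mul.
  apply: (gen_Requiv (gen_idem e) eaG (powN n.-1) aN) => //.
  by rewrite -expgS prednK.
apply/imset2P; exists z b => //.
by rewrite fz zb ze.
Qed.

End RtrivialIdempotents.


(** * Modules with a given apex *)

Section Apex.
Variables (k : fieldType) (M : finMonoid).
Implicit Types (S T : algmod (malg k M)) (e : idem M).

(** All elements that are not J-above e act as zero, but e does not. *)
Definition apex S e : bool :=
  [forall m in Iset (e : M), mact S m == 0] && (mact S e != 0).

Lemma apex_kill S e m s : apex S e -> m \in Iset (e : M) -> mact S m s = 0.
Proof. by case/andP=> /forall_inP K _ /K/eqP->; rewrite zero_lfunE. Qed.

(** This embeds S in the functions from the R-class of e to the corner eS; it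
    holds for simple modules with apex e. *)
Definition detects S e := forall s,
  (forall r, r \in Rclass (e : M) -> mact S r s = 0) -> s = 0.

Lemma detects_eq S e s t : detects S e ->
  (forall r, r \in Rclass (e : M) -> mact S r s = mact S r t) -> s = t.
Proof.
move=> D E; apply/eqP; rewrite -subr_eq0; apply/eqP/D => r rR.
by rewrite linearB /= E // subrr.
Qed.

Lemma mact_Rclass0 S e r m s : apex S e -> r \in Rclass (e : M) ->
  (r * m)%g \notin Rclass (e : M) -> mact S r (mact S m s) = 0.
Proof.
move=> aS rR; rewrite RclassE mulgA (Rclass_el rR) eqxx /= -in_Iset => rm.
by rewrite -mactME (apex_kill _ aS).
Qed.

Definition corner_vs S e : {vspace S} := limg (mact S e).

Lemma corner_vsP S e s : reflect (mact S e s = s) (s \in corner_vs S e).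
Proof.
apply: (iffP idP) => [/memv_imgP[t _ ->]|<-]; last by rewrite memv_img ?memvf.
by rewrite -mactME idemP.
Qed.

Lemma mact_corner S e m s : ((e : M) * m = m)%g -> mact S m s \in corner_vs S e.
Proof. by move=> em; apply/corner_vsP; rewrite -mactME em. Qed.

(** When I(e) acts as zero this is the largest submodule that e sends into U,
    because eM consists of the R-class of e and of elements of I(e). *)
Definition Rclass_preim S e (U : {vspace S}) : {vspace S} :=
  (\bigcap_(r in Rclass (e : M)) (mact S r @^-1: U))%VS.

Lemma Rclass_preimP S e (U : {vspace S}) s :
  reflect (forall r, r \in Rclass (e : M) -> mact S r s \in U)
          (s \in Rclass_preim e U).
Proof.
apply: (iffP idP) => [|H]; rewrite memvE.
  move/subv_bigcapP=> H r rR; have := H r rR.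
  by rewrite -memvE -memv_preim.
by apply/subv_bigcapP=> r rR; rewrite -memvE -memv_preim H.
Qed.

Lemma Rclass_preim_stable S e (U : {vspace S}) (aS : apex S e) m s :
  s \in Rclass_preim e U -> mact S m s \in Rclass_preim e U.
Proof.
move/Rclass_preimP=> H; apply/Rclass_preimP=> r rR.
have [rm|rm] := boolP ((r * m)%g \in Rclass (e : M)); first by rewrite -mactME H.
by rewrite (mact_Rclass0 _ aS) ?mem0v.
Qed.

Lemma simple_detects S e : simple_mod S -> apex S e -> detects S e.
Proof.
move=> [_ Ss] aS s sR.
have : s \in Rclass_preim e (0%VS : {vspace S}).
  by apply/Rclass_preimP=> r rR; rewrite sR ?mem0v.
case: (Ss (msubmodule (@Rclass_preim_stable S e 0 aS))) => /= E.
  by rewrite E memv0 => /eqP.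
case/andP: aS => _ /eqP[]; apply/lfunP=> t; apply/eqP.
have : t \in Rclass_preim e (0%VS : {vspace S}) by rewrite E memvf.
by move/Rclass_preimP/(_ _ (mem_Rclass e)); rewrite memv0 zero_lfunE.
Qed.

Section CornerModule.
Variables (S : algmod (malg k M)) (e : idem M).

Definition corner_act (g : max_subgroup e) : 'End(subvs_of (corner_vs S e)) :=
  linfun (fun u => vsproj (corner_vs S e) (mact S (ms_val g) (vsval u))).

Lemma corner_actE g u : vsval (corner_act g u) = mact S (ms_val g) (vsval u).
Proof.
rewrite linfunK => [|c v w]; last by rewrite !linearP.
by rewrite vsprojK // mact_corner // (ms_mul_e g).1.
Qed.

Fact corner_act1 : corner_act 1%g = \1%VF.
Proof.
apply/lfunP=> u; apply: subvs_inj; rewrite corner_actE id_lfunE ms_val1.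
exact/corner_vsP/subvsP.
Qed.

Fact corner_actM g h : corner_act (g * h)%g = (corner_act g \o corner_act h)%VF.
Proof.
apply/lfunP=> u; apply: subvs_inj; rewrite comp_lfunE !corner_actE ms_valM.
by rewrite mactME.
Qed.

Definition corner_mod : algmod (malg k (group_monoid (max_subgroup e))) :=
  @lin_mod k (group_monoid (max_subgroup e)) _ corner_act corner_act1 corner_actM.

Lemma grp_corner g (u : corner_mod) :
  vsval (grp_act corner_mod g u) = mact S (ms_val g) (vsval u).
Proof. by rewrite -corner_actE /grp_act /= lin_act_elt. Qed.

Definition cval (u : corner_mod) : S := vsval u.
Definition cproj (s : S) : corner_mod := vsproj (corner_vs S e) s.

Lemma cvalK : cancel cval cproj.
Proof. exact: vsvalK. Qed.

Lemma cval_inj : injective cval.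
Proof. exact: can_inj cvalK. Qed.

Lemma cprojK s : mact S e s = s -> cval (cproj s) = s.
Proof. by move/corner_vsP; exact: vsprojK. Qed.

Lemma cproj_mactK m s : ((e : M) * m = m)%g -> cval (cproj (mact S m s)) = mact S m s.
Proof. by move=> em; rewrite cprojK // -mactME em. Qed.

Lemma cval_e u : mact S e (cval u) = cval u.
Proof. exact/corner_vsP/subvsP. Qed.

Lemma cval_linear : linear cval.
Proof. exact: linearP. Qed.

Lemma cvalB u v : cval (u - v) = cval u - cval v.
Proof. exact: linearB. Qed.

Lemma cproj_linear : linear cproj.
Proof. exact: linearP. Qed.

Lemma cval_grp g u : cval (grp_act corner_mod g u) = mact S (ms_val g) (cval u).
Proof. exact: grp_corner. Qed.

Lemma grp_cproj g s : mact S e s = s ->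
  grp_act corner_mod g (cproj s) = cproj (mact S (ms_val g) s).
Proof.
move=> es; apply: cval_inj; rewrite cval_grp cprojK //.
by rewrite cproj_mactK // (ms_mul_e g).1.
Qed.

End CornerModule.

Lemma Rclass_mul_e e r : r \in Rclass (e : M) ->
  (e : M) \in ideal (r * (e : M))%g -> exists h : max_subgroup e,
    (r * (e : M))%g = ms_val h.
Proof.
move=> rR H; have U : (r * (e : M))%g \in unit_set (e : M).
  by apply: unit_setE => //; rewrite ?mulgA ?(Rclass_el rR) // -mulgA idemP.
by exists (exist _ (r * (e : M))%g U : max_subgroup e).
Qed.

(** A submodule of the corner is the image under e of the submodule of S that
    the R-class of e sends into it. *)
Lemma corner_simple S e : simple_mod S -> apex S e -> simple_mod (corner_mod S e).
Proof.
move=> Ssimple aS; have [_ Ss] := Ssimple; have D := simple_detects Ssimple aS.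
split=> [E|N].
  case/andP: aS => _ /eqP[]; apply/lfunP=> s; rewrite zero_lfunE.
  rewrite -(@cproj_mactK S e (e : M) s) ?idemP //.
  have : cproj e (mact S (e : M) s) \in (fullv : {vspace corner_mod S e}) by exact:
    memvf.
  by rewrite E memv0 => /eqP->; exact: linear0.
pose U : {vspace S} := (linfun (vsval : corner_mod S e -> S) @: N)%VS.
have UP (u : corner_mod S e) : (cval u \in U) = (u \in (N : {vspace _})).
  apply/idP/idP=> [/memv_imgP[v vN]|uN].
    by rewrite lfunE /= => /cval_inj->.
  by apply/memv_imgP; exists u; rewrite ?lfunE.
case: (Ss (msubmodule (@Rclass_preim_stable S e U aS))) => /= E; [left|right].
  apply/eqP; rewrite -subv0; apply/subvP=> u uN; rewrite memv0.
  suff : cval u \in Rclass_preim e U.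
    by rewrite E memv0 => /eqP u0; apply/eqP/cval_inj; rewrite u0; exact/esym/linear0.
  apply/Rclass_preimP=> r rR; rewrite -cval_e -mactME.
  have [H|H] := boolP ((e : M) \in ideal (r * (e : M))%g).
    have [h ->] := Rclass_mul_e rR H.
    by rewrite -cval_grp UP; apply: (@submod_mact k (group_monoid _)).
  by rewrite (apex_kill _ aS) ?mem0v // in_Iset.
apply/eqP; rewrite eqEsubv subvf; apply/subvP=> u _; rewrite -UP.
have : cval u \in Rclass_preim e U by rewrite E memvf.
by move/Rclass_preimP/(_ _ (mem_Rclass e)); rewrite cval_e.
Qed.

Lemma corner_isomod S T e : isomod S T -> isomod (corner_mod S e) (corner_mod T e).
Proof.
have half S' T' (f : 'Hom(S', T')) : f \in homA S' T' ->
  exists F : 'Hom(corner_mod S' e, corner_mod T' e),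
    F \in homA (corner_mod S' e) (corner_mod T' e) /\ forall u, cval (F u) = f (cval u).
  move=> fA; pose F : 'Hom(corner_mod S' e, corner_mod T' e) :=
    linfun (fun u => cproj e (f (cval u))).
  have FE u : cval (F u) = f (cval u).
    rewrite linfunK => [|c x y]; first by rewrite cprojK // -(homA_act _ _ fA) -/(mact
      S' e) cval_e.
    by rewrite cval_linear linearP cproj_linear.
  exists F; split=> //; apply/homA_grpP=> g u; apply: cval_inj.
  by rewrite cval_grp !FE cval_grp; exact: homA_act.
case/isomodP=> f [g [/half[F [FA FE]] /half[G [GA GE]] fK gK]].
apply/isomodP; exists F, G; split=> // u; apply: cval_inj.
  by rewrite GE FE fK.
by rewrite FE GE gK.
Qed.

Hypothesis Rt : Rtrivial (gen_submonoid (idempotents M)).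

(** S cannot tell apart two elements of the L-class with the same action on
    the R-class, since it is detected by the R-class. *)
Lemma same_act S e x y s : apex S e -> detects S e ->
  x \in Lclass (e : M) -> y \in Lclass (e : M) -> same_on_Re (e : M) x y ->
  mact S x s = mact S y s.
Proof.
move=> aS D xL yL xy; apply: (detects_eq D) => r rR.
have [rx|rx] := boolP ((r * x)%g \in Rclass (e : M)).
  by rewrite -!mactME (same_on_Re_eq xy rR rx).
by rewrite !(mact_Rclass0 _ aS) // -(same_on_Re_mem xy rR).
Qed.

Section Glue.
Variables (S : algmod (malg k M)) (e : idem M).
Hypothesis aS : apex S e.
Hypothesis Ge0 : #|{: max_subgroup e}|%:R != 0 :> k.

(** An equivariant family of prescribed values psi r for r s, r in the R-class
    of e, is realized by this element s. *)
Definition glue (psi : M -> S) : S :=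
  #|{: max_subgroup e}|%:R^-1 *:
    \sum_(r in Rclass (e : M)) mact S (Lsec e r) (psi r).

Lemma glueP psi :
  (forall (h : max_subgroup e) r, r \in Rclass (e : M) ->
     psi (ms_val h * r)%g = mact S (ms_val h) (psi r)) ->
  forall r, r \in Rclass (e : M) -> mact S r (glue psi) = psi r.
Proof.
move=> psiG r rR; rewrite linearZ linear_sum /=.
rewrite (sum_orbit (F := fun s => mact S r (mact S (Lsec e s) (psi s))) rR).
  rewrite (eq_bigr (fun=> psi r)) => [|h _].
    by rewrite sumr_const -scaler_nat scalerA mulVf ?scale1r.
  have hrR := Rclass_mul_unit h rR.
  have rE : r = (ms_val h^-1 * (ms_val h * r))%g.
    by rewrite mulgA -ms_valM mulVg ms_val1 (Rclass_el rR).
  have -> : mact S r (mact S (Lsec e (ms_val h * r)%g) (psi (ms_val h * r)%g)) =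
      mact S (r * Lsec e (ms_val h * r))%g (psi (ms_val h * r)%g) by rewrite mactME.
  rewrite {1}rE -mulgA (mul_Lsec hrR) psiG // -mactME -mulgA (ms_mul_e h).1.
  by rewrite -ms_valM mulVg ms_val1 -(psiG 1%g) ?ms_val1 ?(Rclass_el rR).
move=> s sR no; rewrite -mactME (apex_kill _ aS) // in_Iset; apply/negP=> H.
have He : (e : M) \in ideal (s * Lsec e s)%g by rewrite mul_Lsec ?mem_ideal.
by have [h sE] := orbit_mem Rt sR rR (Lsec_L sR) He H; case: (no h).
Qed.

Lemma glue_id s : detects S e -> glue (fun r => mact S r s) = s.
Proof.
move=> D; apply: (detects_eq D) => r rR.
by rewrite glueP // => h t _; rewrite mactME.
Qed.

End Glue.

Lemma glue_linear (V : vectType k) S e (psi : V -> M -> S) :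
  (forall r, linear (psi^~ r)) -> linear (fun v => glue e (psi v)).
Proof.
move=> L c u v; rewrite /glue scalerA (mulrC c) -scalerA -scalerDr; congr (_ *: _).
by rewrite scaler_sumr -big_split; apply: eq_bigr => r _; rewrite L linearP.
Qed.

(** By gluing, S is spanned by the translates of its corner, and every nonzero
    submodule meets the corner. *)
Lemma simple_of_corner S e : #|{: max_subgroup e}|%:R != 0 :> k ->
  apex S e -> detects S e -> simple_mod (corner_mod S e) -> simple_mod S.
Proof.
move=> Ge0 aS D [c0 Cs]; split=> [E|N].
  apply: c0; apply/eqP; rewrite -subv0; apply/subvP=> u _; rewrite memv0.
  apply/eqP/cval_inj; have := memvf (cval u); rewrite E memv0 => /eqP->.
  exact/esym/linear0.
pose U : {vspace corner_mod S e} := (linfun (vsval : corner_mod S e -> S) @^-1: N)%VS.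
have UP u : (u \in U) = (cval u \in (N : {vspace S})) by rewrite -memv_preim lfunE.
have US (g : group_monoid (max_subgroup e)) u : u \in U ->
  mact (corner_mod S e) g u \in U.
  rewrite !UP => uN; rewrite (cval_grp g); exact: submod_mact.
have rU r s : r \in Rclass (e : M) -> s \in (N : {vspace S}) ->
  cproj e (mact S r s) \in U.
  by move=> rR sN; rewrite UP cproj_mactK ?(Rclass_el rR) // submod_mact.
case: (Cs (msubmodule US)) => /= E; [left|right].
  apply/eqP; rewrite -subv0; apply/subvP=> s sN; rewrite memv0.
  apply/eqP/D => r rR; have := rU r s rR sN; rewrite E memv0 => /eqP E0.
  by rewrite -(@cproj_mactK S e r s) ?(Rclass_el rR) // E0; exact: linear0.
apply/eqP; rewrite eqEsubv subvf; apply/subvP=> s _.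
rewrite -(glue_id aS Ge0 s D); apply: memvZ; apply: memv_suml => r rR.
apply: submod_mact; rewrite -(@cproj_mactK S e r s) ?(Rclass_el rR) // -UP E.
exact: memvf.
Qed.

(** An element s is determined by the values r s in the corner, and every
    equivariant family of values occurs; so a map of corners extends to the
    modules. *)
Lemma isomod_of_corner S T e : #|{: max_subgroup e}|%:R != 0 :> k ->
  apex S e -> apex T e -> detects S e -> detects T e ->
  isomod (corner_mod S e) (corner_mod T e) -> isomod S T.
Proof.
move=> Ge0 aS aT DS DT /isomodP[f [g [fA gA fK gK]]].
have half S' T' (aS' : apex S' e) (aT' : apex T' e) (DT' : detects T' e)
  (p : 'Hom(corner_mod S' e, corner_mod T' e)) : p \in homA (corner_mod S' e)
    (corner_mod T' e) ->
  exists P : 'Hom(S', T'), P \in homA S' T' /\ forall r s, r \in Rclass (e : M) ->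
    mact T' r (P s) = cval (p (cproj e (mact S' r s))).
  move=> /homA_grpP pA.
  pose psi s r := cval (p (cproj e (mact S' r s))).
  have psiL r : linear (psi^~ r).
    by move=> c x y; rewrite /psi linearP cproj_linear linearP cval_linear.
  pose P := linfun (fun s => glue e (psi s)).
  have PE s : P s = glue e (psi s) by rewrite linfunK //; exact: glue_linear.
  have PR r s : r \in Rclass (e : M) -> mact T' r (P s) = psi s r.
    move=> rR; rewrite PE (glueP aT' Ge0) // => h t tR.
    by rewrite /psi mactME -cval_grp -pA grp_cproj // -mactME (Rclass_el tR).
  exists P; split=> //; apply/homA_mactP=> m s; apply: (detects_eq DT') => r rR.
  rewrite PR // -mactME /psi -mactME.
  have [rm|rm] := boolP ((r * m)%g \in Rclass (e : M)); first by rewrite PR.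
  rewrite !mactME !(mact_Rclass0 _ _ rR rm) //.
  by rewrite (_ : cproj e 0 = 0) ?linear0 //; exact: linear0.
have [P [PA PE]] := half S T aS aT DT f fA.
have [Q [QA QE]] := half T S aT aS DS g gA.
apply/isomodP; exists P, Q; split=> // s.
  apply: (detects_eq DS) => r rR.
  by rewrite QE // PE // cvalK fK cproj_mactK // (Rclass_el rR).
apply: (detects_eq DT) => r rR.
by rewrite PE // QE // cvalK gK cproj_mactK // (Rclass_el rR).
Qed.

(** A J-class minimal among those acting nontrivially on a simple module is
    regular, because its square acts nontrivially too, and any idempotent in it
    is an apex. *)
Lemma simple_apex S : simple_mod S -> exists m, regular_Jclass m /\
  forall e, (e : M) \in Jclass m -> apex S e.
Proof.
move=> [S0 Ss].
have [m mS mmin] : exists2 m, mact S m != 0 &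
    forall n, mact S n != 0 -> n \in ideal m -> ideal n = ideal m.
  have E1 : mact S 1%g != 0.
    apply: contra_notN S0 => /eqP E; apply/eqP; rewrite -subv0; apply/subvP=> s _.
    by rewrite memv0 -[s]mact1 E zero_lfunE.
  case: (arg_minnP (P := fun m => mact S m != 0) (fun m => #|ideal m|) E1) => m mS mmin.
  exists m => // n nS nm; apply/eqP; rewrite eqEcard mmin // andbT.
  by apply/subsetP=> x xn; exact: ideal_mul xn nm.
pose U : {vspace S} := (\sum_(x in ideal m) limg (mact S x))%VS.
have UP n s : n \in ideal m -> mact S n s \in U.
  by move=> nm; apply: (subvP (sumv_sup n nm (subvv _))); rewrite memv_img ?memvf.
have Ustable n u : u \in U -> mact S n u \in U.
  case/memv_sumP=> us usP ->; rewrite linear_sum /=; apply: memv_suml => x xm.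
  have /memv_imgP[t _ ->] := usP x xm; rewrite -mactME; apply: UP.
  by apply: ideal_mul xm; apply/idealP; exists n, 1%g; rewrite mulg1.
have U_full s : s \in U.
  case: (Ss (msubmodule Ustable)) => /= [U0|->]; last exact: memvf.
  case/eqP: mS; apply/lfunP=> t; rewrite zero_lfunE; apply/eqP.
  by rewrite -memv0 -U0 UP ?mem_ideal.
have [x xm xS] : exists2 x, x \in ideal m & mact S (m * x)%g != 0.
  apply: NNPP => no; case/eqP: mS; apply/lfunP=> s; rewrite zero_lfunE.
  have /memv_sumP[us usP ->] := U_full s; rewrite linear_sum big1 // => x xm.
  have /memv_imgP[t _ ->] := usP x xm; rewrite /= -mactME.
  have [->|H] := eqVneq (mact S (m * x)%g) 0; first by rewrite zero_lfunE.
  by case: no; exists x.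
have ideal_mr n y : n \in ideal m -> (n * y)%g \in ideal m.
  by apply: ideal_mul; apply/idealP; exists 1%g, y; rewrite mul1g.
have mxm := mmin _ xS (ideal_mr _ _ (mem_ideal m)).
have [u mE] : exists u, m = (m * x * u)%g.
  by apply: stable_right; rewrite mxm mem_ideal.
have [n [n0 bb]] := idem_power (x * u)%g; set b := (_ ^+ n)%g in bb.
have mb : (m * b)%g = m.
  rewrite /b; elim: (n) => [|i IHi]; first by rewrite expg0 mulg1.
  by rewrite expgSr mulgA IHi mulgA -mE.
exists m; split.
  exists b; first by rewrite inE bb.
  rewrite inE; apply/eqP/setP=> y; apply/idP/idP=> H; apply: ideal_mul H _.
    rewrite /b -(prednK n0) expgS -mulgA; apply: (ideal_mul _ xm).
    by apply/idealP; exists 1%g, (u * (x * u) ^+ n.-1)%g; rewrite mul1g.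
  by apply/idealP; exists m, 1%g; rewrite mulg1 mb.
move=> e; rewrite inE => /eqP em; apply/andP; split; last first.
  apply: contra_neqN mS => /eqP e0; have := mem_ideal m; rewrite -em =>
    /idealP[a [c ->]].
  by apply/lfunP=> s; rewrite !mactME e0 zero_lfunE linear0 zero_lfunE.
apply/forall_inP=> m' m'I; apply: contraT => m'S.
pose K : {vspace S} := (\bigcap_(y in ideal m) lker (mact S y))%VS.
have KP s : reflect (forall y, y \in ideal m -> mact S y s = 0) (s \in K).
  apply: (iffP idP) => [|H]; rewrite memvE.
    by move/subv_bigcapP=> H y ym; have := H y ym; rewrite -memvE memv_ker => /eqP.
  by apply/subv_bigcapP=> y ym; rewrite -memvE memv_ker H.
have K_stable y s : s \in K -> mact S y s \in K.
  by move/KP=> H; apply/KP=> z zm; rewrite -mactME H // ideal_mr.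
have K0 s : (forall y, y \in ideal m -> mact S y s = 0) -> s = 0.
  move/KP; case: (Ss (msubmodule K_stable)) => /= E; first by rewrite E memv0 => /eqP.
  case/eqP: mS; apply/lfunP=> t; rewrite zero_lfunE.
  have : t \in K by rewrite E memvf.
  by move/KP/(_ m (mem_ideal m)).
case/eqP: m'S; apply/lfunP=> s; rewrite zero_lfunE; apply: K0 => y ym.
rewrite -mactME; have [->|H] := eqVneq (mact S (y * m')%g) 0;
  first by rewrite zero_lfunE.
move: m'I; rewrite in_Iset => /negP[].
have := mmin _ H (ideal_mr _ _ ym); rewrite -em => E.
have := mem_ideal (e : M); rewrite -E => /ideal_mul; apply.
by apply/idealP; exists y, 1%g; rewrite mulg1.
Qed.

Lemma apex_Jclass S e f : apex S e -> apex S f -> (e : M) \in Jclass (f : M).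
Proof.
move=> aS bS; have half a b : apex S a -> apex S b -> (a : M) \in ideal (b : M).
  move=> aa /andP[_ b0]; apply: contraNT b0; rewrite -in_Iset => bI.
  by apply/eqP/lfunP=> s; rewrite zero_lfunE (apex_kill _ aa).
rewrite inE; apply/eqP/setP=> x; apply/idP/idP=> H; apply: ideal_mul H _; exact: half.
Qed.

End Apex.

(** * The simple module with a given apex and corner *)

Section Coinduced.
Variables (k : fieldType) (M : finMonoid) (e : idem M).
Variable V : algmod (malg k (group_monoid (max_subgroup e))).
Local Notation MV := {ffun M -> V}.

Definition translate (m : M) : 'End(MV) :=
  linfun (fun phi : MV => [ffun x : M => phi (x * m)%g] : MV).

Lemma translateE m phi x : translate m phi x = phi (x * m)%g.
Proof.
by rewrite linfunK ?ffunE // => c u v; apply/ffunP=> y; rewrite !ffunE.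
Qed.

Fact translate1 : translate 1%g = \1%VF.
Proof. by apply/lfunP=> phi; apply/ffunP=> x; rewrite translateE mulg1 id_lfunE. Qed.

Fact translateM m n : translate (m * n)%g = (translate m \o translate n)%VF.
Proof. by apply/lfunP=> phi; apply/ffunP=> x; rewrite comp_lfunE !translateE mulgA. Qed.

Definition translation_mod : algmod (malg k M) := lin_mod translate1 translateM.

Lemma mact_translation m phi : mact translation_mod m phi = translate m phi.
Proof. by rewrite mact_lin_mod. Qed.

Let below_part : 'End(MV) :=
  linfun (fun phi : MV => [ffun x : M => if ((e : M) * x)%g \in Iset (e : M) then phi
    x else 0] : MV).

Let below_partE phi x : below_part phi x = if ((e : M) * x)%g \in Iset (e : M) then
  phi x else 0.
Proof.
rewrite linfunK ?ffunE // => c u v; apply/ffunP=> y; rewrite !ffunE.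
by case: ifP => // _; rewrite scaler0 addr0.
Qed.

Let defect : 'Hom(MV, {ffun max_subgroup e * M -> V}) :=
  linfun (fun phi : MV =>
    [ffun p => phi (ms_val p.1 * p.2)%g - grp_act V p.1 (phi p.2)] : {ffun
      max_subgroup e * M -> V}).

Let defectE phi p : defect phi p = phi (ms_val p.1 * p.2)%g - grp_act V p.1 (phi p.2).
Proof.
rewrite linfunK ?ffunE // => c u v; apply/ffunP=> q; rewrite !ffunE linearP.
by rewrite scalerBr opprD addrACA.
Qed.

Definition equivariant_vs : {vspace translation_mod} :=
  (lker below_part :&: lker defect)%VS.

Lemma equivariant_vsP (phi : MV) :
  reflect ((forall x, ((e : M) * x)%g \in Iset (e : M) -> phi x = 0) /\
           (forall h x, phi (ms_val h * x)%g = grp_act V h (phi x)))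
          (phi \in equivariant_vs).
Proof.
rewrite memv_cap !memv_ker; apply: (iffP andP) => [[/eqP b0 /eqP d0]|[b0 d0]]; split.
- move=> x xI; have := congr1 (fun f : MV => f x) b0.
  by rewrite /= below_partE xI ffunE.
- move=> h x; have := congr1 (fun f : {ffun max_subgroup e * M -> V} => f (h, x)) d0.
  by rewrite /= defectE ffunE => /eqP; rewrite subr_eq0 => /eqP.
- apply/eqP/ffunP=> x; rewrite below_partE ffunE; case: ifP => // /b0 //.
by apply/eqP/ffunP=> -[h x]; rewrite defectE ffunE /= d0 subrr.
Qed.

Lemma equivariant_stable m phi : phi \in equivariant_vs ->
  mact translation_mod m phi \in equivariant_vs.
Proof.
move/equivariant_vsP=> [b0 d0]; rewrite mact_translation; apply/equivariant_vsP;
  split=> [x xI|h x].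
  by rewrite translateE b0 // mulgA -[(_ * _ * m)%g]mul1g mulgA Iset_mul.
by rewrite !translateE -d0 mulgA.
Qed.

(** Coinduction of V: the equivariant functions on the R-class of e.  Such a
    function is extended to M through x |-> e x, and by zero where e x is in
    I(e), so that the partial action of M becomes translation. *)
Definition coind_mod : algmod (malg k M) := submod (msubmodule equivariant_stable).

Definition cfun (u : coind_mod) : MV := vsval u.

Lemma cfun0 x : cfun 0 x = 0.
Proof. by rewrite /cfun linear0 ffunE. Qed.

Lemma cfun_mact m u x : cfun (mact coind_mod m u) x = cfun u (x * m)%g.
Proof. by rewrite /cfun mact_submod mact_translation translateE. Qed.

Lemma cfun_below u x : ((e : M) * x)%g \in Iset (e : M) -> cfun u x = 0.
Proof. by have /equivariant_vsP[] := subvsP u => H _; exact: H. Qed.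

Lemma cfun_grp u (h : max_subgroup e) x : cfun u (ms_val h * x)%g = grp_act V h (cfun
  u x).
Proof. by have /equivariant_vsP[] := subvsP u => _; exact. Qed.

Lemma cfun_el u x : cfun u ((e : M) * x)%g = cfun u x.
Proof. by rewrite -(ms_val1 e) cfun_grp grp_act1. Qed.

Lemma cfun_inj u v : cfun u =1 cfun v -> u = v.
Proof. by move=> uv; apply: subvs_inj; apply/ffunP. Qed.

Lemma coind_detects : detects coind_mod e.
Proof.
move=> u uR; apply: cfun_inj => x.
rewrite cfun0; have [xI|xI] := boolP (((e : M) * x)%g \in Iset (e : M));
  first exact: cfun_below.
have xR : ((e : M) * x)%g \in Rclass (e : M).
  by rewrite RclassE mulgA idemP eqxx /=; move: xI; rewrite in_Iset negbK.
have : cfun (mact coind_mod ((e : M) * x)%g u) (e : M) = 0 by rewrite uR // cfun0.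
by rewrite cfun_mact mulgA idemP cfun_el.
Qed.

Let unit_value (v : V) (y : M) : V :=
  oapp (fun h : max_subgroup e => grp_act V h v) 0 (insub y).

Let unit_valueE v (h : max_subgroup e) : unit_value v (ms_val h) = grp_act V h v.
Proof.
rewrite /unit_value; case: insubP => [h' _ h'E|]; last by rewrite (valP h).
by congr (grp_act V _ v); apply: ms_inj.
Qed.

Let unit_value0 v y : y \notin unit_set (e : M) -> unit_value v y = 0.
Proof. by move=> yU; rewrite /unit_value insubN. Qed.

Let extend (v : V) : MV := [ffun x : M => unit_value v ((e : M) * x * (e : M))%g].

Let extend_coind v : extend v \in equivariant_vs.
Proof.
apply/equivariant_vsP; split=> [x xI|g x]; rewrite !ffunE.
  rewrite unit_value0 //; apply: contraL xI => /unit_setP[_ [y _ [xy _]]].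
  rewrite in_Iset negbK; apply/idealP; exists 1%g, ((e : M) * y)%g.
  by rewrite mul1g mulgA xy.
have [eg ge] := ms_mul_e g.
have -> : ((e : M) * (ms_val g * x) * (e : M) = ms_val g * ((e : M) * x * (e : M)))%g.
  by rewrite !mulgA eg ge.
set y := (_ * _ * _)%g; have ey : ((e : M) * y)%g = y by rewrite !mulgA idemP.
have [yU|yU] := boolP (y \in unit_set (e : M)).
  have -> : y = ms_val (exist _ y yU : max_subgroup e) by [].
  by rewrite -ms_valM !unit_valueE grp_actM.
rewrite !unit_value0 ?linear0 //; apply: contra yU => gyU.
have -> : y = ms_val (g^-1 * (exist _ (ms_val g * y)%g gyU : max_subgroup e))%g.
  by rewrite ms_valM /= mulgA -ms_valM mulVg ms_val1 ey.
exact: valP.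
Qed.

Lemma coind_corner : isomod (corner_mod coind_mod e) V.
Proof.
pose ev : 'Hom(corner_mod coind_mod e, V) := linfun (fun u => cfun (cval u) (e : M)).
have evE u : ev u = cfun (cval u) (e : M).
  by rewrite linfunK // => c x y; rewrite /cfun !linearP /= !ffunE.
have fe (u : corner_mod coind_mod e) x : cfun (cval u) (x * (e : M))%g = cfun (cval u)
  x.
  by rewrite -cfun_mact cval_e.
exists ev.
  apply/homA_grpP=> g u; rewrite !evE cval_grp cfun_mact -cfun_grp.
  by rewrite (ms_mul_e g).1 (ms_mul_e g).2.
apply: lfun_bij => [|v].
  apply/lker0P; apply/eqP/vspaceP=> u; rewrite memv_ker memv0 evE.
  apply/eqP/eqP=> [u0|->]; last by rewrite (_ : cval 0 = 0) ?cfun0 //; exact: linear0.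
  apply: cval_inj; apply: cfun_inj => x.
  have -> : cfun (cval (0 : corner_mod coind_mod e)) x = 0 by rewrite (_ : cval 0 = 0)
    ?cfun0 //; exact: linear0.
  rewrite -cfun_el -fe.
  have [xI|xI] := boolP (((e : M) * x * (e : M))%g \in Iset (e : M)).
    by apply: cfun_below; rewrite !mulgA idemP.
  have U : ((e : M) * x * (e : M))%g \in unit_set (e : M).
    apply: unit_setE; rewrite ?mulgA ?idemP // -?mulgA ?idemP //.
    by move: xI; rewrite in_Iset negbK mulgA.
  have := cfun_grp (cval u) (exist _ ((e : M) * x * (e : M))%g U : max_subgroup e) (e
    : M).
  by rewrite u0 linear0 fe.
pose u : coind_mod := vsproj _ (extend v).
have uE x : cfun u x = extend v x by rewrite /cfun vsprojK ?extend_coind.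
have eu : mact coind_mod e u = u.
  apply: cfun_inj => x; rewrite cfun_mact !uE !ffunE.
  by rewrite -!mulgA idemP.
exists (cproj e u); rewrite evE cprojK // uE ffunE !idemP.
by rewrite -(ms_val1 e) unit_valueE grp_act1.
Qed.

Lemma coind_apex : simple_mod V -> apex coind_mod e.
Proof.
move=> Vs; apply/andP; split.
  apply/forall_inP=> m mI; apply/eqP/lfunP=> u; apply: cfun_inj => x.
  rewrite cfun_mact zero_lfunE cfun0.
  by apply: cfun_below; rewrite -[(_ * _)%g]mulg1 mulgA Iset_mul.
apply/eqP=> e0; have [E _] := simple_isomod (isomod_sym coind_corner) Vs.
apply: E; apply/eqP; rewrite -subv0; apply/subvP=> u _; rewrite memv0.
by apply/eqP/cval_inj; rewrite -cval_e e0 zero_lfunE; exact/esym/linear0.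
Qed.

End Coinduced.


(** * Cocycles between two modules with an apex *)

Lemma lfun_scale_sum (k : fieldType) (U V : vectType k) (L : 'Hom(U, V)) c
    (I : Type) (r : seq I) (P : pred I) (F : I -> U) :
  L (c *: \sum_(i <- r | P i) F i) = c *: \sum_(i <- r | P i) L (F i).
Proof. by rewrite linearZ linear_sum. Qed.

Section Cocycles.
Variables (k : fieldType) (M : finMonoid).
Hypothesis Rt : Rtrivial (gen_submonoid (idempotents M)).
Variables (S T : algmod (malg k M)) (e f : idem M).
Hypotheses (aS : apex S e) (DS : detects S e).
Hypotheses (aT : apex T f) (DT : detects T f).
Hypotheses (Ge0 : #|{: max_subgroup e}|%:R != 0 :> k).
Hypotheses (Gf0 : #|{: max_subgroup f}|%:R != 0 :> k).

Local Notation ce := (#|{: max_subgroup e}|%:R^-1 : k).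
Local Notation cf := (#|{: max_subgroup f}|%:R^-1 : k).

Implicit Types (theta : M -> 'Hom(S, T)) (m n r x y z : M) (s v : S).

Definition biequivariant theta := forall (g : max_subgroup f) (h : max_subgroup e) x s,
  x \in fMe (e : M) (f : M) ->
  theta (ms_val g * x * ms_val h)%g s = mact T (ms_val g) (theta x (mact S (ms_val h)
    s)).

Lemma biequivariant_l theta (g : max_subgroup f) x s : biequivariant theta ->
  x \in fMe (e : M) (f : M) -> theta (ms_val g * x)%g s = mact T (ms_val g) (theta x s).
Proof.
move=> Th xM; have [fx xe] := fMeP xM.
have := Th 1%g 1%g x s xM; rewrite !ms_val1 fx xe => ->.
have := Th g 1%g x s xM; rewrite !ms_val1 -mulgA xe => ->.
by rewrite -mactME (ms_mul_e g).2.
Qed.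

Lemma biequivariant_r theta (h : max_subgroup e) x s : biequivariant theta ->
  x \in fMe (e : M) (f : M) -> theta (x * ms_val h)%g s = theta x (mact S (ms_val h) s).
Proof.
move=> Th xM; have [fx xe] := fMeP xM.
have := Th 1%g h x s xM; rewrite !ms_val1 fx => ->.
have := Th 1%g 1%g x (mact S (ms_val h) s) xM; rewrite !ms_val1 fx xe => E.
by rewrite [RHS]E -mactME (ms_mul_e h).1.
Qed.

Lemma fMe_Lclass z x : ((f : M) * z = z)%g -> x \in Lclass (e : M) ->
  (z * x)%g \in fMe (e : M) (f : M).
Proof. by move=> fz xL; apply: fMe_mem; rewrite ?mulgA ?fz // -mulgA (Lclass_e xL). Qed.

Definition right_sum theta z s : T :=
  ce *: \sum_(r in Rclass (e : M)) theta (z * Lsec e r)%g (mact S r s).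

Lemma right_sum_linear theta z : linear (right_sum theta z).
Proof.
move=> c u v; rewrite /right_sum scalerA (mulrC c) -scalerA -scalerDr; congr (_ *: _).
by rewrite scaler_sumr -big_split; apply: eq_bigr => r _; rewrite !linearP.
Qed.

(** Given theta, prescribed between the corners of S and T, the cocycle attached
    to it is m |-> q m - q 1 m.  Up to the orders of the maximal subgroups, q m is
    the sum of the maps x' theta(r' m x) r over dual elements r, x for e and
    r', x' for f. *)
Definition qmap theta m : 'Hom(S, T) :=
  linfun (fun s => glue f (fun r => right_sum theta (r * m)%g s)).

Lemma qmapE theta m s : qmap theta m s = glue f (fun r => right_sum theta (r * m)%g s).
Proof.
by rewrite linfunK //; apply: glue_linear => r; exact: right_sum_linear.
Qed.

Lemma qmapR theta m r s : biequivariant theta -> r \in Rclass (f : M) ->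
  mact T r (qmap theta m s) = right_sum theta (r * m)%g s.
Proof.
move=> Th rR; rewrite qmapE (glueP Rt aT Gf0) // => h t tR.
rewrite /right_sum lfun_scale_sum; congr (_ *: _); apply: eq_bigr => u uR.
rewrite -!mulgA -biequivariant_l // mulgA; apply: fMe_Lclass (Lsec_L uR).
by rewrite mulgA (Rclass_el tR).
Qed.

(** Only the r in the maximal subgroup contribute to the sum, since r e lies in
    I(e) for the other ones; thus q recovers theta on the corners. *)
Lemma right_sum_corner theta x s : biequivariant theta -> x \in fMe (e : M) (f : M) ->
  mact S e s = s -> right_sum theta x s = theta x s.
Proof.
move=> Th xM es; have [fx xe] := fMeP xM.
rewrite /right_sum (sum_orbit (F := fun r => theta (x * Lsec e r)%g (mact S r s))
  (mem_Rclass e)).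
  rewrite (eq_bigr (fun=> theta x s)) => [|h _].
    by rewrite sumr_const -scaler_nat scalerA mulVf ?scale1r.
  rewrite (ms_mul_e h).2; have hR : ms_val h \in Rclass (e : M).
    by rewrite -(ms_mul_e h).2 Rclass_mul_unit ?mem_Rclass.
  have eL : ((e : M) * Lsec e (ms_val h))%g = ms_val h^-1%g.
    rewrite -(ms_val1 e) -(mulVg h) ms_valM -mulgA (mul_Lsec hR).
    by rewrite (ms_mul_e h^-1%g).2.
  rewrite -{1}xe -mulgA eL biequivariant_r // -mactME -ms_valM mulVg.
  by rewrite ms_val1 es.
move=> r rR no; rewrite -es -mactME (apex_kill _ aS) ?linear0 // in_Iset.
apply/negP=> H; have eL : (e : M) \in Lclass (e : M) by rewrite inE.
have He : (e : M) \in ideal ((e : M) * (e : M))%g by rewrite idemP mem_ideal.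
by have [h rE] := orbit_mem Rt rR (mem_Rclass e) eL H He; case: (no h).
Qed.

(** theta, translated by z, is compatible with the relations defining S as a
    quotient of the algebra: elements of the L-class with the same action are
    identified and elements below it are zero. *)
Definition factors theta z :=
  (forall x y, x \in Lclass (e : M) -> y \in Lclass (e : M) -> same_on_Re (e : M) x y ->
     theta (z * x)%g = theta (z * y)%g) /\
  (forall n, (n * (e : M) = n)%g -> n \in Iset (e : M) -> theta (z * n)%g = 0).

Lemma right_sum_factors theta z y s : biequivariant theta -> ((f : M) * z = z)%g ->
  factors theta z -> (y * (e : M) = y)%g ->
  right_sum theta z (mact S y s) = theta (z * y)%g s.
Proof.
move=> Th fz [Fa Fb] ye.
have [yI|] := boolP (y \in Iset (e : M)).
  rewrite Fb // zero_lfunE (apex_kill _ aS) //.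
  by rewrite -(linfunK (right_sum_linear theta z)) linear0.
rewrite in_Iset negbK => H.
have yL : y \in Lclass (e : M) by rewrite LclassE ye eqxx.
have /LclassP[_ [u eu]] := yL.
pose r0 := ((e : M) * u)%g; have r0y : (r0 * y = e :> M)%g by rewrite /r0 -mulgA -eu
  idemP.
have r0R : r0 \in Rclass (e : M).
  rewrite RclassE /r0 mulgA idemP eqxx /=; apply/idealP; exists 1%g, y.
  by rewrite mul1g -/r0 r0y.
rewrite /right_sum (sum_orbit (F := fun r => theta (z * Lsec e r)%g (mact S r (mact S
  y s))) r0R).
  rewrite (eq_bigr (fun=> theta (z * y)%g s)) => [|h _].
    by rewrite sumr_const -scaler_nat scalerA mulVf ?scale1r.
  have hR := Rclass_mul_unit h r0R; have LL := Lsec_L hR.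
  have hy : (ms_val h * r0 * y)%g = ms_val h by rewrite -mulgA r0y (ms_mul_e h).2.
  rewrite -mactME hy -biequivariant_r ?fMe_Lclass // -mulgA.
  rewrite (Fa _ y) ?Lclass_mulr //.
  apply: (same_on_ReE Rt (r := (ms_val h * r0)%g)) => //; first exact: Lclass_mulr.
    rewrite mulgA (mul_Lsec hR) (ms_mul_e h).1.
    by apply/idealP; exists (ms_val h^-1%g), 1%g; rewrite mulg1 -ms_valM mulVg.
  by rewrite mulgA (mul_Lsec hR) (ms_mul_e h).1 hy.
move=> r rR no; rewrite -mactME (apex_kill _ aS) ?linear0 // in_Iset.
apply/negP=> Hr; have He : (e : M) \in ideal (r0 * y)%g by rewrite r0y mem_ideal.
by have [h rE] := orbit_mem Rt rR r0R yL Hr He; case: (no h).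
Qed.

Lemma right_sum_mul theta z n s : biequivariant theta -> ((f : M) * z = z)%g ->
  factors theta z -> right_sum theta (z * n)%g s = right_sum theta z (mact S n s).
Proof.
move=> Th fz Fz; rewrite -{2}(glue_id Rt aS Ge0 s DS) /glue lfun_scale_sum.
have RL := right_sum_linear theta z.
rewrite -(linfunK RL) linearZ linear_sum {1}/right_sum /=; congr (_ *: _).
apply: eq_bigr => r rR; rewrite (linfunK RL) -mactME right_sum_factors ?mulgA //.
by rewrite -mulgA (Lclass_e (Lsec_L rR)).
Qed.

Lemma qmap_left theta m s : biequivariant theta ->
  (forall x, x \in fMe (e : M) (f : M) -> x \in Iset (f : M) -> theta x = 0) ->
  qmap theta m s = mact T m (qmap theta 1%g s).
Proof.
move=> Th T0; apply: (detects_eq DT) => r rR; rewrite qmapR //.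
have [rm|rm] := boolP ((r * m)%g \in Rclass (f : M)).
  by rewrite -mactME qmapR // mulg1.
rewrite (mact_Rclass0 _ aT) // /right_sum big1 ?scaler0 // => u uR.
have frm : ((f : M) * (r * m) = r * m)%g by rewrite mulgA (Rclass_el rR).
rewrite T0 ?zero_lfunE ?(fMe_Lclass frm (Lsec_L uR)) //.
rewrite -[(r * m)%g]mul1g Iset_mul //; move: rm.
by rewrite RclassE frm eqxx in_Iset.
Qed.

Lemma qmap_right theta m s : biequivariant theta ->
  (forall r, r \in Rclass (f : M) -> factors theta r) ->
  qmap theta m s = qmap theta 1%g (mact S m s).
Proof.
move=> Th FR; apply: (detects_eq DT) => r rR; rewrite !qmapR // mulg1.
by rewrite right_sum_mul ?(Rclass_el rR) //; exact: FR.
Qed.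

(** Tested against r in the R-class of f: if r m is in it again, both sides
    telescope; otherwise r m is in I(f), it kills T, and theta translated by
    r m factors through S. *)
Lemma qmap_cocycle theta m n s : biequivariant theta ->
  (forall z, ((f : M) * z = z)%g -> z \in Iset (f : M) -> factors theta z) ->
  qmap theta (m * n)%g s = mact T m (qmap theta n s) + qmap theta m (mact S n s)
    - mact T m (qmap theta 1%g (mact S n s)).
Proof.
move=> Th FI; apply: (detects_eq DT) => r rR; rewrite linearB linearD /= !(qmapR _ _
  Th rR).
have [rm|rm] := boolP ((r * m)%g \in Rclass (f : M)).
  by rewrite -!mactME !(qmapR _ _ Th rm) mulg1 mulgA addrK.
rewrite !(mact_Rclass0 _ aT) // add0r subr0 mulgA.
have frm : ((f : M) * (r * m) = r * m)%g by rewrite mulgA (Rclass_el rR).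
rewrite [LHS]right_sum_mul //; apply: FI => //; move: rm.
by rewrite RclassE frm eqxx in_Iset.
Qed.

Section Trivial.
Variable delta : M -> 'Hom(S, T).
Hypothesis deltaM : forall x y s,
  delta (x * y)%g s = mact T x (delta y s) + delta x (mact S y s).

Let delta1 s : delta 1%g s = 0.
Proof.
have := deltaM 1%g 1%g s; rewrite mulg1 !mact1 => /eqP.
by rewrite -subr_eq0 opprD addrA subrr sub0r oppr_eq0 => /eqP.
Qed.

Lemma delta_inner (A B : 'Hom(S, T)) :
  (forall m s, delta m s = mact T m (A s) + B (mact S m s)) ->
  forall m s, delta m s = mact T m (A s) - A (mact S m s).
Proof.
move=> E m s; rewrite E; congr (_ + _); apply/eqP; rewrite -addr_eq0 addrC.
by have := E 1%g (mact S m s); rewrite delta1 !mact1 => <-.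
Qed.

(** The map x |-> f delta(x) e between the corners, made biequivariant. *)
Definition average x : 'Hom(S, T) :=
  (cf * ce) *: \sum_(g : max_subgroup f) \sum_(h : max_subgroup e)
    (mact T (ms_val g^-1%g) \o (delta (ms_val g * x * ms_val h)%g \o mact S (ms_val
      h^-1%g)))%VF.

Lemma averageE x s : average x s =
  (cf * ce) *: \sum_(g : max_subgroup f) \sum_(h : max_subgroup e)
    mact T (ms_val g^-1%g) (delta (ms_val g * x * ms_val h)%g (mact S (ms_val h^-1%g)
      s)).
Proof.
rewrite scale_lfunE sum_lfunE; congr (_ *: _); apply: eq_bigr => g _.
by rewrite sum_lfunE; apply: eq_bigr => h _; rewrite !comp_lfunE.
Qed.

Lemma average_biequivariant : biequivariant average.
Proof.
move=> g0 h0 x s xM; rewrite !averageE lfun_scale_sum; congr (_ *: _).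
rewrite (reindex_inj (mulIg g0^-1%g)) /=; apply: eq_bigr => g _.
rewrite linear_sum (reindex_inj (mulgI h0^-1%g)) /=; apply: eq_bigr => h _.
rewrite -!mactME -!ms_valM !invMg !invgK; congr (mact T _ (delta _ _)).
rewrite !ms_valM !mulgA -(mulgA (ms_val g)) -(ms_valM g0^-1%g) mulVg ms_val1.
by rewrite (ms_mul_e g).2 -(mulgA _ (ms_val h0)) msV -mulgA (ms_mul_e h).1.
Qed.

(** Expand delta (Y m X') by the Leibniz rule in delta m, where X and Y run
    through dual families resolving the identity of T, and X', Y' through such
    families for S; the other two terms have the form m A and B m. *)
Lemma delta_average : exists A B : 'Hom(S, T), forall m s,
  delta m s = qmap average m s + mact T m (A s) + B (mact S m s).
Proof.
pose Ah (h : max_subgroup e) : 'Hom(S, T) := ce *: \sum_(r in Rclass (e : M))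
  (delta (Lsec e r * ms_val h)%g \o mact S (ms_val h^-1%g * r)%g)%VF.
pose Bg (g : max_subgroup f) : 'Hom(S, T) := cf *: \sum_(r in Rclass (f : M))
  (mact T (Lsec f r * ms_val g^-1%g)%g \o delta (ms_val g * r)%g)%VF.
pose D (g : max_subgroup f) (h : max_subgroup e) m s :=
  \sum_(r' in Rclass (f : M)) \sum_(r in Rclass (e : M))
    mact T (Lsec f r' * ms_val g^-1%g)%g
      (delta (ms_val g * r' * m * (Lsec e r * ms_val h))%g (mact S (ms_val h^-1%g *
        r)%g s)).
have idS (h : max_subgroup e) s : ce *: \sum_(r in Rclass (e : M))
    mact S (Lsec e r * ms_val h)%g (mact S (ms_val h^-1%g * r)%g s) = s.
  rewrite -[RHS](glue_id Rt aS Ge0 s DS); congr (_ *: _); apply: eq_bigr => r rR.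
  rewrite -!mactME; congr (mact S _ s).
  by rewrite !mulgA -(mulgA _ (ms_val h)) msV (Lclass_e (Lsec_L rR)).
have idT (g : max_subgroup f) t : cf *: \sum_(r in Rclass (f : M))
    mact T (Lsec f r * ms_val g^-1%g)%g (mact T (ms_val g * r)%g t) = t.
  rewrite -[RHS](glue_id Rt aT Gf0 t DT); congr (_ *: _); apply: eq_bigr => r rR.
  rewrite -!mactME; congr (mact T _ t).
  by rewrite !mulgA -(mulgA _ (ms_val g^-1%g)) -ms_valM mulVg ms_val1 (Lclass_e
    (Lsec_L rR)).
have key g h m s : (cf * ce) *: D g h m s =
    mact T m (Ah h s) + delta m s + Bg g (mact S m s).
  have E r' : ce *: \sum_(r in Rclass (e : M)) mact T (Lsec f r' * ms_val g^-1%g)%g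
      (delta (ms_val g * r' * m * (Lsec e r * ms_val h))%g (mact S (ms_val h^-1%g *
        r)%g s)) =
    mact T (Lsec f r' * ms_val g^-1%g)%g (mact T (ms_val g * r')%g (mact T m (Ah h s)
      + delta m s))
    + mact T (Lsec f r' * ms_val g^-1%g)%g (delta (ms_val g * r')%g (mact S m s)).
    rewrite -linear_sum -linearZ -linearD /=; congr (mact T _ _).
    transitivity (mact T (ms_val g * r' * m)%g (Ah h s) + delta (ms_val g * r' * m)%g
      s).
      rewrite scale_lfunE sum_lfunE -[in X in _ + X](idS h s) !linearZ -scalerDr /=.
      congr (_ *: _); rewrite !linear_sum -big_split /=; apply: eq_bigr => r rR.
      by rewrite deltaM comp_lfunE.
    by rewrite deltaM mactME linearD /= addrA.
  rewrite /D -scalerA scaler_sumr (eq_bigr _ (fun r' _ => E r')) big_split scalerDr.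
  rewrite idT; congr (_ + _); rewrite scale_lfunE sum_lfunE; congr (_ *: _).
  by apply: eq_bigr => r' _; rewrite comp_lfunE.
have qD m s : qmap average m s = (cf * ce) *: \sum_(g : max_subgroup f)
    \sum_(h : max_subgroup e) (cf * ce) *: D g h m s.
  rewrite qmapE /glue /right_sum.
  under eq_bigr => r' r'R do rewrite lfun_scale_sum.
  rewrite -scaler_sumr scalerA; congr (_ *: _).
  under eq_bigr => r' r'R.
    under eq_bigr => r rR.
      rewrite averageE lfun_scale_sum.
      under eq_bigr => g _ do rewrite linear_sum /=.
      over.
    rewrite -scaler_sumr exchange_big /=.
    under eq_bigr => g _ do rewrite exchange_big /=.
    over.
  rewrite -scaler_sumr exchange_big /= scaler_sumr; apply: eq_bigr => g _.
  rewrite exchange_big /= scaler_sumr; apply: eq_bigr => h _.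
  congr (_ *: _); apply: eq_bigr => r' _; apply: eq_bigr => r _.
  by rewrite -!mactME !mulgA.
pose A := - (ce *: \sum_h Ah h); pose B := - (cf *: \sum_g Bg g).
exists A, B => m s; rewrite qD.
have avg (X : max_subgroup e -> T) (Y : T) (Z : max_subgroup f -> T) :
    (cf * ce) *: \sum_(g : max_subgroup f) \sum_(h : max_subgroup e) (X h + Y + Z g) =
    ce *: (\sum_h X h) + Y + cf *: (\sum_g Z g).
  rewrite (eq_bigr (fun g => (\sum_h X h + Y *+ #|{: max_subgroup e}|) + Z g *+ #|{:
    max_subgroup e}|)).
    rewrite big_split sumr_const sumrMnl -!scaler_nat !scalerDr !scalerA /=.
    have E1 : cf * ce * #|{: max_subgroup f}|%:R = ce by rewrite mulrAC mulVf ?mul1r.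
    have E3 : cf * ce * #|{: max_subgroup e}|%:R = cf by rewrite -mulrA mulVf ?mulr1.
    by rewrite !mulrA !E1 !E3 mulVf // scale1r.
  by move=> g _; rewrite !big_split /= !sumr_const.
rewrite (eq_bigr (fun g => \sum_h (mact T m (Ah h s) + delta m s + Bg g (mact S m
  s)))) => [|g _].
  have -> : mact T m (A s) = - (ce *: \sum_h mact T m (Ah h s)).
    by rewrite opp_lfunE linearN /= scale_lfunE sum_lfunE lfun_scale_sum.
  have -> : B (mact S m s) = - (cf *: \sum_g Bg g (mact S m s)).
    by rewrite opp_lfunE scale_lfunE sum_lfunE.
  by rewrite avg addrAC addrK (addrC (_ *: _)) addrK.
by apply: eq_bigr => h _; rewrite key.
Qed.

(** A cocycle whose values between the corners respect the defining relations
    of both modules is inner: its average splits into a part living on the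
    R-class of f, on which q m = m (q 1), and a part factoring through S, on
    which q m = (q 1) m. *)
Lemma delta_trivial :
  (forall z s, z \in fMe (e : M) (f : M) -> z \in Iset (f : M) -> z \in Iset (e : M) ->
     mact T f (delta z (mact S e s)) = 0) ->
  (forall x y s, x \in fM_Le (e : M) (f : M) -> y \in fM_Le (e : M) (f : M) ->
     same_on_Re (e : M) x y ->
     mact T f (delta x (mact S e s)) = mact T f (delta y (mact S e s))) ->
  exists A : 'Hom(S, T), forall m s, delta m s = mact T m (A s) - A (mact S m s).
Proof.
move=> V0 Vsame.
have IG (g : max_subgroup f) (h : max_subgroup e) (a : idem M) x : x \in fMe (e : M)
  (f : M) ->
    ((ms_val g * x * ms_val h)%g \in Iset (a : M)) = (x \in Iset (a : M)).
  move=> /fMeP[fx xe]; apply/idP/idP=> [H|]; last exact: Iset_mul.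
  have -> : x = (ms_val g^-1%g * (ms_val g * x * ms_val h) * ms_val h^-1%g)%g.
    by rewrite !mulgA -ms_valM mulVg ms_val1 fx -mulgA msV xe.
  exact: Iset_mul.
have bi_fMe (g : max_subgroup f) (h : max_subgroup e) x : x \in fMe (e : M) (f : M) ->
    (ms_val g * x * ms_val h)%g \in fMe (e : M) (f : M).
  move=> _; apply: fMe_mem; first by rewrite !mulgA (ms_mul_e g).1.
  by rewrite -!mulgA (ms_mul_e h).2.
have corner g h x s : mact T (ms_val g^-1%g) (delta x (mact S (ms_val h^-1%g) s)) =
    mact T (ms_val (g^-1%g : max_subgroup f)) (mact T f (delta x (mact S e
      (mact S (ms_val (h^-1%g : max_subgroup e)) s)))).
  by rewrite -mactME -(mactME (e : M)) (ms_mul_e _).1 (ms_mul_e _).2.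
have av0 z : z \in fMe (e : M) (f : M) -> z \in Iset (f : M) -> z \in Iset (e : M) ->
    average z = 0.
  move=> zM zf ze; apply/lfunP=> s; rewrite averageE zero_lfunE.
  rewrite big1 ?scaler0 // => g _; rewrite big1 // => h _.
  by rewrite corner V0 ?linear0 ?bi_fMe // IG.
have av_same x y : x \in fM_Le (e : M) (f : M) -> y \in fM_Le (e : M) (f : M) ->
    same_on_Re (e : M) x y -> average x = average y.
  move=> xM yM xy; apply/lfunP=> s; rewrite !averageE; congr (_ *: _).
  apply: eq_bigr => g _; apply: eq_bigr => h _; rewrite !corner; congr (mact T _ _).
  have [xL yL] : x \in Lclass (e : M) /\ y \in Lclass (e : M).
    by case/setIP: xM => _ ->; case/setIP: yM.
  have [gxL gxhM] := fM_Le_unit_mul g h xM; have [gyL gyhM] := fM_Le_unit_mul g h yM.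
  by apply: Vsame => //; apply: same_on_Re_mulr => //; exact: same_on_Re_mull.
have [A [B E]] := delta_average.
pose theta1 x : 'Hom(S, T) := if x \in Iset (f : M) then 0 else average x.
pose theta2 x : 'Hom(S, T) := if x \in Iset (f : M) then average x else 0.
have B1 : biequivariant theta1.
  move=> g h x s xM; rewrite /theta1 IG //; case: ifP => _;
    last exact: average_biequivariant.
  by rewrite !zero_lfunE linear0.
have B2 : biequivariant theta2.
  move=> g h x s xM; rewrite /theta2 IG //; case: ifP => _;
    first exact: average_biequivariant.
  by rewrite !zero_lfunE linear0.
have Q1 m s : qmap theta1 m s = mact T m (qmap theta1 1%g s).
  by apply: qmap_left => // x _ xf; rewrite /theta1 xf.
have Q2 m s : qmap theta2 m s = qmap theta2 1%g (mact S m s).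
  apply: qmap_right => // r rR; have fr := Rclass_el rR; split=> [x y xL yL xy|n ne nI].
    have [rx|rx] := boolP ((r * x)%g \in Lclass (e : M)).
      have ry : (r * y)%g \in Lclass (e : M) by rewrite -(same_Lclass_mull r xL yL xy).
      have inF t : (r * t)%g \in Lclass (e : M) -> (r * t)%g \in fM_Le (e : M) (f : M).
        by move=> rt; apply/setIP; split=> //; apply/imsetP; exists (r * t)%g;
          rewrite ?mulgA ?fr.
      have S' := same_on_Re_mull r xL yL xy.
      have [->//|[xI yI]] := same_fM_Le (inF _ rx) (inF _ ry) S'.
      by rewrite /theta2 xI yI; apply: av_same; rewrite ?inF.
    have ry : (r * y)%g \notin Lclass (e : M) by rewrite -(same_Lclass_mull r xL yL xy).
    have z0 t : t \in Lclass (e : M) -> (r * t)%g \notin Lclass (e : M) ->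
      theta2 (r * t)%g = 0.
      move=> tL; rewrite Lclass_mull // -in_Iset => tI.
      by rewrite /theta2; case: ifP => // fI; rewrite av0 ?fMe_Lclass.
    by rewrite !z0.
  rewrite /theta2; case: ifP => // fI; rewrite av0 //.
    by apply: fMe_mem; rewrite ?mulgA ?fr // -mulgA ne.
  by rewrite -[(r * n)%g]mulg1 Iset_mul.
have Qsum m s : qmap average m s = qmap theta1 m s + qmap theta2 m s.
  rewrite !qmapE /glue -scalerDr -big_split /=; congr (_ *: _); apply: eq_bigr => r _.
  rewrite -linearD /=; congr (mact T _ _); rewrite /right_sum -scalerDr -big_split /=.
  congr (_ *: _); apply: eq_bigr => u _; rewrite /theta1 /theta2.
  by case: ifP => _; rewrite zero_lfunE ?add0r ?addr0.
exists (A + qmap theta1 1%g) => m s.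
apply: (@delta_inner (A + qmap theta1 1%g) (B + qmap theta2 1%g)) => {}m {}s.
rewrite E Qsum Q1 Q2 !add_lfunE linearD /= (addrC (mact T m (A s))) -!addrA.
by congr (_ + _); rewrite addrCA; congr (_ + _); rewrite addrC.
Qed.

End Trivial.
End Cocycles.


(** * The module kX and its submodule *)

Section ClassModule.
Variables (k : fieldType) (M : finMonoid) (e f : idem M).
Local Notation Gfe := (max_subgroup f * max_subgroup e)%type.
Local Notation kXm := (kX k e f).
Implicit Types (x y z : M) (p q : Gfe) (C : X (e : M) (f : M)).

Lemma mem_class C x : x \in sval C ->
  x \in fMe (e : M) (f : M) /\ sval C = Defs.equiv_class (e : M) (f : M) x.
Proof.
case: C => C /= CX; move: (CX); rewrite inE => /andP[/imsetP[c cM ->] _].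
rewrite inE => /andP[xM cx]; split=> //; apply/setP=> y; rewrite !inE.
by rewrite ((equiv_equivalence (e : M) (f : M) c x y).2 cx).
Qed.

Lemma class_self x : x \in fMe (e : M) (f : M) ->
  x \in Defs.equiv_class (e : M) (f : M) x.
Proof. by move=> xM; rewrite inE xM; exact: connect0. Qed.

Definition class_repr C : M := odflt 1%g [pick x in sval C].

Lemma class_reprP C : class_repr C \in sval C.
Proof.
rewrite /class_repr; case: pickP => [x //|no].
case: C no => C /= CX no; move: (CX); rewrite inE => /andP[/imsetP[c cM E] _].
by have := no c; rewrite E class_self.
Qed.

Lemma class_eltE C x : x \in sval C -> class_elt k e f x = [ffun D => (D == C)%:R].
Proof.
move=> xC; apply/ffunP=> D; rewrite !ffunE; congr (_%:R).
have [->|ne] := eqVneq D C; first by rewrite xC.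
congr (nat_of_bool _); apply: contraNF ne => xD; apply/eqP/val_inj.
by rewrite /= (mem_class xD).2 (mem_class xC).2.
Qed.

Lemma class_elt0 x : x \in fMe (e : M) (f : M) ->
  Defs.equiv_class (e : M) (f : M) x \notin Xset (e : M) (f : M) ->
    class_elt k e f x = 0.
Proof.
move=> xM xX; apply/ffunP=> D; rewrite !ffunE.
have [xD|//] := boolP (x \in sval D).
by case/negP: xX; rewrite -(mem_class xD).2; exact: valP.
Qed.

Lemma class_elt_equiv x y : equiv_gen (e : M) (f : M) x y ->
  class_elt k e f x = class_elt k e f y.
Proof.
move=> xy; have xM := equiv_gen_fMe xy.
have yM : y \in fMe (e : M) (f : M).
  by apply: (@equiv_gen_fMe M e f y x); rewrite equiv_gen_sym.
apply/ffunP=> D; rewrite !ffunE; congr (_%:R); congr (nat_of_bool _).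
apply/idP/idP=> H; rewrite (mem_class H).2 inE ?xM ?yM /=.
  exact: connect1.
by apply: connect1; rewrite equiv_gen_sym.
Qed.

Lemma class_elt_fIIe x : x \in fIIe (e : M) (f : M) -> class_elt k e f x = 0.
Proof.
move=> xI; apply/ffunP=> D; rewrite !ffunE.
have [xD|//] := boolP (x \in sval D).
case: D xD => D /= DX xD; move: DX; rewrite inE => /andP[_ /pred0P/(_ x)] /=.
by rewrite xD xI.
Qed.

Lemma act_class_elt p x : x \in fMe (e : M) (f : M) ->
  mact kXm p (class_elt k e f x) = class_elt k e f (biact p x).
Proof.
move=> xM; rewrite mact_lin_mod; apply/ffunP=> C; rewrite perm_repE ffunE.
rewrite (big_pred1 (biact_X p^-1%g C)) => [|D].
  rewrite ffunE /=; congr (_%:R); congr (nat_of_bool _).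
  apply/imsetP/idP=> [[y yC ->]|xC].
    by rewrite biactM mulgV biact1 // (mem_class yC).1.
  by exists (biact p x); rewrite // biactM mulVg biact1.
apply/eqP/eqP=> [<-|->]; first by rewrite -biact_XM mulVg biact_X1.
by rewrite -biact_XM mulgV biact_X1.
Qed.

Section Extend.
Variables (Y : vectType k) (tau : M -> Y).

(** For tau constant on classes and zero on the class excluded from X, this
    sends the class of x to tau x. *)
Definition class_ext : 'Hom(kXm, Y) :=
  linfun (fun v : kXm => \sum_C (v : {ffun X (e : M) (f : M) ->
    k^o}) C *: tau (class_repr C)).

Lemma class_ext_sum v :
  class_ext v = \sum_C (v : {ffun X (e : M) (f : M) -> k^o}) C *: tau (class_repr C).
Proof.
rewrite linfunK // => c u w; rewrite scaler_sumr -big_split; apply: eq_bigr => C _ /=.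
by rewrite !ffunE scalerDl scalerA.
Qed.

Hypothesis tau0 : forall x, x \in fIIe (e : M) (f : M) -> tau x = 0.
Hypothesis tau_same : forall z x y, z \in fI (f : M) -> x \in Lclass (e : M) ->
  y \in Lclass (e : M) -> same_on_Re (e : M) x y -> tau (z * x)%g = tau (z * y)%g.

Lemma class_extE x : x \in fMe (e : M) (f : M) -> class_ext (class_elt k e f x) = tau x.
Proof.
have gen y z : equiv_gen (e : M) (f : M) y z -> tau y = tau z.
  case/orP=> [/andP[/tau0-> /tau0->] //|].
  case/exists_inP=> w wI /exists_inP[x' Lx /exists_inP[y' Ly /and3P[s /eqP ->
    /eqP ->]]].
  exact: tau_same.
have eqv y z : Defs.equiv (e : M) (f : M) y z -> tau y = tau z.
  case/connectP=> s; elim: s y => [|t s IHs] y /=; first by move=> _ ->.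
  by case/andP=> /gen-> ts zE; exact: IHs.
move=> xM; have [xX|xX] := boolP (Defs.equiv_class (e : M) (f : M) x \in Xset (e : M)
  (f : M)).
  pose C : X (e : M) (f : M) := exist _ (Defs.equiv_class (e : M) (f : M) x) xX.
  have xC : x \in sval C by exact: class_self.
  rewrite class_ext_sum (class_eltE xC) (bigD1 C) //= big1 => [|D ne]; last first.
    by rewrite ffunE (negbTE ne) scale0r.
  rewrite addr0 ffunE eqxx scale1r; apply/esym/eqv.
  by have := class_reprP C; rewrite inE => /andP[].
rewrite (class_elt0 xM xX) linear0.
have : ~~ [disjoint Defs.equiv_class (e : M) (f : M) x & fIIe (e : M) (f : M)].
  apply: contra xX => dis; rewrite inE dis andbT; apply/imsetP; exists x => //.
case/pred0Pn=> y /=; rewrite inE => /andP[/andP[_ xy] yI].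
by rewrite (eqv _ _ xy) tau0.
Qed.

End Extend.

(** The generators of Uflat in the tilde class lie below both J-classes: if z
    were R-equivalent to f it would be L-equivalent to an idempotent with
    the same idempotent right identities as e, hence to e. *)
Lemma Ltilde_below z : z \in fM_Lte (e : M) (f : M) :\: Lclass (e : M) ->
  [/\ z \in fMe (e : M) (f : M), z \in Iset (f : M) & z \in Iset (e : M)].
Proof.
case/setDP=> /setIP[/imsetP[a _ za] zt] zL.
have fz : ((f : M) * z = z)%g by rewrite za mulgA idemP.
move: zt; rewrite inE => /forall_inP zt.
have ze : (z * (e : M) = z)%g.
  by have /eqP := zt (e : M) (valP e); rewrite idemP eqxx => /eqP.
have zI : z \in Iset (e : M) by move: zL; rewrite LclassE ze eqxx in_Iset.
split=> //; first exact: fMe_mem.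
rewrite in_Iset; apply/negP=> H.
have /RclassP[_ [t ft]] : z \in Rclass (f : M) by rewrite RclassE fz eqxx.
have aI : (t * z)%g \in idempotents M.
  by rewrite inE mulgA -(mulgA t) -ft -mulgA fz.
have zaz : (z * (t * z) = z)%g by rewrite mulgA -ft fz.
have /eqP := zt _ aI; rewrite zaz eqxx => /esym/eqP ea.
move: zI; rewrite in_Iset => /negP[]; apply/idealP.
by exists ((e : M) * t)%g, 1%g; rewrite mulg1 -mulgA.
Qed.

Lemma gens_orbit v p : v \in Uflat_gens k e f ->
  (exists x y, [/\ x \in fM_Le (e : M) (f : M), y \in fM_Le (e : M) (f : M),
     same_on_Re (e : M) x y & mact kXm p v = class_elt k e f x - class_elt k e f y]) \/
  (exists z, [/\ z \in fMe (e : M) (f : M), z \in Iset (f : M), z \in Iset (e : M)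
     & mact kXm p v = class_elt k e f z]).
Proof.
rewrite mem_cat => /orP[/mapP[[x y]]|/mapP[z]].
  rewrite mem_enum inE /= => /and3P[xM yM xy] ->; left.
  have [gxL pxM] := fM_Le_unit_mul p.1 p.2^-1%g xM.
  have [gyL pyM] := fM_Le_unit_mul p.1 p.2^-1%g yM.
  exists (biact p x), (biact p y); split=> //.
    apply: same_on_Re_mulr => //; apply: same_on_Re_mull => //.
      by case/setIP: xM.
    by case/setIP: yM.
  by rewrite linearB /= !act_class_elt ?fM_Le_fMe.
rewrite mem_enum inE /= => /andP[/Ltilde_below[zM zf ze] _ ->]; right.
exists (biact p z); rewrite biact_fMe ?act_class_elt //; split=> //; exact: Iset_mul.
Qed.

Lemma Uflat_lker (Y : vectType k) (L : 'Hom(kXm, Y)) :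
  (forall p v, v \in Uflat_gens k e f -> L (mact kXm p v) = 0) ->
  forall u : Uflat k e f, L (vsval u) = 0.
Proof.
move=> L0 u; apply/eqP; rewrite -memv_ker; move: (valP u); apply/subvP.
rewrite /= /gen_vs big_seq; elim/big_ind: _ => [|V1 V2 H1 H2|v vG]; first exact: sub0v.
  by rewrite subv_add H1.
apply/subvP=> _ /memv_imgP[a _ ->]; rewrite memv_ker (linfunK (act_linear_apply v)).
rewrite act_mact sum_lfunE linear_sum big1 // => p _.
by rewrite /= scale_lfunE linearZ /= (L0 p v vG) scaler0.
Qed.

Lemma gen_mem v : v \in Uflat_gens k e f -> v \in gen_vs (Uflat_gens k e f).
Proof.
move=> vG; rewrite /gen_vs (big_rem v vG) /= memvE (subv_trans _ (addvSl _ _)) //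
  -memvE.
apply/memv_imgP; exists 1; first exact: memvf.
by rewrite (linfunK (act_linear_apply v)) act1 id_lfunE.
Qed.

End ClassModule.

(** * Derivations of a monoid algebra *)

Lemma malg_mulE_elt (k : fieldType) (M : finMonoid) (x y : M) :
  malg_elt k x * malg_elt k y = malg_elt k (x * y)%g.
Proof. exact: malg_mul_elt. Qed.

Section MonoidDerivations.
Variables (k : fieldType) (M : finMonoid) (S T : algmod (malg k M)).
Local Notation A := (malg k M).

Lemma derivation_elt (d : 'Hom(A, 'Hom(S, T))) : d \in derivations S T ->
  forall x y s, d (malg_elt k (x * y)%g) s =
    mact T x (d (malg_elt k y) s) + d (malg_elt k x) (mact S y s).
Proof.
move=> /derivationsP dA x y s.
by rewrite -malg_mulE_elt dA add_lfunE !comp_lfunE.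
Qed.

Lemma cocycle_derivation (delta : M -> 'Hom(S, T)) :
  (forall x y s, delta (x * y)%g s = mact T x (delta y s) + delta x (mact S y s)) ->
  exists2 d : 'Hom(A, 'Hom(S, T)), d \in derivations S T & forall m,
    d (malg_elt k m) = delta m.
Proof.
move=> deltaM.
pose d : 'Hom(A, 'Hom(S, T)) := linfun (fun a : A => \sum_m malg_coef a m *: delta m).
have dE a : d a = \sum_m malg_coef a m *: delta m.
  rewrite linfunK // => c u v; rewrite scaler_sumr -big_split; apply: eq_bigr => m _ /=.
  by rewrite malg_coefD malg_coefZ scalerDl scalerA.
have delt m : d (malg_elt k m) = delta m.
  rewrite dE (bigD1 m) //= malg_coef_elt eqxx scale1r big1 ?addr0 // => x ne.
  by rewrite malg_coef_elt (negbTE ne) scale0r.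
exists d => //; apply/derivationsP=> a b; apply/lfunP=> s.
rewrite add_lfunE !comp_lfunE.
rewrite {1}[a]malg_expand mulr_suml linear_sum sum_lfunE.
rewrite (dE a) sum_lfunE act_mact sum_lfunE -big_split /=; apply: eq_bigr => x _.
rewrite -scalerAl linearZ !scale_lfunE -scalerDr /=; congr (_ *: _).
rewrite {1}[b]malg_expand mulr_sumr linear_sum sum_lfunE.
rewrite (dE b) sum_lfunE act_mact sum_lfunE !linear_sum -big_split /=;
  apply: eq_bigr => y _.
rewrite -scalerAr linearZ !scale_lfunE /= malg_mulE_elt delt deltaM !linearZ /=.
by rewrite scalerDr.
Qed.

Lemma inner_eq (d : 'Hom(A, 'Hom(S, T))) (h : 'Hom(S, T)) :
  (forall m s, d (malg_elt k m) s = mact T m (h s) - h (mact S m s)) -> d = inner S T h.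
Proof.
move=> dh; apply/lfunP=> a; rewrite [a]malg_expand !linear_sum /=.
apply: eq_bigr => m _; rewrite !linearZ /=; congr (_ *: _); apply/lfunP=> s.
by rewrite dh innerE add_lfunE opp_lfunE !comp_lfunE.
Qed.

End MonoidDerivations.

(** * Extensions and equivariant maps on Uflat *)

Section ExtUflat.
Variables (k : fieldType) (M : finMonoid).
Hypothesis Rt : Rtrivial (gen_submonoid (idempotents M)).
Variables (S T : algmod (malg k M)) (e f : idem M).
Hypotheses (aS : apex S e) (DS : detects S e).
Hypotheses (aT : apex T f) (DT : detects T f).
Hypotheses (Ge0 : #|{: max_subgroup e}|%:R != 0 :> k).
Hypotheses (Gf0 : #|{: max_subgroup f}|%:R != 0 :> k).

Local Notation A := (malg k M).
Local Notation V := (corner_mod S e).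
Local Notation W := (corner_mod T f).
Local Notation HM := (hom_mod W V).
Local Notation Gfe := (max_subgroup f * max_subgroup e)%type.
Local Notation kXm := (kX k e f).
Local Notation U := (Uflat k e f).

Definition cut : 'Hom('Hom(S, T), 'Hom(V, W)) :=
  linfun (fun F : 'Hom(S, T) => linfun (fun v : V => cproj f (mact T f (F (cval v))))).

Lemma cutE F v : cval (cut F v) = mact T f (F (cval v)).
Proof.
have L G : linear (fun v : V => cproj f (mact T f ((G : 'Hom(S, T)) (cval v)))).
  by move=> c x y; rewrite cval_linear !linearP cproj_linear.
have L2 : linear (fun F : 'Hom(S, T) => linfun (fun v : V =>
  cproj f (mact T f (F (cval v))))).
  move=> c F1 F2; apply/lfunP=> x; rewrite (linfunK (L _)) [RHS]add_lfunE.
  rewrite [X in _ = X + _]scale_lfunE !(linfunK (L _)) add_lfunE scale_lfunE linearP.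
  exact: cproj_linear.
by rewrite (linfunK L2) (linfunK (L _)) cproj_mactK ?idemP.
Qed.

Definition uncut (F : 'Hom(V, W)) : 'Hom(S, T) :=
  linfun (fun s : S => cval (F (cproj e (mact S e s)))).

Lemma uncutE F s : uncut F s = cval (F (cproj e (mact S e s))).
Proof.
by rewrite linfunK // => c x y; rewrite linearP cproj_linear linearP cval_linear.
Qed.

Definition corner_values : 'Hom('Hom(A, 'Hom(S, T)), 'Hom(U, HM)) :=
  linfun (fun d : 'Hom(A, 'Hom(S, T)) => linfun (fun u : U =>
    class_ext e f (fun x => cut (d (malg_elt k x)) : HM) (vsval u : kXm))).

Lemma corner_valuesE d (u : U) :
  corner_values d u = class_ext e f (fun x => cut (d (malg_elt k x)) : HM) (vsval u :
    kXm).
Proof.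
have L1 d' : linear (fun u : U => class_ext e f (fun x =>
  cut (d' (malg_elt k x)) : HM) (vsval u : kXm)).
  by move=> c x y; rewrite !linearP.
have L2 : linear (fun d : 'Hom(A, 'Hom(S, T)) => linfun (fun u : U =>
    class_ext e f (fun x => cut (d (malg_elt k x)) : HM) (vsval u : kXm))).
  move=> c d1 d2; apply/lfunP=> w; rewrite (linfunK (L1 _)) [RHS]add_lfunE.
  rewrite [X in _ = X + _]scale_lfunE !(linfunK (L1 _)).
  rewrite !class_ext_sum scaler_sumr -big_split; apply: eq_bigr => C _ /=.
  by rewrite add_lfunE scale_lfunE linearP scalerDr !scalerA mulrC.
by rewrite (linfunK L2) (linfunK (L1 _)).
Qed.

Section OneDerivation.
Variable d : 'Hom(A, 'Hom(S, T)).
Hypothesis dA : d \in derivations S T.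
Local Notation delta x := (d (malg_elt k x)).

Let deltaM := derivation_elt dA.

Let below_e x v : x \in Iset (e : M) -> mact S x v = 0.
Proof. exact: apex_kill. Qed.

Let below_f x t : x \in Iset (f : M) -> mact T f (mact T x t) = 0.
Proof. by move=> xI; rewrite (apex_kill t aT xI) linear0. Qed.

Lemma delta_fIIe x v : x \in fIIe (e : M) (f : M) -> mact T f (delta x v) = 0.
Proof.
case/imset2P=> m n mI nI ->; rewrite -mulgA deltaM linearD /= below_f ?add0r.
  by rewrite below_e ?linear0 // -[(n * _)%g]mul1g mulgA Iset_mul.
by rewrite -[(_ * m)%g]mulg1 Iset_mul.
Qed.

Lemma delta_same z x y v : z \in fI (f : M) -> x \in Lclass (e : M) ->
  y \in Lclass (e : M) -> same_on_Re (e : M) x y ->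
  mact T f (delta (z * x)%g v) = mact T f (delta (z * y)%g v).
Proof.
move=> /imsetP[m mI ->] xL yL xy.
have : ((f : M) * m)%g \in Iset (f : M) by rewrite -[(_ * m)%g]mulg1 Iset_mul.
move: (_ * m)%g => w wI.
by rewrite !deltaM !linearD /= !below_f // (same_act _ aS DS xL yL xy).
Qed.

Lemma class_ext_cut x : x \in fMe (e : M) (f : M) ->
  class_ext e f (fun x => cut (delta x) : HM) (class_elt k e f x) = cut (delta x).
Proof.
move=> xM; apply: class_extE => // [y yI|z y y' zI yL y'L yy'].
  apply/lfunP=> v; apply: cval_inj; rewrite cutE delta_fIIe // zero_lfunE.
  exact/esym/linear0.
by apply/lfunP=> v; apply: cval_inj; rewrite !cutE; exact: delta_same.
Qed.

(** The outer two terms vanish on the combinations of x that generate Uflat,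
    which is why a cocycle is biequivariant there. *)
Lemma delta_biact (p : Gfe) x v :
  mact T f (delta (biact p x) v) =
  mact T (ms_val p.1 * x)%g (delta (ms_val p.2^-1%g) v) +
  mact T (ms_val p.1) (delta x (mact S (ms_val p.2^-1%g) v)) +
  mact T f (delta (ms_val p.1) (mact S x (mact S (ms_val p.2^-1%g) v))).
Proof.
rewrite /biact !deltaM !linearD /= -!mactME mulgA (ms_mul_e p.1).1 -addrA.
by rewrite mactME.
Qed.

Lemma cut_biact_below (p : Gfe) z : z \in Iset (f : M) -> z \in Iset (e : M) ->
  cut (delta (biact p z)) = hom_act W V p (cut (delta z)).
Proof.
move=> zf ze; apply/lfunP=> v; apply: cval_inj; rewrite cutE hom_actE cval_grp cutE.
rewrite delta_biact (apex_kill _ aT) ?add0r; last by rewrite -[(_ * z)%g]mulg1 Iset_mul.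
rewrite (below_e _ ze) !linear0 addr0 -mactME (ms_mul_e p.1).2.
by rewrite cval_grp.
Qed.

Lemma cut_biact_same (p : Gfe) x y : x \in fM_Le (e : M) (f : M) ->
  y \in fM_Le (e : M) (f : M) -> same_on_Re (e : M) x y ->
  cut (delta (biact p x)) - cut (delta (biact p y)) =
  hom_act W V p (cut (delta x) - cut (delta y)).
Proof.
move=> xM yM xy; have [->|[xf yf]] := same_fM_Le xM yM xy.
  by rewrite !subrr linear0.
have [xL yL] : x \in Lclass (e : M) /\ y \in Lclass (e : M).
  by case/setIP: xM => _ ->; case/setIP: yM.
rewrite linearB; apply/lfunP=> v; apply: cval_inj.
rewrite !(add_lfunE, opp_lfunE) !hom_actE !cvalB.
rewrite !cutE !cval_grp !cutE !cval_grp !delta_biact.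
rewrite !(@apex_kill _ _ T f (_ * _)%g) //; try by rewrite -[(_ * _)%g]mulg1 Iset_mul.
rewrite !add0r (same_act _ aS DS xL yL xy) opprD addrACA subrr addr0.
by rewrite -!mactME (ms_mul_e p.1).2.
Qed.

(** A combination of generators of Uflat acts as zero on S, and multiplies into
    I(f), which acts as zero on T; so the cocycle is equivariant on it. *)
Lemma corner_values_homA : corner_values d \in homA U HM.
Proof.
apply/(@homA_mactP k (group_monoid Gfe)) => q u; rewrite !corner_valuesE mact_submod.
pose Phi : 'Hom(kXm, HM) := class_ext e f (fun x => cut (delta x) : HM).
pose L : 'Hom(kXm, HM) := (Phi \o mact kXm q)%VF - (mact HM q \o Phi)%VF.
suff /eqP : L (vsval u) = 0.
  by rewrite add_lfunE opp_lfunE !comp_lfunE subr_eq0 => /eqP.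
apply: (Uflat_lker (L := L)) => p v vG.
have HMact F : mact HM q F = hom_act W V q F by rewrite mact_lin_mod.
rewrite add_lfunE opp_lfunE !comp_lfunE; apply/eqP; rewrite subr_eq0; apply/eqP.
case: (gens_orbit p vG) => [[x [y [xM yM xy ->]]]|[z [zM zf ze ->]]].
  rewrite !linearB /= !act_class_elt ?fM_Le_fMe // !class_ext_cut ?biact_fMe
    ?fM_Le_fMe //.
  by rewrite (cut_biact_same _ xM yM xy) -HMact linearB.
by rewrite act_class_elt // !class_ext_cut ?biact_fMe // cut_biact_below // HMact.
Qed.

(** All elements of fMe below both J-classes are covered: those that are not
    generators either belong to fI(f)I(e)e or have their class outside X. *)
Lemma corner_values_inner : corner_values d = 0 -> exists h, d = inner S T h.
Proof.
move=> d0; have dv v : v \in Uflat_gens k e f -> class_ext e f (fun x =>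
  cut (delta x) : HM) v = 0.
  move=> vG; have := corner_valuesE d (vsproj _ v : U).
  by rewrite vsprojK ?gen_mem // d0 zero_lfunE => <-.
have cut_value (F : 'Hom(S, T)) s : mact T f (F (mact S e s)) = cval (cut F (cproj e
  (mact S e s))).
  by rewrite cutE cproj_mactK ?idemP.
have [h hE] : exists h : 'Hom(S, T), forall m s, delta m s = mact T m (h s) - h (mact
  S m s).
  apply: (@delta_trivial _ _ Rt S T e f) => // [z s zM zf ze|x y s xM yM xy].
    have [zt|zt] := boolP (z \in Ltilde_class (e : M)); last first.
      by rewrite delta_fIIe //; exact: not_Ltilde_fIIe.
    rewrite cut_value -class_ext_cut //.
    have [zX|zX] := boolP (Defs.equiv_class (e : M) (f : M) z \in Xset (e : M) (f :
      M)); last first.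
      by rewrite (class_elt0 k zM zX) linear0 zero_lfunE; exact: linear0.
    rewrite dv ?zero_lfunE; first exact: linear0.
    rewrite mem_cat; apply/orP; right; apply/mapP; exists z => //.
    rewrite mem_enum inE /= zX andbT; apply/setDP; split; last first.
      by rewrite LclassE negb_and -in_Iset ze orbT.
    apply/setIP; split=> //; apply/imsetP; exists z => //.
    by case/fMeP: zM => ->.
  rewrite !cut_value; suff -> : cut (delta x) = cut (delta y) by [].
  apply/eqP; rewrite -subr_eq0 -(class_ext_cut (fM_Le_fMe xM)) -(class_ext_cut
    (fM_Le_fMe yM)) -linearB.
  apply/eqP/dv; rewrite mem_cat; apply/orP; left; apply/mapP; exists (x, y) => //.
  by rewrite mem_enum inE /= xM yM.
by exists h; apply: inner_eq.
Qed.

End OneDerivation.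

Lemma corner_values_of_inner h : corner_values (inner S T h) = 0.
Proof.
have dE x s : inner S T h (malg_elt k x) s = mact T x (h s) - h (mact S x s).
  by rewrite innerE add_lfunE opp_lfunE !comp_lfunE.
apply/lfunP=> u; rewrite corner_valuesE zero_lfunE.
apply: (Uflat_lker (L := class_ext e f _)) => p v vG.
case: (gens_orbit p vG) => [[x [y [xM yM xy ->]]]|[z [zM zf ze ->]]].
  rewrite linearB /= !(class_ext_cut (inner_derivation h)) ?fM_Le_fMe //.
  have [->|[xf yf]] := same_fM_Le xM yM xy; first by rewrite subrr.
  have [xL yL] : x \in Lclass (e : M) /\ y \in Lclass (e : M).
    by case/setIP: xM => _ ->; case/setIP: yM.
  apply/eqP; rewrite subr_eq0; apply/eqP/lfunP=> w; apply: cval_inj.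
  by rewrite !cutE !dE (apex_kill _ aT xf) (apex_kill _ aT yf) (same_act _ aS DS xL yL
    xy).
rewrite (class_ext_cut (inner_derivation h)) //; apply/lfunP=> w; apply: cval_inj.
rewrite cutE dE (apex_kill _ aT zf) (apex_kill _ aS ze) linear0 subrr linear0.
by rewrite zero_lfunE; exact/esym/linear0.
Qed.

Lemma Gfe_neq0 : #|{: Gfe}|%:R != 0 :> k.
Proof. by rewrite card_prod natrM mulf_neq0. Qed.

(** Every equivariant map on Uflat comes from a derivation: extend it to kX by
    Maschke's theorem, read it as a biequivariant theta on fMe, and take the
    cocycle m |-> q m - q 1 m. *)
Lemma corner_values_onto (phi : 'Hom(U, HM)) : phi \in homA U HM ->
  exists2 d, d \in derivations S T & corner_values d = phi.
Proof.
move=> phiA.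
have [Phi PhiA PhiE] : exists2 Phi : 'Hom(kXm, HM), Phi \in homA kXm HM &
    forall u : U, Phi (vsval u) = phi u.
  have [p pA [pU pid]] := @maschke k _ kXm Gfe_neq0 (gen_submodule (Uflat_gens k e f)).
  exists (phi \o (linfun (vsproj (gen_submodule (Uflat_gens k e f))) \o p))%VF.
    exact: homA_comp phiA (homA_proj pA pU).
  by move=> u; rewrite !comp_lfunE lfunE /= pid ?subvsP // vsvalK.
have PhiM (p0 : Gfe) v : Phi (mact kXm p0 v) = hom_act W V p0 (Phi v).
  by rewrite (homA_mactP Phi).1 // mact_lin_mod.
pose theta x : 'Hom(S, T) := uncut (Phi (class_elt k e f x)).
have thetaB : biequivariant e f theta.
  move=> g h x s xM; rewrite /theta !uncutE.
  have -> : (ms_val g * x * ms_val h)%g = biact (g,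
    h^-1%g) x by rewrite /biact /= invgK.
  rewrite -act_class_elt // PhiM hom_actE /= invgK cval_grp.
  rewrite grp_cproj; last by rewrite -mactME idemP.
  by rewrite -!mactME (ms_mul_e h).1 (ms_mul_e h).2.
have thetaF z : ((f : M) * z = z)%g -> z \in Iset (f : M) -> factors e theta z.
  move=> fz zI; have zfI : z \in fI (f : M) by apply/imsetP; exists z.
  split=> [x y xL yL xy|n ne nI]; rewrite /theta.
    congr (uncut (Phi _)); apply: class_elt_equiv; apply/orP; right.
    apply/exists_inP; exists z => //; apply/exists_inP; exists x => //.
    by apply/exists_inP; exists y; rewrite // xy !eqxx.
  rewrite class_elt_fIIe; last by apply/imset2P; exists z n; rewrite // fz -mulgA ne.
  rewrite linear0; apply/lfunP=> s; rewrite uncutE !zero_lfunE; exact: linear0.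
pose q := qmap e f theta.
have [|d dA dE] := @cocycle_derivation k M S T (fun m => q m - (q 1%g \o mact S m)%VF).
  move=> x y s; rewrite !(add_lfunE, opp_lfunE, comp_lfunE) linearB /=.
  rewrite (qmap_cocycle Rt aS DS aT DT Ge0 Gf0 x y s thetaB thetaF) mactME.
  by rewrite -!addrA; congr (_ + _); rewrite addrCA.
exists d => //; apply/lfunP=> u; rewrite corner_valuesE -PhiE.
pose L : 'Hom(kXm, HM) := class_ext e f (fun x => cut (d (malg_elt k x)) : HM) - Phi.
suff /eqP : L (vsval u) = 0 by rewrite add_lfunE opp_lfunE subr_eq0 => /eqP.
have theta_cut x v : x \in fMe (e : M) (f : M) ->
    mact T f (q x (cval v)) = cval (Phi (class_elt k e f x) v).
  move=> xM; have [fx _] := fMeP xM.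
  rewrite (qmapR Rt aT Gf0 _ _ thetaB (mem_Rclass f)) fx.
  by rewrite (right_sum_corner Rt aS Ge0 thetaB xM (cval_e v)) uncutE cval_e cvalK.
apply: Uflat_lker => {u} g v vG; rewrite add_lfunE opp_lfunE; apply/eqP;
  rewrite subr_eq0; apply/eqP.
case: (gens_orbit g vG) => [[x [y [xM yM xy ->]]]|[z [zM zf ze ->]]].
  have [xL yL] : x \in Lclass (e : M) /\ y \in Lclass (e : M).
    by case/setIP: xM => _ ->; case/setIP: yM.
  rewrite !linearB /= !(class_ext_cut dA) ?fM_Le_fMe //; apply/lfunP=> w;
    apply: cval_inj.
  rewrite !(add_lfunE, opp_lfunE) !cvalB.
  rewrite !cutE !dE !(add_lfunE, opp_lfunE, comp_lfunE) !linearB /= !theta_cut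
    ?fM_Le_fMe //.
  by rewrite (same_act _ aS DS xL yL xy) opprK addrACA addNr addr0.
rewrite (class_ext_cut dA) //; apply/lfunP=> w; apply: cval_inj.
rewrite cutE dE !(add_lfunE, opp_lfunE, comp_lfunE) (apex_kill _ aS ze) linear0 subr0.
exact: theta_cut.
Qed.

(** The restriction of derivations to corners, read on Uflat, is onto the
    equivariant maps with the inner derivations as kernel. *)
Theorem ext1_dim_Uflat : ext1_dim S T = \dim (homA U HM).
Proof.
rewrite ext1_dim_derivations.
have <- : (corner_values @: derivations S T)%VS = homA U HM.
  apply/eqP; rewrite eqEsubv; apply/andP; split; apply/subvP=> phi.
    by case/memv_imgP=> d dA ->; exact: corner_values_homA.
  by move=> phiA; have [d dA <-] := corner_values_onto phiA; exact: memv_img.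
have <- : (derivations S T :&: lker corner_values)%VS = limg (inner S T).
  apply/vspaceP=> d; rewrite memv_cap (memv_ker corner_values); apply/andP/idP.
    by case=> dA /eqP d0; have [h ->] := corner_values_inner dA d0;
      rewrite memv_img ?memvf.
  case/memv_imgP=> h _ ->; rewrite corner_values_of_inner.
  by split; first exact: inner_derivation.
by rewrite -(limg_ker_dim corner_values (derivations S T)) addKn.
Qed.

End ExtUflat.

(** * The quiver *)

Section Quiver.
Variables (M : finMonoid) (k : fieldType) (n : nat) (e : 'I_n -> idem M).
Hypothesis Rt : Rtrivial (gen_submonoid (idempotents M)).
Hypothesis char_not_dvd : forall (a : idem M) (p : nat),
  p \in [pchar k] -> ~~ (p %| #|{: max_subgroup a}|)%N.
Hypothesis k_splits : forall a : idem M, splits k (max_subgroup a).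
Hypothesis e_reps : regular_reps e.

Lemma max_subgroup_order_neq0 (a : idem M) : #|{: max_subgroup a}|%:R != 0 :> k.
Proof.
apply/negP=> G0; have Gpos : (0 < #|{: max_subgroup a}|)%N.
  by apply/card_gt0P; exists 1%g.
have [p pP] := natf0_pchar Gpos G0.
by move: (char_not_dvd a pP); rewrite (dvdn_pcharf pP) G0.
Qed.

Lemma apex_index_exists (S : algmod (malg k M)) : simple_mod S -> exists i,
  apex S (e i).
Proof.
move=> Ss; have [m [mreg mapex]] := simple_apex Ss.
by have [i [im _]] := e_reps mreg; exists i; exact: mapex.
Qed.

Lemma apex_index_unique (S : algmod (malg k M)) i j : apex S (e i) -> apex S (e j) ->
  i = j.
Proof.
move=> ai aj; have reg : regular_Jclass (e i : M).
  by exists (e i : M); [exact: (valP (e i)) | rewrite inE].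
have [l [_ lu]] := e_reps reg.
by rewrite -(lu i) ?inE // -(lu j) // (apex_Jclass aj ai).
Qed.

Local Notation quiver_vertex := {S : algmod (malg k M) | simple_mod S}.

Definition apex_index (v : quiver_vertex) : 'I_n :=
  xchoose (apex_index_exists (svalP v)).

Lemma apex_indexP v : apex (sval v) (e (apex_index v)).
Proof. exact: (xchooseP (apex_index_exists (svalP v))). Qed.

Definition pair_vertex (v : quiver_vertex) : {i : 'I_n & kG_simple k e i} :=
  existT _ (apex_index v)
    (exist _ (corner_mod (sval v) (e (apex_index v)))
      (corner_simple (svalP v) (apex_indexP v))).

Lemma apex_isomod (S T : algmod (malg k M)) (a : idem M) : isomod S T -> apex S a ->
  apex T a.
Proof.
case/isomodP=> g [h [gA hA gK hK]] /andP[/forall_inP S0 Sa].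
have E m s : h (mact T m (g s)) = mact S m s by rewrite -(homA_mactP g).1 // gK.
apply/andP; split.
  apply/forall_inP=> m /S0/eqP m0; apply/eqP/lfunP=> t; apply: (can_inj hK).
  by rewrite -[t]hK E m0 !zero_lfunE linear0.
apply: contra_neqN Sa => /eqP Ta; apply/lfunP=> s.
by rewrite -E Ta !zero_lfunE linear0.
Qed.

Lemma same_pair_corner (S : algmod (malg k M)) i j pS (V : kG_simple k e j) :
  i = j -> isomod (corner_mod S (e j)) (sval V) ->
  same_pair (existT _ i (exist _ (corner_mod S (e i)) pS)) (existT _ j V).
Proof. by move=> ij; subst i => SV; exact: SamePair. Qed.

Lemma same_pair_isomod p q : same_pair (k := k) (e := e) p q ->
  forall S T : algmod (malg k M), simple_mod S -> simple_mod T ->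
  apex S (e (tag p)) -> apex T (e (tag q)) ->
  isomod (corner_mod S (e (tag p))) (sval (tagged p)) ->
  isomod (corner_mod T (e (tag q))) (sval (tagged q)) -> isomod S T.
Proof.
case=> i V W VW S T Ss Ts /= aS aT SV TW.
apply: (isomod_of_corner Rt (max_subgroup_order_neq0 (e i)) aS aT).
- exact: simple_detects.
- exact: simple_detects.
exact: isomod_trans SV (isomod_trans VW (isomod_sym TW)).
Qed.

Lemma arrows_pair_vertex v w m :
  ext1_dim (sval v) (sval w) = m <->
  has_multiplicity (Uflat k (e (apex_index v)) (e (apex_index w)))
    (tensor_dual (corner_mod (sval w) (e (apex_index w)))
                 (corner_mod (sval v) (e (apex_index v)))) m.
Proof.
have [av aw] := (apex_indexP v, apex_indexP w).
have Vs := corner_simple (svalP v) av; have Ws := corner_simple (svalP w) aw.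
have Ve := k_splits Vs; have We := k_splits Ws.
have [Ge Gf] := (max_subgroup_order_neq0 (e (apex_index v)),
  max_subgroup_order_neq0 (e (apex_index w))).
rewrite (ext1_dim_Uflat Rt av (simple_detects (svalP v) av) aw (simple_detects (svalP
  w) aw) Ge Gf).
have Gfe := Gfe_neq0 Ge Gf.
have ZZ := tensor_dual_hom (corner_mod (sval w) (e (apex_index w))) (corner_mod (sval
  v) (e (apex_index v))).
have Zs := hom_mod_simple Ws Vs We Ve Gfe.
have Ze := hom_mod_end Ws We Ve.
have mE := has_multiplicityE m (@maschke k _ (Uflat k (e (apex_index v)) (e
  (apex_index w))) Gfe) Zs Ze.
split=> [E|H].
  by apply: has_multiplicity_isor (isomod_sym ZZ) _; apply: (proj2 mE).
by apply/esym/(proj1 mE); exact: has_multiplicity_isor ZZ H.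
Qed.

Lemma pair_vertex_onto w : exists v, same_pair (pair_vertex v) w.
Proof.
case: w => i [V Vs]; have aV := coind_apex Vs.
have Ss : simple_mod (coind_mod V).
  apply: (simple_of_corner Rt (max_subgroup_order_neq0 (e i)) aV (@coind_detects _ _ _
    V)).
  exact: simple_isomod (isomod_sym (coind_corner V)) Vs.
pose v : quiver_vertex := exist _ (coind_mod V) Ss.
exists v; apply: same_pair_corner; last exact: coind_corner.
exact: apex_index_unique (apex_indexP v) aV.
Qed.

Lemma pair_vertex_eq v w : isomod (sval v) (sval w) <-> same_pair (pair_vertex v)
  (pair_vertex w).
Proof.
split=> [vw|].
  apply: same_pair_corner; last exact: corner_isomod.
  exact: apex_index_unique (apex_isomod vw (apex_indexP v)) (apex_indexP w).
move/same_pair_isomod; apply.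
- exact: (svalP v).
- exact: (svalP w).
- exact: apex_indexP.
- exact: apex_indexP.
- exact: isomod_refl.
exact: isomod_refl.
Qed.

End Quiver.

Local Close Scope ring_scope.

Theorem theorem5p10 (M : finMonoid) (k : fieldType) (n : nat) (e : 'I_n -> idem M)
  (idempotents_Rtrivial : Rtrivial (gen_submonoid (idempotents M)))
  (char_not_dvd : forall (a : idem M) (p : nat),
     p \in [pchar k]%R -> ~~ (p %| #|{: max_subgroup a}|))
  (k_splits : forall a : idem M, splits k (max_subgroup a))
  (e_reps : regular_reps e) :
  digraph_iso (quiver (malg k M)) (pair_quiver k e).
Proof.
exists (pair_vertex e_reps); split=> [v w|w|v w m] /=.
- exact: pair_vertex_eq.
- exact: pair_vertex_onto.
exact: arrows_pair_vertex.
Qed.
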